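(* Let $T^{\mathcal F}$ be a maximally modulated singular integral operator on $\mathbb{R}^n$ which is sub-linear, and let $T^{\mathcal F}_*$ be the associated (maximally) modulated maximal singular integral. Let $1\le q,r<\infty$. Suppose that $T^{\mathcal F}$ satisfies the $W_q$ property and that $M^{\sharp}_{T^{\mathcal F},\alpha}$ is of weak type $(r,r)$ for some $\alpha\ge3$. Let $s=\max(q,r)$. Then there is a constant $C$, independent of $f$, such that for every compactly supported $f\in L^s(\mathbb{R}^n)$ there exist $\frac{1}{2\alpha^n}$-sparse families $\mathcal S_1,\dots,\mathcal S_{n+1}$, with $\mathcal S_j$ contained in a dyadic grid $D^j$ for each $j$, such that $$|T^{\mathcal F}_*f(x)|\le C\sum_{j=1}^{n+1}A^s_{\mathcal S_j}f(x)\qquad\text{for a.e. }x\in\mathbb{R}^n,$$ where $A^s_{\mathcal S_j}f(x)=\sum_{Q\in\mathcal S_j}\langle f\rangle_{s,Q}\,\chi_Q(x)$.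
   Context: Cubes are cubes in $\mathbb{R}^n$ with sides parallel to the axes; $\alpha Q$ is the cube concentric with $Q$ with side length $\alpha$ times that of $Q$; $|E|$ is Lebesgue measure, and $\chi_E$ is the indicator function of $E$. $D^1,\dots,D^{n+1}$ are $n+1$ general dyadic grids in $\mathbb{R}^n$, chosen so that every cube $Q\subset\mathbb{R}^n$ is contained in some cube $Q'$ belonging to one of the $D^j$ with $|Q'|\le c_n|Q|$. Maximally modulated operators. $T$ is a linear operator of weak type $(1,1)$ such that $Tf(x)=\int_{\mathbb{R}^n}K(x,y)f(y)\,dy$ for $x\notin\operatorname{supp}f$, where the kernel $K$ satisfies the $L^{\rho}$-Hörmander condition for some exponent $\rho\in[1,\infty]$: $$\sup_{Q}\ \sup_{x',x''\in\frac12Q}\ \sum_{k=1}^\infty|2^kQ|^{1/\rho'}\,\|K(x',\cdot)-K(x'',\cdot)\|_{L^{\rho}(2^kQ\setminus2^{k-1}Q)}<\infty,$$ with $\rho'$ the conjugate exponent of $\rho$. For $\epsilon>0$, $T_\epsilon f(x)=\int_{|x-y|>\epsilon}K(x,y)f(y)\,dy$. Let $\mathcal F=\{\phi_\theta\}_{\theta\in A}$ be a family of real-valued measurable functions on $\mathbb{R}^n$ indexed by a set $A$, and $\mathcal M^{\phi_\theta}f(x)=e^{2\pi i\phi_\theta(x)}f(x)$. Define $$T^{\mathcal F}f(x)=\sup_{\theta\in A}|T(\mathcal M^{\phi_\theta}f)(x)|,\qquad T^{\mathcal F}_*f(x)=\sup_{\epsilon>0}\sup_{\theta\in A}|T_\epsilon(\mathcal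 M^{\phi_\theta}f)(x)|.$$ Averages: $\langle f\rangle_{p,Q}=\left(\frac1{|Q|}\int_Q|f|^p\right)^{1/p}$. $W_q$ property: a sub-linear operator $U$ satisfies $W_q$ if there is a non-increasing function $\psi_{U,q}$ on $(0,1)$ such that for every cube $Q$, every $f\in L^q(Q)$ and every $0<\lambda<1$, $$\left|\{x\in Q:|U(f\chi_Q)(x)|>\psi_{U,q}(\lambda)\langle f\rangle_{q,Q}\}\right|\le\lambda|Q|.$$ Sharp maximal operator: for $\alpha\ge3$, $$M^{\sharp}_{T^{\mathcal F},\alpha}f(x)=\sup_{Q\ni x}\ \operatorname*{ess\,sup}_{x',x''\in Q}\left|T^{\mathcal F}(f\chi_{\mathbb{R}^n\setminus\alpha Q})(x')-T^{\mathcal F}(f\chi_{\mathbb{R}^n\setminus\alpha Q})(x'')\right|,$$ the supremum being over all cubes $Q$ containing $x$. It is of weak type $(r,r)$ if it is bounded from $L^r$ to $L^{r,\infty}$. Sparse family: a family $\mathcal S$ of cubes is $\eta$-sparse ($0<\eta\le 1$) if there exist pairwise disjoint measurable sets $E_Q\subset Q$, $Q\in\mathcal S$, with $|E_Q|\ge\eta|Q|$. *)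

(* Defs.v *)
From HB Require Import structures.
From mathcomp Require Import all_boot all_order all_algebra.
From mathcomp Require Import complex.
From mathcomp Require Import all_classical all_reals all_analysis.
From mathcomp Require Import ess_sup_inf.

Set Implicit Arguments.
Unset Strict Implicit.
Unset Printing Implicit Defensive.

Import Order.TTheory GRing.Theory Num.Theory.
Import numFieldNormedType.Exports.

Local Open Scope classical_set_scope.
Local Open Scope ring_scope.

Fact rV_display : measure_display -> measure_display.
Proof. exact. Qed.

(* R^n is 'rV[R]_n, with the product of the Borel sigma-algebras of R *)
Section measurable_rV.
Variables (R : realType) (n : nat).

Definition coor (i : 'I_n) (x : 'rV[R]_n) : measurableTypeR R := x ord0 i.

Let rV_set0 : g_sigma_preimage coor set0.
Proof. exact: sigma_algebra0. Qed.

Let rV_setC A : g_sigma_preimage coor A -> g_sigma_preimage coor (~` A).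
Proof. exact: sigma_algebraC. Qed.

Let rV_bigcup (F : (set 'rV[R]_n)^nat) :
  (forall i, g_sigma_preimage coor (F i)) ->
  g_sigma_preimage coor (\bigcup_i (F i)).
Proof. exact: sigma_algebra_bigcup. Qed.

HB.instance Definition _ := @isMeasurable.Build
  (rV_display (R.-ocitv.-measurable).-sigma)
  'rV[R]_n (g_sigma_preimage coor) rV_set0 rV_setC rV_bigcup.

Lemma measurable_coor (i : 'I_n) : measurable_fun setT (coor i).
Proof.
move=> _ Y mY; rewrite setTI; apply: sub_sigma_algebra => /=.
rewrite -bigcup_seq/=; exists i => /=; first by rewrite mem_index_enum.
by exists Y => //; rewrite setTI.
Qed.

Lemma measurable_rVP d (X : measurableType d) (f : X -> 'rV[R]_n) :
  (forall i, measurable_fun setT (coor i \o f)) -> measurable_fun setT f.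
Proof.
move=> mf; suff fS : g_sigma_preimage (fun i => coor i \o f) `<=` measurable.
  move=> _ A mA; apply: fS; rewrite g_sigma_preimage_comp; exists A => //.
apply: smallest_sub; first exact: sigma_algebra_measurable.
rewrite -bigcup_seq; apply: bigcup_sub => i _ A [B mB <-]; exact: mf.
Qed.

End measurable_rV.

Section lebesgue_rV.
Variable R : realType.

Definition consrV n (p : measurableTypeR R * 'rV[R]_n) : 'rV[R]_n.+1 :=
  row_mx (\row_(_ < 1) p.1) p.2 : 'rV[R]_(1 + n).

Lemma consrV0 n p : @consrV n p ord0 ord0 = p.1.
Proof.
have -> : (ord0 : 'I_n.+1) = lshift n (ord0 : 'I_1) by apply/val_inj.
by apply: etrans (row_mxEl _ _ _ _) _; rewrite mxE.
Qed.

Lemma consrVS n p i : @consrV n p ord0 (lift ord0 i) = p.2 ord0 i.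
Proof.
have -> : lift ord0 i = rshift 1 i by apply/val_inj.
exact: row_mxEr.
Qed.

Lemma measurable_consrV n : measurable_fun setT (@consrV n).
Proof.
apply: measurable_rVP => i; have [j|] := unliftP ord0 i.
  move=> ->; rewrite (_ : _ \o _ = coor j \o snd).
    by apply: measurableT_comp => //; exact: measurable_coor.
  by apply/funext => p; rewrite /= /coor consrVS.
move=> ->; rewrite (_ : _ \o _ = fst) //.
by apply/funext => p; rewrite /= /coor consrV0.
Qed.

Definition boxrV n (a b : 'rV[R]_n) : set 'rV[R]_n :=
  [set x | forall i, a ord0 i <= x ord0 i < b ord0 i].

Lemma measurable_boxrV n (a b : 'rV[R]_n) : measurable (boxrV a b).
Proof.
rewrite (_ : boxrV a b =
    \bigcap_(i in setT) (coor i @^-1` `[a ord0 i, b ord0 i[%classic)).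
  apply: fin_bigcap_measurable => [|i _]; first exact: finite_finset.
  rewrite -[X in measurable X]setTI; apply: measurable_coor => //.
apply/seteqP; split => x /= xab i; first by move=> _; rewrite /= in_itv /= xab.
by have := xab i I; rewrite /= in_itv.
Qed.

Lemma preimage_consrV_box n (a b : 'rV[R]_n.+1) :
  @consrV n @^-1` boxrV a b = `[a ord0 ord0, b ord0 ord0[%classic `*`
    boxrV (\row_i a ord0 (lift ord0 i)) (\row_i b ord0 (lift ord0 i)).
Proof.
apply/seteqP; split => [p /= pab|p [/= p1 p2] i].
  split=> [|i]; first by have := pab ord0; rewrite consrV0 in_itv.
  by have := pab (lift ord0 i); rewrite consrVS !mxE.
have [j ->|->] := unliftP ord0 i.
  by have := p2 j; rewrite consrVS !mxE.
by rewrite consrV0; move: p1; rewrite in_itv.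
Qed.

HB.instance Definition _ n := isMeasurableFun.Build _ _ _ _
  (@consrV n) (@measurable_consrV n).

Section lebesgue_step.
Variables (n : nat) (m : {sigma_finite_measure set 'rV[R]_n -> \bar R}).
Local Open Scope ereal_scope.

Definition lebesgue_step : set 'rV[R]_n.+1 -> \bar R :=
  pushforward (@lebesgue_measure R \x m) (@consrV n).

Let lebesgue_step0 : lebesgue_step set0 = 0.
Proof. exact: measure0. Qed.

Let lebesgue_step_ge0 A : 0 <= lebesgue_step A.
Proof. exact: measure_ge0. Qed.

Let lebesgue_step_sigma_additive : semi_sigma_additive lebesgue_step.
Proof. exact: measure_semi_sigma_additive. Qed.

HB.instance Definition _ := isMeasure.Build _ _ _ lebesgue_step
  lebesgue_step0 lebesgue_step_ge0 lebesgue_step_sigma_additive.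

Let lebesgue_step_sigma_finite : sigma_finite setT lebesgue_step.
Proof.
pose g (x : 'rV[R]_n.+1) : measurableTypeR R * 'rV[R]_n :=
  (coor ord0 x, \row_i x ord0 (lift ord0 i)).
have mg : measurable_fun setT g.
  apply/measurable_fun_pairP; split; first exact: measurable_coor.
  apply: measurable_rVP => i; rewrite (_ : _ \o _ = coor (lift ord0 i)).
    exact: measurable_coor.
  by apply/funext => x; rewrite /= /coor mxE.
have gK : cancel (@consrV n) g.
  move=> p; rewrite /g /coor consrV0; case: p => x y; congr pair => /=.
  by apply/rowP => i; rewrite mxE consrVS.
have /sigma_finiteP[F [TF ndF Foo]] :=
  sigma_finiteT (@lebesgue_measure R
                 : {sigma_finite_measure set (measurableTypeR R) -> \bar R}).
have /sigma_finiteP[G [TG ndG Goo]] := sigma_finiteT m.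
exists (fun k => g @^-1` (F k `*` G k)).
  apply/seteqP; split => // x _; rewrite -preimage_bigcup /preimage/=.
  have [i _ Fi] : (\bigcup_i F i) (g x).1 by rewrite -TF.
  have [j _ Gj] : (\bigcup_i G i) (g x).2 by rewrite -TG.
  exists (maxn i j) => //; split.
    by move: Fi; exact/subsetPset/ndF/leq_maxl.
  by move: Gj; exact/subsetPset/ndG/leq_maxr.
move=> k; have [mF Fk] := Foo k; have [mG Gk] := Goo k; split.
  by rewrite -[X in measurable X]setTI; apply: mg => //; exact: measurableX.
rewrite /lebesgue_step /pushforward -comp_preimage.
rewrite (_ : g \o _ = id) ?preimage_id; last first.
  by apply/funext => p /=; rewrite gK.
by rewrite product_measure1E // lte_mul_pinfty // ge0_fin_numE.
Qed.

HB.instance Definition _ := Measure_isSigmaFinite.Build _ _ _ lebesgue_step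
  lebesgue_step_sigma_finite.

End lebesgue_step.

(* n-dimensional Lebesgue measure on the Borel sets, by iterated products;
   lebesgue_rV_box below gives its value on boxes *)
Fixpoint lebesgue_rV n : {sigma_finite_measure set 'rV[R]_n -> \bar R} :=
  if n is n'.+1 then lebesgue_step (lebesgue_rV n') else \d_(0 : 'rV[R]_0).

Lemma lebesgue_rV_box n (a b : 'rV[R]_n) :
  (forall i, a ord0 i <= b ord0 i) ->
  lebesgue_rV n (boxrV a b) = (\prod_i (b ord0 i - a ord0 i))%:E.
Proof.
elim: n a b => [|n IH] a b ab /=.
  rewrite big_ord0 diracE mem_set //= => -[].
  by [].
rewrite /lebesgue_step /pushforward preimage_consrV_box product_measure1E //.
- rewrite IH; last by move=> i; rewrite !mxE.
  rewrite big_ord_recl EFinM; congr (_ * _)%E.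
    apply: etrans (lebesgue_measure_itv _) _; rewrite /= lte_fin.
    case: ltP => // ba; suff -> : a ord0 ord0 = b ord0 ord0 by rewrite subrr.
    by apply/eqP; rewrite eq_le ab.
  by congr EFin; apply: eq_bigr => i _; rewrite !mxE.
- exact: measurable_boxrV.
Qed.

End lebesgue_rV.

Section cubes.
Variables (R : realType) (n : nat).

(* All cubes are taken half-open, so that the cubes of a given side length in a
   dyadic grid can partition the space. *)
Record cube := Cube { corner : 'rV[R]_n; side : R; side_gt0 : 0 < side }.

HB.instance Definition _ := gen_eqMixin cube.
HB.instance Definition _ := gen_choiceMixin cube.

Definition cube_set (Q : cube) : set 'rV[R]_n :=
  [set x | forall i, corner Q ord0 i <= x ord0 i < corner Q ord0 i + side Q].

Definition dilate (a : R) (Q : cube) : set 'rV[R]_n :=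
  [set x | forall i,
    corner Q ord0 i + side Q / 2 - a * side Q / 2 <= x ord0 i
      < corner Q ord0 i + side Q / 2 + a * side Q / 2].

Definition dyadic_grid (D : set cube) :=
  [/\ forall Q, D Q -> exists k : int, side Q = 2 ^ k,
      forall Q Q', D Q -> D Q' ->
        [\/ cube_set Q `&` cube_set Q' = cube_set Q,
            cube_set Q `&` cube_set Q' = cube_set Q'
          | cube_set Q `&` cube_set Q' = set0]
    & forall k : int, let Dk := D `&` [set Q | side Q = 2 ^ k] in
        \bigcup_(Q in Dk) cube_set Q = setT /\ trivIset Dk cube_set].

Local Notation mu := (lebesgue_rV R n).

Definition covering_grids (I : Type) (D : I -> set cube) :=
  exists c : R, forall Q, exists j Q',
    [/\ D j Q', cube_set Q `<=` cube_set Q'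
      & (mu (cube_set Q') <= c%:E * mu (cube_set Q))%E].

Definition sparse (eta : R) (S : set cube) :=
  exists E : cube -> set 'rV[R]_n,
    trivIset S E /\
    forall Q, S Q ->
      [/\ measurable (E Q), E Q `<=` cube_set Q
        & (eta%:E * mu (cube_set Q) <= mu (E Q))%E].

End cubes.

Section operators.
Variables (R : realType) (n : nat).
Local Notation Rn := 'rV[R]_n.
Local Notation mu := (lebesgue_rV R n).
Local Notation normc := ComplexField.Normc.normc.

Implicit Types (f g : Rn -> R[i]) (Q : cube R n) (x y : Rn).
Implicit Types (T : (Rn -> R[i]) -> Rn -> R[i]).
Implicit Types (U : (Rn -> R[i]) -> Rn -> \bar R).
Implicit Types (K : Rn -> Rn -> R[i]).

Definition enorm x : R := Num.sqrt (\sum_i x ord0 i ^+ 2).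

Definition cmeasurable (D : set Rn) f :=
  measurable_fun D (fun x => complex.Re (f x) : measurableTypeR R) /\
  measurable_fun D (fun x => complex.Im (f x) : measurableTypeR R).

Definition inLp (p : R) (D : set Rn) f :=
  cmeasurable D f /\ (\int[mu]_(x in D) (normc (f x) `^ p)%:E < +oo)%E.

Definition Lp_norm (p : R) f : \bar R :=
  Lnorm mu p%:E (fun x => (normc (f x))%:E).

Definition avg (p : R) Q f : \bar R :=
  (((mu (cube_set Q))^-1 * \int[mu]_(x in cube_set Q) (normc (f x) `^ p)%:E)
     `^ p^-1)%E.

(* The integral of a complex function; it is 0 when the function is not
   absolutely integrable. *)
Definition cintegral (D : set Rn) f : R[i] :=
  if `[< inLp 1 D f >] then
    Complex (\int[mu]_(x in D) complex.Re (f x))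
            (\int[mu]_(x in D) complex.Im (f x))
  else 0.

Definition fsupp f : set Rn := closure [set x | f x != 0].

Definition cutoff f (E : set Rn) : Rn -> R[i] := fun x => f x * \1_E x.

(* Suprema over uncountable families need not be measurable, so the level sets
   below are measured by the outer measure [mu_ext mu]; it coincides with mu on
   measurable sets. *)
Definition weak_type (p : R) U :=
  exists C : R, forall f, inLp p setT f -> forall t : R, 0 < t ->
    (t%:E * mu_ext mu [set x | t%:E < `|U f x|] `^ p^-1
       <= C%:E * Lp_norm p f)%E.

Definition hormander_sum K (rho : \bar R) Q x' x'' : \bar R :=
  (\sum_(1 <= k <oo)
     mu (dilate (2 ^+ k) Q) `^ fine (hoelder_conjugate rho)^-1 *
     Lnorm mu rho (fun y =>
       (normc (K x' y - K x'' y) *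
        \1_(dilate (2 ^+ k) Q `\` dilate (2 ^+ k.-1) Q) y)%:E))%E.

Definition hormander K (rho : \bar R) :=
  (ereal_sup [set ereal_sup
     [set hormander_sum K rho Q x.1 x.2
        | x in dilate 2^-1 Q `*` dilate 2^-1 Q] | Q in [set: cube R n]]
   < +oo)%E.

(* T is an operator on L^1; as such it is only required to be linear up to null
   sets. Kernels satisfying an L^rho-Hormander condition may be unbounded away
   from the diagonal, so the kernel representation is required at those
   points off the support where the integral converges absolutely. *)
Record singular_integral T K (rho : \bar R) : Prop := SingularIntegral {
  si_linear : forall (a b : R[i]) f g, inLp 1 setT f -> inLp 1 setT g ->
    {ae mu, forall x, T (fun y => a * f y + b * g y) x = a * T f x + b * T g x};
  si_weak11 : weak_type 1 (fun f x => (normc (T f x))%:E);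
  si_kernel_measurable : forall x, cmeasurable setT (K x);
  si_kernel : forall f x, inLp 1 setT f -> ~ fsupp f x ->
    inLp 1 setT (fun y => K x y * f y) ->
    T f x = cintegral setT (fun y => K x y * f y);
  si_hormander : hormander K rho }.

Definition truncated K (e : R) f x : R[i] :=
  cintegral [set y | e < enorm (x - y)] (fun y => K x y * f y).

Section modulated.
Variables (A : Type) (phi : A -> Rn -> R).

Definition modulation (th : A) f : Rn -> R[i] := fun x =>
  Complex (cos (2 * pi * phi th x)) (sin (2 * pi * phi th x)) * f x.

Definition max_modulated T f x : \bar R :=
  ereal_sup [set (normc (T (modulation th f) x))%:E | th in [set: A]].

Definition max_modulated_star K f x : \bar R :=
  ereal_sup [set ereal_sup
    [set (normc (truncated K e (modulation th f) x))%:E | th in [set: A]]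
    | e in [set e : R | 0 < e]].

End modulated.

Definition sublinear U :=
  (forall f g, inLp 1 setT f -> inLp 1 setT g ->
     {ae mu, forall x, `|U (fun y => f y + g y)%R x| <= `|U f x| + `|U g x|}%E) /\
  (forall (c : R[i]) f, inLp 1 setT f ->
     {ae mu, forall x, `|U (fun y => c * f y)%R x|
                       = (normc c)%:E * `|U f x|}%E).

Definition W_property (q : R) U :=
  exists psi : R -> R,
    {in `]0, 1[ &, forall a b, a <= b -> psi b <= psi a} /\
    forall Q f (lam : R), inLp q (cube_set Q) f -> 0 < lam < 1 ->
      (mu_ext mu (cube_set Q `&`
         [set x | (psi lam)%:E * avg q Q f < `|U (cutoff f (cube_set Q)) x|])
       <= lam%:E * mu (cube_set Q))%E.

Definition sharp_maximal U (alpha : R) f x : \bar R :=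
  ereal_sup [set ess_sup (mu \x mu)%E (fun z : Rn * Rn =>
      `|U (cutoff f (~` dilate alpha Q)) z.1
        - U (cutoff f (~` dilate alpha Q)) z.2|
      * (\1_(cube_set Q `*` cube_set Q) z)%:E)%E
    | Q in [set Q | cube_set Q x]].

Definition sparse_operator (p : R) (S : set (cube R n)) f x : \bar R :=
  (\esum_(Q in S) (avg p Q f * (\1_(cube_set Q) x)%:E))%E.

End operators.

(* Main.v *)
(* Let U be the modulated operator and alpha Q the dilate of Q.  The W_q property
   and the weak type of the sharp maximal function bound U(f 1_E) on most of Q by
   a multiple of the s-mean of f over alpha P when E lies in alpha P \ alpha Q;
   the oscillation bound then holds at almost every point of Q.  On one fixed
   dyadic grid, descend from a cell P as long as the cell meets the exceptional
   set of P in a small proportion, and stop otherwise: this yields a 1/2-sparse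
   family of stopping cells whose s-means add up to a bound for U(f 1_(alpha P \
   alpha Q)) along the tower of cells around almost every point.

   A truncation T_epsilon of a modulation of f is the limit of T applied to its
   cutoffs to (complement of alpha P) union (G_i inter alpha P), where P has side
   comparable to epsilon and the G_i are finite unions of dyadic cells exhausting
   {|x - y| > epsilon}.  These cutoffs form a countable family, so one null set
   serves all epsilon and all modulations.

   Each alpha P sits in a cell of comparable size of one of the n+1 grids.  The
   cells so obtained are only eta-sparse for a small eta; selecting those where
   the mean jumps, or where many cells have been passed, restores sparsity.  Far
   from the support a single cell containing the origin suffices. *)
Require Import Defs.
From HB Require Import structures.
From mathcomp Require Import all_boot all_order all_algebra.
From mathcomp Require Import complex.
From mathcomp Require Import all_classical all_reals all_analysis.
From mathcomp Require Import measurable_realfun ess_sup_inf.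
From mathcomp Require Import ring lra zify.

Set Implicit Arguments.
Unset Strict Implicit.
Unset Printing Implicit Defensive.

Import Order.TTheory GRing.Theory Num.Theory.
Import numFieldNormedType.Exports.

Local Open Scope classical_set_scope.
Local Open Scope ring_scope.

(** * Cubes and dyadic cells *)

Section cubes.
Variables (R : realType) (n : nat).
Local Notation Rn := 'rV[R]_n.
Local Notation mu := (lebesgue_rV R n).
Implicit Types (P Q : cube R n) (x y : Rn).

(** Passing from [alpha P] to [alpha P \ alpha Q] subtracts the cutoff of [f] to [alpha Q], and W_q
    controls that term on [Q] only if the mean over [alpha Q] is not much larger than the mean over
    [alpha P]. Dilates are not dyadic, so although the descent runs on one grid, the exceptional set
    of [P] also has to contain the points where a dyadic maximal function of any of the n+1 grids is
    large.

    The level sets of [U] need not be measurable. Every exceptional set is first replaced by a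
    measurable hull, at the price of a strict inequality between the constants.

    The descent starts at a level [K] where the dilated top cell contains the support of [f], so
    that every tower has a first member and selection is a recursion on the depth. Points far away
    are served by a chain of cells around the origin. Such a cell loses at most half of its volume
    to the previous one and at most a quarter to a box holding all the near cells; this is where the
    final sparseness 1/4 comes from. *)

Lemma cube_setE Q :
  cube_set Q = boxrV (corner Q) (\row_i (corner Q ord0 i + side Q)).
Proof. by apply/seteqP; split => x /= xQ i; have := xQ i; rewrite mxE. Qed.

Lemma measurable_cube Q : measurable (cube_set Q).
Proof. by rewrite cube_setE; exact: measurable_boxrV. Qed.

Lemma mu_cube Q : mu (cube_set Q) = (side Q ^+ n)%:E.
Proof.
rewrite cube_setE lebesgue_rV_box => [|i]; last by rewrite mxE lerDl ltW // side_gt0.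
congr (_%:E); rewrite (eq_bigr (fun=> side Q)) => [|i _]; last by rewrite mxE addrC addKr.
by rewrite prodr_const card_ord.
Qed.

Lemma corner_in Q : cube_set Q (corner Q).
Proof. by move=> i; rewrite lexx /= ltrDl side_gt0. Qed.

Definition dil (a : R) (a0 : 0 < a) Q : cube R n :=
  Cube (\row_i (corner Q ord0 i + side Q / 2 - a * side Q / 2))
       (mulr_gt0 a0 (side_gt0 Q)).

Lemma dilE a (a0 : 0 < a) Q : cube_set (dil a0 Q) = dilate a Q.
Proof.
apply/seteqP; split => x /= xQ i; have := xQ i; rewrite mxE => /andP[-> h] /=.
  by move: h => /=; lra.
by move: h => /=; lra.
Qed.

Lemma measurable_dilate a Q : 0 < a -> measurable (dilate a Q).
Proof. by move=> a0; rewrite -(dilE a0); exact: measurable_cube. Qed.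

Lemma sub_dilate a Q : 1 <= a -> cube_set Q `<=` dilate a Q.
Proof.
move=> a1 x xQ i; have /andP[h1 h2] := xQ i.
have s0 := side_gt0 Q; have : side Q <= a * side Q by rewrite ler_peMl // ltW.
by move=> h; apply/andP; split; lra.
Qed.

Lemma sub_cube P Q i : cube_set Q `<=` cube_set P ->
  corner P ord0 i <= corner Q ord0 i /\
  corner Q ord0 i + side Q <= corner P ord0 i + side P.
Proof.
move=> QP; have /andP[c1 c2] := QP _ (corner_in Q) i; split => //.
rewrite leNgt; apply/negP => c3.
(* If [Q] stuck out of [P] in direction [i], this point on the excluded right face of [P] would
   belong to [Q]. *)
pose z : Rn := \row_k if k == i then corner P ord0 i + side P else corner Q ord0 k.
have /QP/(_ i) : cube_set Q z.
  move=> k; rewrite mxE; case: eqP => [->|_].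
    by apply/andP; split => //; rewrite ltW.
  by rewrite lexx /= ltrDl side_gt0.
by rewrite mxE eqxx ltxx andbF.
Qed.

Lemma dilateS a P Q : 1 <= a -> cube_set Q `<=` cube_set P ->
  dilate a Q `<=` dilate a P.
Proof.
move=> a1 QP x xQ i; have /andP[h1 h2] := xQ i.
have [c1 c2] := sub_cube i QP.
have : 0 <= (a - 1) * (side P - side Q).
  by rewrite mulr_ge0 // subr_ge0 //; lra.
rewrite mulrBl !mul1r mulrBr => h.
by apply/andP; split; lra.
Qed.

Definition supb (M : R) x := forall i, `|x ord0 i| <= M.

(** The factor 3 is what it takes for the dilate to contain the sup-norm ball of radius [side Q]
    about every point of [Q], not only about its centre. *)
Lemma in_dilate a Q x y M : 3 <= a -> cube_set Q x -> supb M (y - x) -> M <= side Q ->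
  dilate a Q y.
Proof.
move=> a3 xQ yx MQ i; have /andP[h1 h2] := xQ i.
have := yx i; rewrite !mxE ler_norml => /andP[h3 h4].
have s0 := side_gt0 Q; have : 3 * side Q <= a * side Q by rewrite ler_pM2r.
by move=> h; apply/andP; split; lra.
Qed.

Lemma dilate_supb a Q x y : 1 <= a -> cube_set Q x -> dilate a Q y ->
  supb (a * side Q) (y - x).
Proof.
move=> a1 xQ yQ i; have /andP[h1 h2] := xQ i; have /andP[h3 h4] := yQ i.
have s0 := side_gt0 Q; have : side Q <= a * side Q by rewrite ler_peMl // ltW.
by rewrite !mxE => h; rewrite ler_norml; apply/andP; split; lra.
Qed.

End cubes.

Section cells.
Variables (R : realType) (n : nat) (D : set (cube R n)).
Local Notation Rn := 'rV[R]_n.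
Local Notation mu := (lebesgue_rV R n).
Implicit Types (P Q : cube R n) (x y : Rn) (k : int).

(** The default unit cube is never returned when [D] is a dyadic grid, by [cellP]. *)
Definition cell k x : cube R n :=
  xget (Cube 0 ltr01) [set Q | [/\ D Q, side Q = 2 ^ k & cube_set Q x]].

Hypothesis gridD : dyadic_grid D.

Lemma cellP k x : [/\ D (cell k x), side (cell k x) = 2 ^ k & cube_set (cell k x) x].
Proof.
have [_ _ /(_ k)[cov _]] := gridD.
have : [set: Rn] x by []. rewrite -cov => -[Q [DQ sQ] Qx].
exact: (@xgetPex _ (Cube 0 ltr01) [set Q | [/\ D Q, side Q = 2 ^ k & cube_set Q x]]
  (ex_intro _ Q (And3 DQ sQ Qx))).
Qed.

Lemma cell_in k x : D (cell k x). Proof. by case: (cellP k x). Qed.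
Lemma side_cell k x : side (cell k x) = 2 ^ k. Proof. by case: (cellP k x). Qed.
Lemma mem_cell k x : cube_set (cell k x) x. Proof. by case: (cellP k x). Qed.

Lemma cell_unique k x Q : D Q -> side Q = 2 ^ k -> cube_set Q x -> Q = cell k x.
Proof.
move=> DQ sQ Qx; have [_ _ /(_ k)[_ /trivIsetP dis]] := gridD.
have [Dc sc cx] := cellP k x.
have [//|/eqP QN] := eqVneq Q (cell k x).
have /eqP QN' := QN.
have := dis Q (cell k x) (conj DQ sQ) (conj Dc sc) QN'.
by move/seteqP => [/(_ x (conj Qx cx))].
Qed.

Lemma cell_eq k x y : cube_set (cell k x) y -> cell k y = cell k x.
Proof.
by move=> xy; apply/esym/cell_unique => //; [exact: cell_in|exact: side_cell].
Qed.

Lemma cell_mono k l x : 2 ^ k <= 2 ^ l :> R ->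
  cube_set (cell k x) `<=` cube_set (cell l x).
Proof.
move=> kl y xy; have [_ /(_ _ _ (cell_in k x) (cell_in l x)) nest _] := gridD.
case: nest => eqc.
- by move: xy; rewrite -eqc => -[].
- have sub : cube_set (cell l x) `<=` cube_set (cell k x) by rewrite -eqc => z [].
  have [kl0|kl0] := eqVneq (2 ^ k : R) (2 ^ l).
    suff -> : cell l x = cell k x by [].
    by apply: cell_unique; rewrite ?side_cell //; [exact: cell_in|exact: mem_cell].
  move=> i; have [] := sub_cube i sub; rewrite !side_cell => h1 h2.
  have {kl kl0} : 2 ^ k < 2 ^ l :> R by rewrite lt_neqAle kl0.
  by move=> h3; clear -h1 h2 h3; lra.
- move/seteqP: eqc => [/(_ x) []]; split; exact: mem_cell.
Qed.

Lemma pow2_le (k l : int) : (k <= l) -> 2 ^ k <= 2 ^ l :> R.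
Proof. by move=> kl; rewrite ler_weXz2l // ler1n. Qed.

Lemma cell_eq_up k l x y : k <= l -> cube_set (cell k x) y -> cell l y = cell l x.
Proof. by move=> kl xy; apply/cell_eq/(cell_mono (pow2_le kl)). Qed.

(** The corners of a level need not lie on the lattice of step [2 ^ k], but two cells whose corners
    fall into the same lattice box share the coordinatewise maximum of their corners, hence
    coincide. The code thus separates the cells of a level and makes them countable. *)
Definition cell_code k x : nat :=
  pickle [ffun i => Num.floor (corner (cell k x) ord0 i / 2 ^ k)].

Lemma cell_codeP k x y : cell_code k x = cell_code k y -> cell k x = cell k y.
Proof.
move=> /(pcan_inj pickleK)/ffunP xy.
pose z : Rn := \row_i Num.max (corner (cell k x) ord0 i) (corner (cell k y) ord0 i).
have k0 : 0 < 2 ^ k :> R by rewrite exprz_gt0.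
have H i : `|corner (cell k x) ord0 i - corner (cell k y) ord0 i| < 2 ^ k.
  have := xy i; rewrite !ffunE => fl.
  have := floor_itv (corner (cell k x) ord0 i / 2 ^ k).
  have := floor_itv (corner (cell k y) ord0 i / 2 ^ k); rewrite -fl.
  rewrite !ler_pdivlMr // !ltr_pdivrMr // intrD mulrDl mul1r.
  move=> /andP[h1 h2] /andP[h3 h4]; rewrite ltr_norml; apply/andP; split; lra.
have zx : cube_set (cell k x) z.
  move=> i; rewrite mxE le_max lexx /= gt_max ltrDl side_cell k0 /=.
  by have := H i; rewrite ltr_norml => /andP[h1 h2]; lra.
have zy : cube_set (cell k y) z.
  move=> i; rewrite mxE le_max lexx orbT /= gt_max ltrDl side_cell k0 andbT.
  by have := H i; rewrite ltr_norml => /andP[h1 h2]; lra.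
by rewrite -(cell_eq zx) -(cell_eq zy).
Qed.

Lemma countable_grid : countable D.
Proof.
have H Q : exists p : int * Rn, D Q -> Q = cell p.1 p.2.
  have [DQ|] := pselect (D Q); last by exists (0, 0).
  have [/(_ _ DQ)[k sk] _ _] := gridD.
  by exists (k, corner Q) => _ /=; apply: cell_unique => //; exact: corner_in.
have [h hP] := choice H.
apply/countable_injP; exists (fun Q => pickle ((h Q).1, cell_code (h Q).1 (h Q).2)).
move=> P Q /[!inE] DP DQ /(pcan_inj pickleK)[e1 e2].
by rewrite (hP _ DP) (hP _ DQ) e1; apply: cell_codeP; rewrite -{1}e1.
Qed.

Lemma cell_piece k (F : cube R n -> set Rn) i : (forall Q, measurable (F Q)) ->
  measurable [set y | F (cell k y) y /\ cell_code k y = i].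
Proof.
move=> mF; have [[y yi]|no] := pselect (exists y, cell_code k y = i); last first.
  rewrite (_ : [set _ | _] = set0); first exact: measurable0.
  by apply/seteqP; split => // y [_ yi]; apply: no; exists y.
rewrite (_ : [set _ | _] = F (cell k y) `&` cube_set (cell k y)).
  by apply: measurableI => //; exact: measurable_cube.
apply/seteqP; split => z /= [h1 h2].
  have zy : cell k z = cell k y by apply: cell_codeP; rewrite h2.
  by split; [rewrite -zy|rewrite -zy; exact: mem_cell].
by have e := cell_eq h2; split; [rewrite e|rewrite -yi /cell_code e].
Qed.

Lemma measurable_cellfun k (F : cube R n -> set Rn) :
  (forall Q, measurable (F Q)) -> measurable [set y | F (cell k y) y].
Proof.
move=> mF; rewrite (_ : [set _ | _] =
  \bigcup_i [set y | F (cell k y) y /\ cell_code k y = i]).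
  by apply: bigcup_measurable => i _; exact: cell_piece.
by apply/seteqP; split => y /= => [h|[i _ []]//]; exists (cell_code k y).
Qed.

Definition level k (B : set Rn) := forall x y, cube_set (cell k x) y -> B x -> B y.

Lemma levelE k B : level k B -> B = [set y | B (corner (cell k y))].
Proof.
move=> lB; apply/seteqP; split => y /= h.
  by apply: lB h; exact: corner_in.
have := corner_in (cell k y); move=> /cell_eq e.
by apply: (lB _ _ _ h); rewrite e; exact: mem_cell.
Qed.

Lemma measurable_level k B : level k B -> measurable B.
Proof.
move=> lB; rewrite (levelE lB).
apply: (@measurable_cellfun k (fun Q => [set _ | B (corner Q)])) => Q.
have [h|h] := pselect (B (corner Q)).
  by rewrite (_ : [set _ | _] = setT) //; apply/seteqP; split.
by rewrite (_ : [set _ | _] = set0) //; apply/seteqP; split.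
Qed.

(** [B] splits into countably many cells of level [k], indexed by [cell_code], and the inequality is
    summed over them. *)
Lemma le_level_measure (m1 m2 : {measure set Rn -> \bar R}) k B : level k B ->
  (forall x, B x -> (m1 (cube_set (cell k x)) <= m2 (cube_set (cell k x)))%E) ->
  (m1 B <= m2 B)%E.
Proof.
move=> lB h; pose C i := [set y | B y /\ cell_code k y = i].
have mC i : measurable (C i).
  rewrite /C; have := @cell_piece k (fun=> B) i; apply => _; exact: measurable_level lB.
have dC : trivIset setT C.
  apply/trivIsetP => i j _ _ ij; apply/seteqP; split => // y [[_ yi] [_ yj]].
  by move: ij; rewrite -yi -yj eqxx.
have BE : B = \bigcup_i C i.
  by apply/seteqP; split => y /= => [By|[i _ []]//]; exists (cell_code k y).
rewrite BE !measure_bigcup //.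
apply: lee_nneseries => // i _.
have [[y [By yi]]|no] := pselect (exists y, C i y); last first.
  rewrite (_ : C i = set0) ?measure0 //.
  by apply/seteqP; split => // y Cy; apply: no; exists y.
suff -> : C i = cube_set (cell k y) by exact: h.
apply/seteqP; split => z /= => [[_ zi]|yz].
  suff <- : cell k z = cell k y by exact: mem_cell.
  by apply: cell_codeP; rewrite zi.
by split; [exact: lB By|rewrite -yi /cell_code (cell_eq yz)].
Qed.

(* The first-hitting levels turn the maximal function into a disjoint union
   of cells, on which the averages are compared one at a time. *)
Lemma dyadic_maximal (m1 m2 : {measure set Rn -> \bar R}) (K : int) :
  let M := [set x | exists d : nat,
    (m1 (cube_set (cell (K - d%:Z) x)) <= m2 (cube_set (cell (K - d%:Z) x)))%E] in
  measurable M /\ (m1 M <= m2 M)%E.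
Proof.
pose H x d := (m1 (cube_set (cell (K - d%:Z) x)) <= m2 (cube_set (cell (K - d%:Z) x)))%E.
move=> M; pose B d := [set x | H x d /\ forall e, (e < d)%N -> ~ H x e].
have HE x y d e : (e <= d)%N -> cube_set (cell (K - d%:Z) x) y -> H y e = H x e.
  move=> ed xy; rewrite /H (@cell_eq_up (K - d%:Z) (K - e%:Z) x y) //.
  by rewrite lerD2l lerN2 lez_nat.
have lB d : level (K - d%:Z) (B d).
  move=> x y xy [h1 h2]; split; first by rewrite (HE x y d d).
  by move=> e ed; rewrite (HE x y d e (ltnW ed)) //; exact: h2.
have ME : M = \bigcup_d B d.
  apply/seteqP; split => [x /= [d Hd]|x [d _ [Hd _]]]; last by exists d.
  have ex : exists d, H x d by exists d.
  have := ex_minnP (P := fun d => H x d) ex => -[e He mine].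
  exists e => //; split => // e' e'e /mine; rewrite leqNgt e'e //.
have mB d : measurable (B d) by exact: measurable_level (lB d).
split; first by rewrite ME; exact: bigcup_measurable.
have dB : trivIset setT B.
  apply/trivIsetP => i j _ _; wlog : i j / (i < j)%N.
    move=> w ij; have := ij; rewrite neq_ltn => /orP[/w/(_ ij)//|/w].
    by rewrite eq_sym setIC => /(_ ij).
  by move=> ij _; apply/seteqP; split => // x [[h _] [_ /(_ _ ij)]].
rewrite ME !measure_bigcup //; apply: lee_nneseries => // d _.
by apply: (le_level_measure (lB d)) => x [].
Qed.

End cells.

(** * Stopping times along a tower of cells *)

Section stopping.
Variable bad : nat -> nat -> bool.

(* [bad i d] tells that the [d]-th term has to be selected when the last
   selected one is the [i]-th; [last_stop d] is the last selected index [<= d] *)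
Fixpoint last_stop d :=
  if d is e.+1 then if bad (last_stop e) d then d else last_stop e else 0%N.

Definition stop d := last_stop d == d.

Lemma last_stop_le d : (last_stop d <= d)%N.
Proof. by elim: d => //= d IH; case: ifP => // _; apply: leqW. Qed.

Lemma stop_last d : stop (last_stop d).
Proof.
elim: d => //= d IH; case: ifP => // h; by rewrite /stop /= h.
Qed.

Lemma last_stop_bad d : last_stop d = d \/ ~~ bad (last_stop d) d.
Proof.
case: d => [|d] /=; first by left.
by case: ifP => h; [left|right; rewrite h].
Qed.

Lemma stop_bad d : stop d.+1 -> bad (last_stop d) d.+1.
Proof.
rewrite /stop /=; case: ifP => // _ /eqP h.
by have := last_stop_le d; rewrite h ltnn.
Qed.

(** Take the least stop beyond [d]: until then the last selected index remains [d], so this stop was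
    selected against [d] itself. What smaller stopping cells remove from a stopping cell is thereby
    described by the criterion of that one cell. *)
Lemma first_stop d e : stop d -> (d < e)%N -> stop e ->
  exists2 e', (d < e')%N & bad d e'.
Proof.
move=> sd de se; pose P i := (d < i)%N && stop i.
have exP : exists i, P i by exists e; rewrite /P de.
case: (ex_minnP exP) => -[//|m] /andP[dm sm] minm; exists m.+1 => //.
suff <- : last_stop m = d by exact: stop_bad.
have : ~~ (d < last_stop m)%N.
  apply/negP => h; have : P (last_stop m) by rewrite /P h stop_last.
  by move/minm; rewrite ltnNge last_stop_le.
rewrite -leqNgt leq_eqVlt => /orP[/eqP //|].
move: dm; rewrite ltnS; elim: (m) => [|j IH].
  by rewrite leqn0 => /eqP -> /=.
rewrite leq_eqVlt => /orP[/eqP dj|dj /=].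
  by move: sd; rewrite /stop dj => /eqP ->; rewrite ltnn.
case: ifP => [_|_ /IH]; first by rewrite ltnNge ltnW.
exact.
Qed.

End stopping.

Lemma eq_last_stop (bad bad' : nat -> nat -> bool) d :
  (forall i j, (i < j <= d)%N -> bad i j = bad' i j) ->
  last_stop bad d = last_stop bad' d.
Proof.
elim: d => //= d IH h; rewrite IH => [|i j /andP[ij jd]]; last first.
  by apply: h; rewrite ij leqW.
by rewrite h // ltnS last_stop_le ltnSn.
Qed.

Section stopping_cells.
Variables (R : realType) (n : nat) (D : set (cube R n)).
Local Notation Rn := 'rV[R]_n.
Local Notation mu := (lebesgue_rV R n).
Hypothesis gridD : dyadic_grid D.
Variables (K : int) (bad : Rn -> nat -> nat -> bool).
Local Notation c d x := (cell D (K - d%:Z) x).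
Hypothesis bad_cell : forall x y i d, (i < d)%N -> cube_set (c d x) y ->
  bad y i d = bad x i d.

Lemma subz_level (d e : nat) : (e <= d)%N -> K - d%:Z <= K - e%:Z.
Proof. by move=> ed; rewrite lerD2l lerN2 lez_nat. Qed.

Lemma stop_cell x y d : cube_set (c d x) y -> stop (bad y) d = stop (bad x) d.
Proof.
move=> xy; rewrite /stop (@eq_last_stop (bad y) (bad x) d) // => i j /andP[ij jd].
by apply: bad_cell => //; apply: cell_mono xy => //; apply/pow2_le/subz_level.
Qed.

(** The usual disjoint part of a stopping cell: the points in no strictly smaller stopping cell.
    Depths are compared through the side of [P], so that the core depends on the cell alone and not
    on a point and depth defining it. *)
Definition stop_core (P : cube R n) : set Rn :=
  cube_set P `&` [set y | forall e, stop (bad y) e -> side P <= 2 ^ (K - e%:Z)].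

Lemma measurable_stop_core P : measurable (stop_core P).
Proof.
apply: measurableI; first exact: measurable_cube.
rewrite (_ : [set _ | _] = \bigcap_(e in [set e | ~ side P <= 2 ^ (K - e%:Z)])
    [set y | ~ stop (bad y) e]).
  apply: bigcap_measurableType => e _; apply: (measurable_level gridD (k := K - e%:Z)).
  by move=> x y xy /=; rewrite (stop_cell xy).
apply/seteqP; split => y /= h e; first by move=> /= he /h.
by move=> se; apply: contrapT => he; exact: (h e).
Qed.

Lemma pow2_inj (k l : int) : 2 ^ k = 2 ^ l :> R -> k = l.
Proof.
apply: contra_eq => kl; have [lt|lt|/eqP] := ltgtP k l; last by rewrite (negbTE kl).
  by rewrite lt_eqF // ltr_eXz2l // ltr1n.
by rewrite gt_eqF // ltr_eXz2l // ltr1n.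
Qed.

Lemma pow2_lt (k l : int) : (2 ^ k < 2 ^ l :> R) = (k < l).
Proof. by rewrite ltr_eXz2l // ltr1n. Qed.

(** Both cells are stopping cells of the common point, so the side of each is at most that of the
    other. *)
Lemma stop_core_disj x d x' d' y : stop (bad x) d -> stop (bad x') d' ->
  stop_core (c d x) y -> stop_core (c d' x') y -> c d x = c d' x'.
Proof.
move=> sx sx' [xy hx] [xy' hx'].
have := hx d'; rewrite (stop_cell xy') => /(_ sx').
have := hx' d; rewrite (stop_cell xy) => /(_ sx).
rewrite !side_cell // => h1 h2.
have /pow2_inj e : 2 ^ (K - d%:Z) = 2 ^ (K - d'%:Z) :> R by apply: le_anti; rewrite h1 h2.
by rewrite -(cell_eq gridD xy) -(cell_eq gridD xy') e.
Qed.

Lemma sub_stop_core x d : stop (bad x) d ->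
  cube_set (c d x) `\` stop_core (c d x) `<=`
  [set y | cube_set (c d x) y /\ exists2 e, (d < e)%N & bad y d e].
Proof.
move=> sx y [xy ny]; split => //; apply: contrapT => no; apply: ny; split => // e se.
rewrite side_cell // leNgt pow2_lt ltrD2l ltrN2 ltz_nat; apply/negP => de; apply: no.
by apply: first_stop se => //; rewrite (stop_cell xy).
Qed.

Lemma stop_core_half x d (B : set Rn) : stop (bad x) d -> measurable B ->
  (forall y, cube_set (c d x) y -> (exists2 e, (d < e)%N & bad y d e) -> B y) ->
  (mu B <= (2^-1)%:E * mu (cube_set (c d x)))%E ->
  ((2^-1)%:E * mu (cube_set (c d x)) <= mu (stop_core (c d x)))%E.
Proof.
move=> sx mB hB muB.
have mS := measurable_stop_core (c d x); have mC := measurable_cube (c d x).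
have h : (mu (cube_set (c d x)) <= mu (stop_core (c d x)) + mu B)%E.
  apply: le_trans (measureU2 _ _ _) => //; apply: le_measure; rewrite ?inE //.
    exact: measurableU.
  move=> y xy; have [s|ns] := pselect (stop_core (c d x) y); first by left.
  by right; have [h1 h2] := sub_stop_core sx (conj xy ns); exact: hB.
have := le_trans h (leeD2l _ muB); rewrite mu_cube.
have : (mu (stop_core (c d x)) <= mu (cube_set (c d x)))%E.
  by apply: le_measure; rewrite ?inE // => y [].
rewrite mu_cube; have := measure_ge0 mu (stop_core (c d x)).
case: (mu (stop_core (c d x))) => [r||] //= _ _; rewrite -EFinM -EFinD !lee_fin; lra.
Qed.

End stopping_cells.

Section stopping_sums.
Variables (R : realType) (bad : nat -> nat -> bool) (a : nat -> R).
Hypothesis a0 : forall i, 0 <= a i.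
Local Notation last := (last_stop bad).
Local Notation stopsum d := (\sum_(0 <= j < d | stop bad j) a j).

Lemma stopsum_le d e : (d <= e)%N -> stopsum d <= stopsum e.
Proof.
move=> de; rewrite (big_cat_nat (n := d) (p := e)) //= lerDl.
by apply: sumr_ge0 => i _.
Qed.

Lemma stop_le_stopsum d e : (last d < e)%N -> a (last d) <= stopsum e.
Proof.
move=> de; apply: le_trans (stopsum_le de).
by rewrite big_mkcond /= big_nat_recr //= stop_last lerDr sumr_ge0 // => i _; case: ifP.
Qed.

(** Telescoping over the selected indices. The bound on [u i j.+1] serves the jump from the last
    selected index to a newly selected one: the new index is bad, but its predecessor is not. *)
Lemma stop_chain (C : R) (u : nat -> nat -> \bar R) d : 0 <= C ->
  (u 0%N 0%N <= 0)%E ->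
  (forall i j, (i <= j)%N -> u 0%N j <= u 0%N i + u i j)%E ->
  (forall i j, (i <= j)%N -> i = j \/ ~~ bad i j ->
    (u i j <= (C * a i)%:E)%E /\ (u i j.+1 <= (C * a i)%:E)%E) ->
  (u 0%N d <= (C * stopsum d.+1)%:E)%E.
Proof.
move=> C0 u0 uD good.
(* The sum excludes the index [last d], whose term pays for the jump that starts there. *)
have key : (u 0%N (last d) <= (C * stopsum (last d))%:E)%E.
  elim: d => [|d IH] /=; first by rewrite big_nil mulr0.
  case: ifP => // _; apply: le_trans (uD _ _ (leqW (last_stop_le bad d))) _.
  have [|_ h] := good (last d) d (last_stop_le bad d).
    exact: last_stop_bad.
  apply: le_trans (leeD IH h) _; rewrite -EFinD lee_fin -mulrDr ler_wpM2l //.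
  have e : (last d < d.+1)%N by rewrite ltnS last_stop_le.
  apply: le_trans (stopsum_le e).
  by rewrite [in leRHS]big_mkcond /= big_nat_recr //= -big_mkcond /= stop_last.
apply: le_trans (uD _ _ (last_stop_le bad d)) _.
have [|h _] := good (last d) d (last_stop_le bad d).
  exact: last_stop_bad.
apply: le_trans (leeD key h) _; rewrite -EFinD lee_fin -mulrDr ler_wpM2l //.
have e : (last d < d.+1)%N by rewrite ltnS last_stop_le.
apply: le_trans (stopsum_le e).
by rewrite [in leRHS]big_mkcond /= big_nat_recr //= -big_mkcond /= stop_last.
Qed.

(** After a selected index at most [m] marked terms follow before the next selection; with the
    selected one they make [m + 1] terms, each at most [A] times the selected value. *)
Lemma stop_dominate (A : R) (m : nat) (b : nat -> bool) d : 1 <= A ->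
  (forall i j, (i <= j)%N -> ~~ bad i j ->
     a j <= A * a i /\ (\sum_(i.+1 <= l < j.+1) b l <= m)%N) ->
  \sum_(0 <= j < d.+1 | b j) a j <= A * m.+1%:R * stopsum d.+1.
Proof.
move=> A1 good; pose cnt d := (\sum_((last d).+1 <= l < d.+1) b l)%N.
have A0 : 0 <= A by apply: le_trans A1.
(* The second summand is the block still open at [d]; it moves into the stopping sum when the next
   index is selected. *)
have key : \sum_(0 <= j < d.+1 | b j) a j <=
   A * m.+1%:R * stopsum (last d) + A * (cnt d).+1%:R * a (last d).
  elim: d => [|d IH].
    rewrite /cnt /= big_mkcond big_nat1 big_nil mulr0 add0r big_geq // mulr1.
    by case: ifP => _; rewrite ?mulr_ge0 // ler_peMl.
  rewrite big_mkcond big_nat_recr //= -big_mkcond /=.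
  have goodd : a d <= A * a (last d) /\ (cnt d <= m)%N.
    have [e|nb] := last_stop_bad bad d; last exact: (good _ _ (last_stop_le bad d)).
    by rewrite /cnt -{1 3}e big_geq ?e // ler_peMl.
  rewrite /cnt /=; have [h|h] := ifP (bad (last d) d.+1).
    have -> : (\sum_(d.+2 <= l < d.+2) b l = 0)%N by rewrite big_geq.
    rewrite mulr1.
    apply: lerD; last by case: ifP => _; rewrite ?mulr_ge0 // ler_peMl.
    apply: le_trans IH _.
    have e : (last d < d.+1)%N by rewrite ltnS last_stop_le.
    apply: (@le_trans _ _ (A * m.+1%:R * stopsum (last d).+1)); last first.
      by rewrite ler_wpM2l ?mulr_ge0 // stopsum_le.
    rewrite [in leRHS]big_mkcond big_nat_recr //= -big_mkcond stop_last mulrDr lerD2l.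
    by rewrite ler_wpM2r // ler_wpM2l // ler_nat ltnS; case: goodd.
  have [h1 h2] := good _ _ (leqW (last_stop_le bad d)) (negbT h).
  rewrite big_nat_recr /=; last by rewrite ltnS last_stop_le.
  rewrite -/(cnt d); apply: le_trans (lerD IH (lexx _)) _.
  rewrite -addrA lerD2l -addSn natrD mulrDr mulrDl lerD2l.
  by case: (b d.+1) => /=; rewrite ?mulr1 ?mulr0 ?mul0r.
apply: le_trans key _.
have e : (last d < d.+1)%N by rewrite ltnS last_stop_le.
apply: (@le_trans _ _ (A * m.+1%:R * stopsum (last d).+1)); last first.
  by rewrite ler_wpM2l ?mulr_ge0 // stopsum_le.
rewrite [in leRHS]big_mkcond big_nat_recr //= -big_mkcond stop_last mulrDr lerD2l.
rewrite ler_wpM2r // ler_wpM2l // ler_nat ltnS.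
have [e'|nb] := last_stop_bad bad d; first by rewrite /cnt e' big_geq.
by have [] := good _ _ (last_stop_le bad d) nb.
Qed.

End stopping_sums.

(** * Principal subfamilies of sparse families *)

Lemma density_measure d (X : measurableType d) (R : realType)
    (m : {measure set X -> \bar R}) (g : X -> \bar R) :
  measurable_fun setT g -> (forall x, 0 <= g x)%E ->
  exists nu : {measure set X -> \bar R}, forall E, nu E = (\int[m]_(x in E) g x)%E.
Proof.
move=> mg g0; pose f E := (\int[m]_(x in E) g x)%E.
have f0 : f set0 = 0%E by rewrite /f integral_set0.
have fge0 E : (0 <= f E)%E by exact: integral_ge0.
have fadd : semi_sigma_additive f.
  by apply: semi_sigma_additive_nng_induced => // x; exact: g0.
pose H := isMeasure.Build _ _ _ f f0 fge0 fadd.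
by exists (HB.pack_for {measure set X -> \bar R} f H).
Qed.

Section sparsify.
Variables (R : realType) (n : nat) (D : set (cube R n)).
Local Notation Rn := 'rV[R]_n.
Local Notation mu := (lebesgue_rV R n).
Hypothesis gridD : dyadic_grid D.
Variables (nu : {measure set Rn -> \bar R}) (nu_fin : (nu setT < +oo)%E).
Variables (K : int) (F : set (cube R n)) (E : cube R n -> set Rn) (eta : R).
Hypotheses (eta0 : 0 < eta) (mE : forall Q, measurable (E Q)).
Hypotheses (subE : forall Q, F Q -> E Q `<=` cube_set Q) (trivE : trivIset F E).
Hypothesis bigE : forall Q, F Q -> (eta%:E * mu (cube_set Q) <= mu (E Q))%E.
Local Notation c d x := (cell D (K - d%:Z) x).

Definition mean (Q : cube R n) : R := fine (nu (cube_set Q)) / side Q ^+ n.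

Definition fam x d : bool := `[< F (c d x) >].

(* The second alternative makes the selected family 1/2-sparse whatever [eta] is:
   the points of a cell lying in [m] smaller members of [F] fill at most
   [1 / (eta * m)] of it. *)
Definition sparse_bad (m : nat) x i d :=
  (4 * mean (c i x) < mean (c d x)) || (m <= \sum_(i.+1 <= l < d.+1) fam x l)%N.

Lemma nu_fin_num B : measurable B -> nu B \is a fin_num.
Proof.
move=> mB; rewrite ge0_fin_numE //; apply: le_lt_trans nu_fin.
by apply: le_measure; rewrite ?inE.
Qed.

Lemma mean_ge0 Q : 0 <= mean Q.
Proof. by rewrite divr_ge0 ?fine_ge0 // exprn_ge0 // ltW // side_gt0. Qed.

Lemma cell_up x y d e : (e <= d)%N -> cube_set (c d x) y -> c e y = c e x.
Proof. by move=> ed xy; apply: cell_eq_up xy => //; exact: subz_level. Qed.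

Lemma sparse_bad_cell m x y i d : (i < d)%N -> cube_set (c d x) y ->
  sparse_bad m y i d = sparse_bad m x i d.
Proof.
move=> id_ xy; rewrite /sparse_bad (cell_up (ltnW id_) xy) (cell_up (leqnn d) xy).
congr (_ || (_ <= _)%N); apply: eq_big_nat => l /andP[_ ld].
by rewrite /fam (cell_up _ xy).
Qed.

(** Weak type (1,1) of the dyadic maximal function, with constant one, for [nu] restricted to the
    cell and at four times its mean. This quarter and that of [large_count] add up to the half
    allowed in [sparsify_core]. *)
Lemma large_mean x d : exists B, [/\ measurable B,
  (mu B <= (4^-1)%:E * mu (cube_set (c d x)))%E &
  forall y e, cube_set (c d x) y -> (d <= e)%N -> 4 * mean (c d x) < mean (c e y) -> B y].
Proof.
set P := c d x; have mP := measurable_cube P.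
have sub y e : cube_set P y -> (d <= e)%N -> cube_set (c e y) `<=` cube_set P.
  move=> Py de; rewrite /P -(cell_eq gridD Py).
  by apply: cell_mono => //; apply/pow2_le/subz_level.
(* For a [nu]-null cell the height would be zero and the maximal set the whole space. *)
have [P0|P0] := eqVneq (nu (cube_set P)) 0%E.
  exists set0; split; [exact: measurable0|by rewrite measure0 mule_ge0|].
  move=> y e Py de; rewrite {2}/mean (_ : nu _ = 0%E) ?mul0r; last first.
    apply/eqP; rewrite -measure_le0 -P0; apply: le_measure; rewrite ?inE //.
      exact: measurable_cube.
    exact: sub.
  by rewrite ltNge mulr_ge0 // mean_ge0.
have nuP : 0 < fine (nu (cube_set P)).
  rewrite fine_gt0 // lt_neqAle eq_sym P0 /=.
  by rewrite measure_ge0 -ge0_fin_numE // nu_fin_num.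
have sP : 0 < side P ^+ n by rewrite exprn_gt0 // side_gt0.
have mean0 : 0 < mean P by rewrite divr_gt0.
have r0 : 0 <= 4 * mean P by rewrite mulr_ge0 // ltW.
pose m1 : {measure set Rn -> \bar R} := mscale (NngNum r0) mu.
pose m2 : {measure set Rn -> \bar R} := mrestr nu mP.
have [] := dyadic_maximal gridD m1 m2 K; set M := [set _ | _] => mM hM.
exists M; split => //; last first.
  move=> y e Py de h; exists e; rewrite /= /mscale /mrestr /= setIidl; last exact: sub.
  rewrite mu_cube -EFinM -[leRHS]fineK ?nu_fin_num //; last exact: measurable_cube.
  rewrite lee_fin -ler_pdivlMr; first exact: ltW.
  by rewrite exprn_gt0 // side_gt0.
have : ((4 * mean P)%:E * mu M <= nu (cube_set P))%E.
  apply: le_trans hM _; rewrite /= /mrestr; apply: le_measure; rewrite ?inE //.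
  exact: measurableI.
rewrite -[leRHS]fineK ?nu_fin_num // -lee_pdivlMl; last by rewrite mulr_gt0.
move=> /le_trans; apply.
rewrite mu_cube -EFinM lee_fin /mean invfM -mulrA ler_pM2l // invf_div.
by rewrite mulrAC mulfK // gt_eqF.
Qed.

Definition famset l := [set y | F (c l y)].
Definition corset l := [set y | (if `[< F (c l y) >] then E (c l y) else set0) y].

Lemma corset_measurable l : measurable (corset l).
Proof.
apply: (@measurable_cellfun _ _ _ gridD (K - l%:Z) (fun Q => if `[< F Q >] then E Q else set0)).
by move=> Q; case: ifP.
Qed.

Lemma famset_level l : level D (K - l%:Z) (famset l).
Proof. by move=> x y xy; rewrite /famset /= (cell_eq gridD xy). Qed.

Lemma corset_triv : trivIset setT corset.
Proof.
apply/trivIsetP => i j _ _ ij; apply/seteqP; split => // y [].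
rewrite /corset /=; case: asboolP => // Fi Ei; case: asboolP => // Fj Ej.
have [e|ne] := eqVneq (c i y) (c j y).
  have := congr1 (@side _ _) e; rewrite !side_cell // => /pow2_inj/addrI/oppr_inj.
  by case=> e'; rewrite e' eqxx in ij.
by have /trivIsetP/(_ _ _ Fi Fj ne)/seteqP[/(_ y (conj Ei Ej))] := trivE.
Qed.

(* Chebyshev for the counting function of the family, whose integral over a cell
   is controlled by the disjointness of the sets [E]. *)
Lemma large_count (m : nat) x d : 4 <= eta * m%:R -> exists B, [/\ measurable B,
  (mu B <= (4^-1)%:E * mu (cube_set (c d x)))%E &
  forall y e, cube_set (c d x) y -> (d <= e)%N ->
    (m <= \sum_(d.+1 <= l < e.+1) fam y l)%N -> B y].
Proof.
move=> hm; set P := c d x; have mP := measurable_cube P.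
pose G l := if (d < l)%N then famset l else set0.
have mG l : measurable (G l).
  rewrite /G; case: ifP => // _; exact: measurable_level (famset_level (l := l)).
pose N (y : Rn) : \bar R := (\sum_(0 <= l <oo) (\1_(G l) y)%:E)%E.
have mi l : measurable_fun setT (fun y => (\1_(G l) y)%:E : \bar R).
  by apply/measurable_EFinP; exact: measurable_indic.
have mN : measurable_fun setT N.
  have := @ge0_emeasurable_sum _ _ _ setT (fun l y => (\1_(G l) y)%:E : \bar R) xpredT.
  by apply => // l y _ _; rewrite lee_fin.
have N0 y : (0 <= N y)%E by apply: nneseries_ge0 => l _ _; rewrite lee_fin.
pose B := cube_set P `&` [set y | (m%:R%:E <= N y)%E].
have mB : measurable B.
  rewrite /B; apply: measurableI => //.
  rewrite (_ : [set _ | _] = setT `&` N @^-1` `[m%:R%:E, +oo[).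
    by apply: mN => //; exact: emeasurable_itv.
  by rewrite setTI; apply/seteqP; split => y /=; rewrite in_itv /= andbT.
exists B; split => //; last first.
  move=> y e Py de h; split => //=.
  apply: (@le_trans _ _ (\sum_(0 <= l < e.+1) (\1_(G l) y)%:E)%E); last first.
    by apply: nneseries_lim_ge => l _ _; rewrite lee_fin.
  rewrite sumEFin lee_fin (big_cat_nat (n := d.+1)) //=.
  rewrite (le_trans (_ : _ <= (\sum_(d.+1 <= l < e.+1) fam y l)%:R)) ?ler_nat //.
  rewrite natr_sum; apply: ler_wpDl; first by apply: sumr_ge0.
  apply: ler_sum_nat => l /andP[dl _]; rewrite indicE /fam /G dl.
  by case: asboolP => [h'|//]; rewrite mem_set.
have m0 : 0 < m%:R :> R.
  rewrite ltr0n lt0n; apply/eqP => m0; move: hm; rewrite m0 mulr0; lra.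
have h1 : (m%:R%:E * mu B <= \int[mu]_(y in cube_set P) N y)%E.
  rewrite -integral_cst //; apply: (@le_trans _ _ (\int[mu]_(y in B) N y)%E).
    apply: ge0_le_integral => //; first by move=> y _; rewrite lee_fin.
      exact: measurable_funS mN.
    by move=> y [].
  apply: ge0_subset_integral => //; first exact: measurable_funS mN.
  by move=> y [].
have h2 : (eta%:E * \int[mu]_(y in cube_set P) N y <= mu (cube_set P))%E.
  rewrite /N integral_nneseries //; last first.
    by move=> l; exact: measurable_funS (mi l).
  rewrite -nneseriesZl //; last first.
    by move=> l _; apply: integral_ge0 => y _; rewrite lee_fin.
  pose C l := corset l `&` cube_set P.
  have mC l : measurable (C l) by apply: measurableI => //; exact: corset_measurable.
  apply: (@le_trans _ _ (\sum_(0 <= l <oo) mu (C l))%E).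
    apply: lee_nneseries => [l _ _|l _].
      by apply: mule_ge0; [rewrite lee_fin ltW|apply: integral_ge0 => y _; rewrite lee_fin].
    rewrite integral_indic // /G; case: ifP => dl; last by rewrite set0I measure0 mule0.
    have mF : measurable (famset l) by exact: measurable_level (famset_level (l := l)).
    have mI : measurable (famset l `&` cube_set P) by exact: measurableI.
    pose m1 : {measure set Rn -> \bar R} := mscale (NngNum (ltW eta0)) mu.
    pose m2 : {measure set Rn -> \bar R} := mrestr mu (corset_measurable l).
    have dl' : (d <= l)%N by exact: ltnW.
    have lev : level D (K - l%:Z) (famset l `&` cube_set P).
      move=> y z yz [h h']; split; first exact: famset_level yz h.
      rewrite /P -(cell_eq gridD h'); apply: (cell_mono gridD) yz.
      exact/pow2_le/subz_level.
    have := @le_level_measure _ _ _ gridD m1 m2 _ _ lev.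
    rewrite /= /mscale /mrestr /= => h; apply: le_trans (h _) _.
      move=> y [Fy Py]; apply: le_trans (bigE Fy) _; apply: le_measure; rewrite ?inE //.
        by apply: measurableI; [exact: measurable_cube|exact: corset_measurable].
      move=> z Ez; split; first exact: subE Fy _ Ez.
      rewrite /corset /= (cell_eq gridD (subE Fy Ez)).
      by case: asboolP.
    apply: le_measure; rewrite ?inE //; first by apply: measurableI => //; exact: corset_measurable.
    by move=> z [[? ?] ?]; split.
  have tC : trivIset setT C by apply: trivIset_setIr; exact: corset_triv.
  have mUC : measurable (\bigcup_l C l) by exact: bigcup_measurable.
  rewrite -measure_semi_bigcup //.
  apply: le_measure; rewrite ?inE //.
  by move=> y [l _ []].
have h3 : ((eta * m%:R)%:E * mu B <= mu (cube_set P))%E.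
  apply: le_trans h2; rewrite EFinM -muleA lee_wpmul2l // lee_fin ltW //.
have : (4%:E * mu B <= mu (cube_set P))%E.
  by apply: le_trans h3; rewrite lee_wpmul2r // lee_fin.
by rewrite -lee_pdivlMl.
Qed.

Lemma sparsify_core m x d : 4 <= eta * m%:R -> stop (sparse_bad m x) d ->
  ((2^-1)%:E * mu (cube_set (c d x)) <= mu (stop_core K (sparse_bad m) (c d x)))%E.
Proof.
move=> hm sx; have [B1 [mB1 B1le B1h]] := large_mean x d.
have [B2 [mB2 B2le B2h]] := large_count x d hm.
apply: (stop_core_half gridD (@sparse_bad_cell m) sx (B := B1 `|` B2)) => //.
- exact: measurableU.
- move=> y xy [e de /orP[h|h]].
    by left; apply: (B1h y e) => //; [exact: ltnW|rewrite -(cell_up (leqnn d) xy)].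
  by right; apply: (B2h y e) => //; exact: ltnW.
- apply: le_trans (measureU2 _ mB1 mB2) _; apply: le_trans (leeD B1le B2le) _.
  by rewrite mu_cube -!EFinM -EFinD lee_fin; lra.
Qed.

End sparsify.

Lemma le_sum_esum (R : realType) (T : choiceType) (S : set T) (a : T -> \bar R)
    (s : seq T) : uniq s -> (forall t, t \in s -> S t) ->
  (\sum_(t <- s) a t <= \esum_(t in S) a t)%E.
Proof.
move=> us sS; apply: esum_ge; exists [set` s]; last by rewrite fsbig_seq.
by split => // t /=; exact: sS.
Qed.

(** * Near stopping cells and the far chain as one sparse family *)

Section sparse_family.
Variables (R : realType) (n : nat) (n_gt0 : (0 < n)%N) (D : set (cube R n)).
Local Notation Rn := 'rV[R]_n.
Local Notation mu := (lebesgue_rV R n).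
Hypothesis gridD : dyadic_grid D.
Variables (K K' : int) (KK' : K + 4 <= K') (bad : Rn -> nat -> nat -> bool).
Local Notation c d x := (cell D (K - d%:Z) x).
Hypothesis bad_cell : forall x y i d, (i < d)%N -> cube_set (c d x) y ->
  bad y i d = bad x i d.
Hypothesis core : forall x d, stop (bad x) d ->
  ((2^-1)%:E * mu (cube_set (c d x)) <= mu (stop_core K bad (c d x)))%E.

Definition near_stops : set (cube R n) :=
  [set Q | exists x d, [/\ supb (2 ^ K) x, stop (bad x) d & Q = c d x]].
Definition far_chain : set (cube R n) := [set Q | exists2 k, K' <= k & Q = cell D k 0].

(** A cube of side [4 * 2 ^ K] centred at the origin: it contains every cell of side at most [2 ^ K]
    that meets the sup-norm ball of radius [2 ^ K]. *)
Let box : set Rn := cube_set (Cube (\row_(i < n) - (2 ^ (K + 1))) (exprz_gt0 (K + 2) (ltr0Sn R 1))).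

(** The side tells the two kinds of cells apart, near cells having side at most [2 ^ K < 2 ^ K'].
    From a far cell all smaller cells around the origin are removed; this amounts to removing the
    previous one, without naming the level of [Q]. *)
Definition family_core (Q : cube R n) : set Rn :=
  if 2 ^ K' <= side Q then
    cube_set Q `\` (\bigcup_(k in [set k : int | 2 ^ k < side Q]) cube_set (cell D k 0) `|` box)
  else stop_core K bad Q.

Lemma near_box Q x : near_stops Q -> cube_set Q x -> box x.
Proof.
move=> [z [d [zM _ ->]]] xQ i; have := xQ i; have := mem_cell gridD (K - d%:Z) z i.
rewrite /= mxE side_cell // => /andP[h1 h2] /andP[h3 h4].
have := zM i; rewrite ler_norml => /andP[h5 h6].
have h7 : 2 ^ (K - d%:Z) <= 2 ^ K :> R.
  by rewrite ler_weXz2l ?ler1n // gerBl.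
have -> : 2 ^ (K + 1) = 2 * 2 ^ K :> R by rewrite expfzDr ?pnatr_eq0 // mulrC expr1z.
have -> : 2 ^ (K + 2) = 4 * 2 ^ K :> R.
  by rewrite expfzDr ?pnatr_eq0 // mulrC; congr (_ * _); rewrite -exprnP; ring.
by apply/andP; split; lra.
Qed.

Lemma near_side Q : near_stops Q -> side Q <= 2 ^ K.
Proof.
by move=> [x [d [_ _ ->]]]; rewrite side_cell // ler_weXz2l ?ler1n // gerBl.
Qed.

Lemma KltK' : 2 ^ K < 2 ^ K' :> R.
Proof. by rewrite ltr_eXz2l ?ltr1n //; apply: lt_le_trans KK'; rewrite ltrDl. Qed.

(** Near cells keep half of their volume. A far cell loses at most half to its predecessor, and at
    most a quarter to [box], whose side is at most a quarter of its own because [K + 4 <= K']; a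
    quarter is left. *)
Lemma family_sparse : sparse 4^-1 (near_stops `|` far_chain).
Proof.
have nearE Q : near_stops Q -> family_core Q = stop_core K bad Q.
  by move=> /near_side h; rewrite /family_core leNgt (le_lt_trans h KltK').
have farE k : K' <= k -> family_core (cell D k 0) =
    cube_set (cell D k 0) `\` (cube_set (cell D (k - 1) 0) `|` box).
  move=> kK; rewrite /family_core side_cell // ler_weXz2l ?ler1n //.
  congr (_ `\` (_ `|` _)); apply/seteqP; split=> [y [l lk ly]|y ky].
    move: lk; rewrite /= pow2_lt => lk; apply: cell_mono ly => //.
    by apply: pow2_le; rewrite -ltzD1 subrK.
  by exists (k - 1) => //=; rewrite pow2_lt gtrBl.
exists family_core; split.
  apply/trivIsetP => P Q [nP|[k kK ->]] [nQ|[l lK ->]] PQ.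
  - rewrite !nearE //; apply/seteqP; split => // y [yP yQ].
    move: nP nQ yP yQ PQ => [x [d [_ sx ->]]] [x' [d' [_ sx' ->]]] yP yQ.
    by rewrite (stop_core_disj gridD bad_cell sx sx' yP yQ) eqxx.
  - rewrite (nearE _ nP) farE //; apply/seteqP; split => // y [[yP _] [_ no]].
    by apply: no; right; exact: near_box yP.
  - rewrite (nearE _ nQ) farE //; apply/seteqP; split => // y [[_ no] [yQ _]].
    by apply: no; right; exact: near_box yQ.
  - have kl : k != l by apply: contraNneq PQ => ->.
    wlog : k l kK lK kl {PQ} / k < l.
      move=> w; move: (kl); rewrite neq_lt => /orP[h|h]; first exact: w.
      by rewrite setIC; apply: w; rewrite // eq_sym.
    move=> h; rewrite !farE //; apply/seteqP; split => // y [[yk _] [_ no]].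
    apply: no; left; apply: cell_mono yk => //.
    by apply: pow2_le; rewrite -ltzD1 subrK.
move=> Q [nQ|[k kK ->]].
  rewrite nearE //; case: (nQ) => x [d [_ sx ->]]; split.
  - exact: (measurable_stop_core gridD bad_cell).
  - by move=> y [].
  - apply: le_trans (core sx); apply: lee_wpmul2r; rewrite ?lee_fin //; lra.
rewrite farE //; set Qk := cell D k 0; set Qp := cell D (k - 1) 0.
have mQk : measurable (cube_set Qk) by exact: measurable_cube.
have mQp : measurable (cube_set Qp) by exact: measurable_cube.
have mbox : measurable box by exact: measurable_cube.
have mU : measurable (cube_set Qp `|` box) by exact: measurableU.
have mD : measurable (cube_set Qk `\` (cube_set Qp `|` box)) by exact: measurableD.
split; [exact: mD|by move=> y []|].
have h : (mu (cube_set Qk) <= mu (cube_set Qk `\` (cube_set Qp `|` box)) +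
    (mu (cube_set Qp) + mu box))%E.
  apply: (@le_trans _ _ (mu (cube_set Qk `\` (cube_set Qp `|` box)) + mu (cube_set Qp `|` box))%E).
    apply: le_trans (measureU2 _ _ _) => //; apply: le_measure; rewrite ?inE //.
      exact: measurableU.
    move=> y yk; have [h|h] := pselect ((cube_set Qp `|` box) y); first by right.
    by left.
  by apply: leeD2l; exact: measureU2.
have := h; rewrite !mu_cube !side_cell //= -EFinD.
have : (mu (cube_set Qk `\` (cube_set Qp `|` box)) <= mu (cube_set Qk))%E.
  by apply: le_measure; rewrite ?inE // => y [].
rewrite mu_cube side_cell //.
set V : R := (2 ^ k) ^+ n.
have V0 : 0 < V by rewrite exprn_gt0 // exprz_gt0.
have Vp : (2 ^ (k - 1)) ^+ n <= 2^-1 * V.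
  rewrite expfzDr ?pnatr_eq0 // exprMn mulrC ler_pM2r //.
  rewrite exprN1 -[leRHS]expr1; apply: ler_wiXn2l => //; rewrite ?invr_ge0 // invf_le1 //; lra.
have Vb : (2 ^ (K + 2)) ^+ n <= 4^-1 * V.
  have -> : K + 2 = k + (K + 2 - k) by ring.
  rewrite expfzDr ?pnatr_eq0 // exprMn mulrC ler_pM2r //.
  have t4 : 2 ^ (K + 2 - k) <= 4^-1 :> R.
    have -> : 4^-1 = 2 ^ (- 2%:Z) :> R by rewrite -exprnN; congr (_^-1); ring.
    by rewrite ler_weXz2l ?ler1n //; move: KK' kK; lia.
  apply: le_trans (t4); rewrite -[leRHS]expr1; apply: ler_wiXn2l => //.
  - by rewrite ltW // exprz_gt0.
  - by apply: le_trans t4 _; lra.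
have := measure_ge0 mu (cube_set Qk `\` (cube_set Qp `|` box)).
case: (mu _) => [r||] //= _ _; rewrite -EFinM -EFinD !lee_fin; lra.
Qed.

End sparse_family.

(** This is [stop_dominate] with [A = 4]: as long as the mean does not jump, its root grows by a
    factor at most [4 ^ (1/s) <= 4]. Selected cells at different depths have different sides, so
    they are distinct members of [S] and each contributes its own term to the sum. *)
Lemma near_stops_dominate (R : realType) (n : nat) (D : set (cube R n))
    (gridD : dyadic_grid D) (nu : {measure set 'rV[R]_n -> \bar R}) (K : int)
    (F : set (cube R n)) (m d : nat) (s : R) (x : 'rV[R]_n)
    (S : set (cube R n)) (av : cube R n -> \bar R) :
  1 <= s -> supb (2 ^ K) x ->
  near_stops D K (sparse_bad D nu K F m) `<=` S ->
  (forall Q, av Q = (mean nu Q `^ s^-1)%:E) ->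
  ((\sum_(0 <= j < d.+1 | fam D K F x j) mean nu (cell D (K - j%:Z) x) `^ s^-1)%:E <=
   (4 * m.+1%:R)%:E * \esum_(Q in S) (av Q * (\1_(cube_set Q) x)%:E))%E.
Proof.
move=> s1 xK sub avE; pose a j := mean nu (cell D (K - j%:Z) x) `^ s^-1.
pose bad := sparse_bad D nu K F m x.
have h : \sum_(0 <= j < d.+1 | fam D K F x j) a j <=
    4 * m.+1%:R * \sum_(0 <= j < d.+1 | stop bad j) a j.
  apply: stop_dominate => [i||i j ij]; [exact: powR_ge0|by lra|].
  rewrite /bad /sparse_bad negb_or -leNgt -ltnNge => /andP[h1 h2]; split; last exact: ltnW.
  apply: (@le_trans _ _ ((4 * mean nu (cell D (K - i%:Z) x)) `^ s^-1)).
    apply: ge0_ler_powR h1; rewrite ?nnegrE; first by rewrite invr_ge0 (le_trans ler01).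
      exact: mean_ge0.
    by rewrite mulr_ge0 // mean_ge0.
  rewrite powRM ?mean_ge0 // ler_wpM2r ?powR_ge0 //.
  rewrite -[leRHS]powRr1 // ler_powR //; first by lra.
  by rewrite invf_le1 //; lra.
apply: (@le_trans _ _ (4 * m.+1%:R * \sum_(0 <= j < d.+1 | stop bad j) a j)%:E).
  by rewrite lee_fin.
rewrite [leLHS]EFinM; apply: lee_wpmul2l; first by rewrite lee_fin mulr_ge0.
rewrite -sumEFin.
pose l := [seq cell D (K - j%:Z) x | j <- index_iota 0 d.+1 & stop bad j].
have ul : uniq l.
  rewrite map_inj_uniq ?filter_uniq ?iota_uniq // => i j /(congr1 (@side _ _)).
  by rewrite !side_cell // => /pow2_inj/addrI/oppr_inj[].
have lS Q : Q \in l -> S Q.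
  by move=> /mapP[j]; rewrite mem_filter => /andP[sj _] ->; apply: sub; exists x, j.
apply: le_trans (le_sum_esum _ ul lS).
rewrite big_map big_filter; apply: lee_sum => j _.
by rewrite avE indicE mem_set ?mule1 //; exact: mem_cell.
Qed.

(** * The sharp maximal function controls the oscillation *)

(** Level sets of suprema are known through outer measure only; the slack between [v] and [w] buys a
    measurable cover. *)
Lemma measurable_hull d (X : measurableType d) (R : realType)
    (m : {measure set X -> \bar R}) (A : set X) (v w : R) : v < w ->
  (mu_ext m A <= v%:E)%E ->
  exists B, [/\ measurable B, A `<=` B & (m B <= w%:E)%E].
Proof.
move=> vw Av; have : (mu_ext m A < w%:E)%E by apply: le_lt_trans Av _; rewrite lte_fin.
move=> /ereal_inf_lt[_ [F [mF AF] <-] Fw]; exists (\bigcup_i F i); split => //.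
- exact: bigcup_measurable.
- apply: le_trans (ltW Fw); apply: measure_sigma_subadditive => //.
  exact: bigcup_measurable.
Qed.

Lemma ae_xsection d1 d2 (X : measurableType d1) (Y : measurableType d2) (R : realType)
    (m1 : {measure set X -> \bar R}) (m2 : {sigma_finite_measure set Y -> \bar R})
    (N : set (X * Y)) : measurable N -> (m1 \x m2)%E N = 0%E ->
  {ae m1, forall x, m2 (xsection N x) = 0%E}.
Proof.
move=> mN N0; have mf := measurable_fun_xsection m2 mN.
have := (ae_eq_integral_abs m1 measurableT mf).1; rewrite /ae_eq.
case=> [|Z [mZ Z0 ZP]].
  rewrite -N0 /product_measure1; apply: eq_integral => x _.
  by rewrite gee0_abs // measure_ge0.
exists Z; split => // x /= h; apply: ZP => /= h'; apply: h; exact: h'.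
Qed.

Section sharp.
Variables (R : realType) (n : nat).
Local Notation Rn := 'rV[R]_n.
Local Notation mu := (lebesgue_rV R n).
Variables (U : (Rn -> R[i]) -> Rn -> \bar R) (alpha : R).
Hypothesis U_ge0 : forall f x, (0 <= U f x)%E.

(** The essential supremum ignores a null set of pairs, so for almost every [x] in [Q] almost every
    [y] is an admissible partner. As [B] does not fill [Q], some partner lies in [Q] off [B], where
    the value is at most [Y]; the oscillation carries this over to [x]. *)
Lemma sharp_oscillation f Q z (V Y : R) (B : set Rn) :
  cube_set Q z -> (`|sharp_maximal U alpha f z| <= V%:E)%E ->
  measurable B -> (mu B < mu (cube_set Q))%E ->
  {ae mu, forall x, cube_set Q x -> ~ B x -> (U (cutoff f (~` dilate alpha Q)) x <= Y%:E)%E} ->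
  {ae mu, forall x, cube_set Q x -> (U (cutoff f (~` dilate alpha Q)) x <= (Y + V)%:E)%E}.
Proof.
set f2 := cutoff f _ => Qz zV mB Bq [N1 [mN1 N10 N1P]].
have : (ess_sup (mu \x mu)%E (fun z => `|U f2 z.1 - U f2 z.2| *
    (\1_(cube_set Q `*` cube_set Q) z)%:E) <= V%:E)%E.
  apply: le_trans zV; apply: (@le_trans _ _ (sharp_maximal U alpha f z)); last exact: lee_abs.
  by apply: ereal_sup_ubound; exists Q.
move=> /ess_supP[N [mN N0 NP]].
have [N2 [mN2 N20 N2P]] := ae_xsection mN N0.
exists N2; split => // x /=; apply: contra_notP => nx Qx.
have x0 : mu (xsection N x) = 0%E by apply: contrapT => h; apply: nx; exact: N2P.
have mx : measurable (xsection N x) by exact: measurable_xsection.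
have [y [Qy ny]] : exists y, cube_set Q y /\ ~ (B `|` (N1 `|` xsection N x)) y.
  apply: contrapT => no; have sub : cube_set Q `<=` B `|` (N1 `|` xsection N x).
    by move=> y Qy; apply: contrapT => h; apply: no; exists y.
  have := @le_measure _ _ _ mu (cube_set Q) _ _ _ sub; rewrite !inE => h.
  have m1 : measurable (N1 `|` xsection N x) by exact: measurableU.
  have : (mu (cube_set Q) <= mu B)%E.
    apply: le_trans (h (measurable_cube _) (measurableU _ _ mB m1)) _.
    apply: le_trans (measureU2 _ mB m1) _.
    rewrite -[leRHS]adde0 leeD2l //; apply: le_trans (measureU2 _ mN1 mx) _.
    rewrite -[leRHS]adde0; apply: leeD; rewrite le_eqVlt; apply/orP; left; apply/eqP.
      exact: N10.
    exact: x0.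
  by rewrite leNgt Bq.
have UY : (U f2 y <= Y%:E)%E.
  have nB : ~ B y by move=> By; apply: ny; left.
  apply: contrapT => h; apply: ny; right; left; apply: N1P => /= h'; apply: h.
  exact: h'.
have : (`|U f2 x - U f2 y| <= V%:E)%E.
  have : ~ N (x, y).
    by move=> Nxy; apply: ny; right; right; rewrite /xsection /= inE.
  move=> h; have := contrapT (fun h' => h (NP (x, y) h')).
  by rewrite /= indicE mem_set // mule1.
move: UY (U_ge0 f2 x) (U_ge0 f2 y).
case: (U f2 y) => [b||] //; case: (U f2 x) => [a||] //=.
rewrite !lee_fin => bY a0 b0 h; have := le_trans (ler_norm (a - b)) h; lra.
Qed.

End sharp.

(** * Power means, and the passage from the exponent s to smaller ones *)

Section power_means.
Variables (R : realType) (n : nat).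
Local Notation Rn := 'rV[R]_n.
Local Notation mu := (lebesgue_rV R n).
Local Notation normc := ComplexField.Normc.normc.
Implicit Types (f : Rn -> R[i]) (E : set Rn) (Q : cube R n).

Lemma normc_ge0 (z : R[i]) : 0 <= normc z.
Proof. by case: z => a b; exact: sqrtr_ge0. Qed.

Lemma normc_opp (z : R[i]) : normc (- z) = normc z.
Proof. by case: z => a b /=; rewrite !sqrrN. Qed.

Lemma measurable_normc E f : measurable E -> cmeasurable E f ->
  measurable_fun E (fun x => normc (f x) : measurableTypeR R).
Proof.
move=> mE [mr mi]; rewrite (_ : (fun x => _) =
  (@powR R ^~ 2^-1) \o (fun x => complex.Re (f x) ^+ 2 + complex.Im (f x) ^+ 2)).
  apply: measurableT_comp; first exact: measurable_powR.
  by apply: measurable_funD; apply: measurable_funX.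
apply/funext => x /=; rewrite powR12_sqrt ?addr_ge0 ?sqr_ge0 //.
by case: (f x).
Qed.

Definition pint p E f : \bar R := (\int[mu]_(x in E) (normc (f x) `^ p)%:E)%E.

Lemma measurable_pow p E f : measurable E -> cmeasurable E f ->
  measurable_fun E (fun x => (normc (f x) `^ p)%:E : \bar R).
Proof.
move=> mE mf; apply/measurable_EFinP.
apply: (measurableT_comp (measurable_powR p)); exact: measurable_normc.
Qed.

Lemma cmeasurableS E E' f : measurable E' -> E `<=` E' -> cmeasurable E' f -> cmeasurable E f.
Proof. by move=> mE' EE' [h1 h2]; split; [exact: measurable_funS h1|exact: measurable_funS h2]. Qed.

Lemma pint_ge0 p E f : (0 <= pint p E f)%E.
Proof. by apply: integral_ge0 => x _; rewrite lee_fin powR_ge0. Qed.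

Lemma pintS p E E' f : measurable E -> measurable E' -> E `<=` E' -> cmeasurable E' f ->
  (pint p E f <= pint p E' f)%E.
Proof.
move=> mE mE' EE' mf; apply: ge0_subset_integral => //; first exact: measurable_pow.
by move=> x _; rewrite lee_fin powR_ge0.
Qed.

Lemma cutoffE f E x : cutoff f E x = if x \in E then f x else 0.
Proof. by rewrite /cutoff indicE; case: ifP => _; rewrite ?mulr1 ?mulr0. Qed.

Lemma cutoff_cutoff f E E' : cutoff (cutoff f E) E' = cutoff f (E `&` E').
Proof.
apply/funext => x; rewrite !cutoffE in_setI.
by case: (x \in E); case: (x \in E').
Qed.

Lemma cmeasurable_cutoff E f : measurable E -> cmeasurable setT f ->
  cmeasurable setT (cutoff f E).
Proof.
move=> mE [mr mi]; split.
- rewrite (_ : (fun x => _) = (fun x => complex.Re (f x) * (\1_E x : R))).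
    by apply: measurable_funM => //; exact: measurable_indic.
  by apply/funext => x; rewrite cutoffE indicE; case: ifP; rewrite ?mulr1 ?mulr0.
- rewrite (_ : (fun x => _) = (fun x => complex.Im (f x) * (\1_E x : R))).
    by apply: measurable_funM => //; exact: measurable_indic.
  by apply/funext => x; rewrite cutoffE indicE; case: ifP; rewrite ?mulr1 ?mulr0.
Qed.

Lemma pint_cutoff p D E f : p != 0 -> measurable E -> measurable D ->
  pint p D (cutoff f E) = pint p (D `&` E) f.
Proof.
move=> p0 mE mD; rewrite /pint integral_mkcondr; apply: eq_integral => x _.
rewrite cutoffE patchE; case: ifP => // _.
by rewrite ComplexField.Normc.normc0 powR0.
Qed.

(** In place of Hoelder: [u ^ p <= t ^ p + t ^ (p - s) * u ^ s], according to whether [u <= t] or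
    [u > t]. Each summand integrates over [Q] to at most [t ^ p * side Q ^+ n], whence the factor
    2. *)
Lemma pint_le p s E Q f t : 1 <= p -> p <= s -> 0 < t -> measurable E ->
  E `<=` cube_set Q -> cmeasurable setT f ->
  (pint s (cube_set Q) f <= (t `^ s * side Q ^+ n)%:E)%E ->
  (pint p E f <= (2 * t `^ p * side Q ^+ n)%:E)%E.
Proof.
move=> p1 ps t0 mE EQ mf fQ.
have mQ := measurable_cube Q.
have mfQ : cmeasurable (cube_set Q) f by exact: cmeasurableS mf.
apply: le_trans (pintS p mE mQ EQ mfQ) _.
pose k := t `^ (p - s).
have k0 : 0 <= k by exact: powR_ge0.
have tp0 : 0 <= t `^ p by exact: powR_ge0.
apply: (@le_trans _ _ (\int[mu]_(x in cube_set Q) ((t `^ p)%:E + k%:E * (normc (f x) `^ s)%:E))%E).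
  apply: ge0_le_integral => //.
  - by move=> x _; rewrite lee_fin powR_ge0.
  - exact: measurable_pow.
  - by apply: emeasurable_funD => //; apply: measurable_funeM; exact: measurable_pow.
  move=> x _; rewrite lee_fin; set u := normc (f x).
  have u0 : 0 <= u by exact: normc_ge0.
  have [ut|tu] := leP u t.
    apply: (@le_trans _ _ (t `^ p)); last by rewrite lerDl mulr_ge0 // powR_ge0.
    by apply: ge0_ler_powR => //; rewrite ?nnegrE ?ltW //; lra.
  apply: (@le_trans _ _ (k * u `^ s)); last by rewrite lerDr.
  have u1 : 0 < u by exact: lt_trans tu.
  have -> : u `^ p = u `^ (p - s) * u `^ s.
    by rewrite -powRD ?subrK //; apply/implyP => _; rewrite gt_eqF.
  rewrite ler_wpM2r ?powR_ge0 // /k -(opprB s p) !powRN lef_pV2 ?posrE ?powR_gt0 //.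
  by apply: ge0_ler_powR; rewrite ?nnegrE ?subr_ge0 // ltW.
rewrite ge0_integralD //; last 2 first.
- by move=> x _; rewrite -EFinM lee_fin mulr_ge0 // powR_ge0.
- by apply: measurable_funeM; exact: measurable_pow.
rewrite integral_cst // ge0_integralZl //; last 2 first.
- exact: measurable_pow.
- by move=> x _; rewrite lee_fin powR_ge0.
apply: (@le_trans _ _ ((t `^ p)%:E * (side Q ^+ n)%:E + k%:E * (t `^ s * side Q ^+ n)%:E)%E).
  apply: leeD; last exact: lee_wpmul2l.
  by rewrite le_eqVlt; apply/orP; left; apply/eqP; congr (_ * _)%E; exact: mu_cube.
rewrite -!EFinM -EFinD lee_fin mulrA /k -powRD; last by apply/implyP => _; rewrite gt_eqF.
by rewrite subrK -mulrA mulr2n mulrDl mul1r.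
Qed.

Lemma avgE p Q f : avg p Q f = ((((side Q ^+ n)^-1)%R%:E * pint p (cube_set Q) f) `^ p^-1)%E.
Proof.
by rewrite /avg mu_cube inver gt_eqF // exprn_gt0 // side_gt0.
Qed.

Lemma root_le p t (v : \bar R) (V : R) : 1 <= p -> 0 < t -> 0 <= V ->
  (0 <= v)%E -> (v <= (2 * t `^ p * V)%:E)%E -> (v `^ p^-1 <= (2 * t * V `^ p^-1)%:E)%E.
Proof.
move=> p1 t0 V0; case: v => // v; rewrite !lee_fin => v0 vt.
have p0 : 0 <= p^-1 by rewrite invr_ge0; lra.
apply: (@le_trans _ _ ((2 * t `^ p * V) `^ p^-1)).
  by apply: ge0_ler_powR; rewrite ?nnegrE ?mulr_ge0 ?powR_ge0.
have t0' := ltW t0.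
rewrite !powRM ?mulr_ge0 ?powR_ge0 // -powRrM mulfV ?powRr1 //; last by lra.
rewrite !ler_wpM2r ?powR_ge0 //.
apply: ler1_powR; [lra|by rewrite invf_le1 //; lra].
Qed.

Lemma avg_le p s E Q f t : 1 <= p -> p <= s -> 0 < t -> measurable E ->
  cmeasurable setT f ->
  (pint s (cube_set Q) f <= (t `^ s * side Q ^+ n)%:E)%E ->
  (avg p Q (cutoff f E) <= (2 * t)%:E)%E.
Proof.
move=> p1 ps t0 mE mf fQ; rewrite avgE.
have V0 : 0 < side Q ^+ n by rewrite exprn_gt0 // side_gt0.
have -> : 2 * t = 2 * t * 1 `^ p^-1 by rewrite powR1 mulr1.
apply: root_le => //.
  by rewrite mule_ge0 ?pint_ge0 // lee_fin invr_ge0 ltW.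
rewrite pint_cutoff //; [|lra|exact: measurable_cube].
have h : (pint p (cube_set Q `&` E) f <= (2 * t `^ p * side Q ^+ n)%:E)%E.
  apply: pint_le fQ => //; apply: measurableI => //; exact: measurable_cube.
by rewrite lee_pdivrMl // -EFinM mulr1 mulrC.
Qed.

Lemma Lp_norm_le p s E Q f t : 1 <= p -> p <= s -> 0 < t -> measurable E ->
  E `<=` cube_set Q -> cmeasurable setT f ->
  (pint s (cube_set Q) f <= (t `^ s * side Q ^+ n)%:E)%E ->
  (Lp_norm p (cutoff f E) <= (2 * t * (side Q ^+ n) `^ p^-1)%:E)%E.
Proof.
move=> p1 ps t0 mE EQ mf fQ; rewrite /Lp_norm unlock.
have -> : (\int[mu]_x (`|(normc (cutoff f E x))%:E| `^ p))%E = pint p setT (cutoff f E).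
  by apply: eq_integral => x _; rewrite gee0_abs // lee_fin normc_ge0.
rewrite pint_cutoff //; last lra.
rewrite setTI; apply: root_le => //; first by rewrite exprn_ge0 // ltW // side_gt0.
  exact: pint_ge0.
exact: pint_le fQ.
Qed.

Lemma inLp_cutoff p s E Q f : 1 <= p -> p <= s -> measurable E ->
  E `<=` cube_set Q -> inLp s setT f -> inLp p setT (cutoff f E).
Proof.
move=> p1 ps mE EQ [mf fs]; split; first exact: cmeasurable_cutoff.
suff : (pint p setT (cutoff f E) < +oo)%E by [].
rewrite pint_cutoff //; last lra.
rewrite setTI; have mQ := measurable_cube Q.
have V0 : 0 < side Q ^+ n by rewrite exprn_gt0 // side_gt0.
have fQ : (pint s (cube_set Q) f < +oo)%E by exact: le_lt_trans (pintS s mQ _ _ mf) fs.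
(* Adding 1 keeps [t] positive when the mean vanishes. *)
pose t := (fine (pint s (cube_set Q) f) / side Q ^+ n + 1) `^ s^-1.
have w0 : 0 <= fine (pint s (cube_set Q) f) / side Q ^+ n.
  by rewrite divr_ge0 ?fine_ge0 ?pint_ge0 // ltW.
have t0 : 0 < t by rewrite powR_gt0 //; lra.
apply: le_lt_trans (@pint_le p s E Q f t p1 ps t0 mE EQ mf _) (ltry _).
rewrite /t -powRrM mulVf ?powRr1; [|lra|lra].
rewrite -[leLHS]fineK ?ge0_fin_numE ?pint_ge0 // lee_fin mulrDl divfK ?gt_eqF // lerDl.
by rewrite mul1r ltW.
Qed.

End power_means.

(** * Exceptional sets for a pair of nested cubes *)

Section local_estimates.
Variables (R : realType) (n : nat).
Local Notation Rn := 'rV[R]_n.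
Local Notation mu := (lebesgue_rV R n).
Variables (U : (Rn -> R[i]) -> Rn -> \bar R) (alpha q r s : R).
Hypotheses (U_ge0 : forall f x, (0 <= U f x)%E) (subU : sublinear U).
Hypotheses (q_ge1 : 1 <= q) (r_ge1 : 1 <= r) (qs : q <= s) (rs : r <= s).
Hypotheses (WU : W_property q U) (sharpU : weak_type r (sharp_maximal U alpha)).
Hypothesis alpha_ge1 : 1 <= alpha.

Let alpha0 : 0 < alpha. Proof. exact: lt_le_trans alpha_ge1. Qed.
Let s_ge1 : 1 <= s. Proof. exact: le_trans qs. Qed.
Local Notation adil := (dil alpha0).

(** The bound [t] is a free number, taken positive in the estimates, instead of the mean itself;
    vanishing means are recovered afterwards in [annulus_am] and [local_am]. *)
Definition small t f (Q : cube R n) :=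
  (pint s (cube_set Q) f <= (t `^ s * side Q ^+ n)%:E)%E.

Lemma weak_W lam : 0 < lam < 1 -> exists2 B, 0 <= B &
  forall f E Q t, cmeasurable setT f -> measurable E -> E `<=` cube_set Q ->
    0 < t -> small t f Q ->
    (mu_ext mu (cube_set Q `&` [set x | ((B * t)%:E < U (cutoff f E) x)%E])
      <= (lam * side Q ^+ n)%:E)%E.
Proof.
(* The 2 is lost in [avg_le]; the maximum with 0 is there because [psi] may take negative values. *)
move=> lam01; have [psi [_ Wpsi]] := WU; exists (2 * Num.max (psi lam) 0).
  by rewrite mulr_ge0 // le_max lexx orbT.
move=> f E Q t mf mE EQ t0 fQ.
have fE : cutoff (cutoff f E) (cube_set Q) = cutoff f E.
  by rewrite cutoff_cutoff setIidl.
have av := avg_le q_ge1 qs t0 mE mf fQ.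
have mQ := measurable_cube Q.
have fEq : inLp q (cube_set Q) (cutoff f E).
  split; first exact: cmeasurableS (cmeasurable_cutoff mE mf).
  have q0 : q != 0 by apply/eqP => q0; move: q_ge1; rewrite q0 ler10.
  rewrite -[X in (X < _)%E]/(pint q (cube_set Q) (cutoff f E)).
  rewrite pint_cutoff // setIidr //.
  exact: le_lt_trans (pint_le q_ge1 qs t0 mE EQ mf fQ) (ltry _).
have := Wpsi Q (cutoff f E) lam fEq lam01; rewrite fE mu_cube -EFinM.
apply: le_trans; apply: le_mu_ext => x [Qx /= h]; split => //=.
apply: lt_le_trans (lee_abs _); apply: le_lt_trans h.
apply: (@le_trans _ _ ((Num.max (psi lam) 0)%:E * avg q Q (cutoff f E))%E).
  by apply: lee_wpmul2r; rewrite ?poweR_ge0 // lee_fin le_max lexx.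
rewrite [in leRHS]mulrAC mulrC [in leRHS]EFinM; apply: lee_wpmul2l => //.
by rewrite lee_fin le_max lexx orbT.
Qed.

Lemma weak_sharp del : 0 < del <= 1 -> exists2 B, 0 < B &
  forall f E Q t, inLp s setT f -> measurable E -> E `<=` cube_set Q ->
    0 < t -> small t f Q ->
    (mu_ext mu [set x | ((B * t)%:E < `|sharp_maximal U alpha (cutoff f E) x|)%E]
      <= (del * side Q ^+ n)%:E)%E.
Proof.
move=> /andP[del0 del1]; have [C hC] := sharpU.
pose C' := Num.max C 1; have C'0 : 0 < C' by rewrite lt_max ltr01 orbT.
(* At this height the weak type gives [del ^ r * side Q ^+ n], which is at most [del * side Q ^+ n]
   as [del <= 1 <= r]. *)
exists (2 * C' / del); first by rewrite divr_gt0 // mulr_gt0.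
move=> f E Q t fs mE EQ t0 fQ; case: (fs) => mf _.
have V0 : 0 < side Q ^+ n by rewrite exprn_gt0 // side_gt0.
have Bt0 : 0 < 2 * C' / del * t by rewrite mulr_gt0 // divr_gt0 // mulr_gt0.
have := hC _ (inLp_cutoff r_ge1 rs mE EQ fs) _ Bt0.
set X := mu_ext mu _ => h.
have X0 : (0 <= X)%E by exact: mu_ext_ge0.
have r0 : r != 0 by apply/eqP => r0; move: r_ge1; rewrite r0 ler10.
have : (X `^ r^-1 <= (del * (side Q ^+ n) `^ r^-1)%:E)%E.
  have : ((2 * C' / del * t)%:E * X `^ r^-1 <= (C' * (2 * t * (side Q ^+ n) `^ r^-1))%:E)%E.
    apply: le_trans h _; rewrite [leRHS]EFinM.
    apply: (@le_trans _ _ (C'%:E * Lp_norm r (cutoff f E))%E).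
      by apply: lee_wpmul2r; rewrite ?Lnorm_ge0 // lee_fin le_max lexx.
    apply: lee_wpmul2l; first by rewrite lee_fin ltW.
    exact: Lp_norm_le fQ.
  rewrite -lee_pdivlMl // => /le_trans; apply; rewrite -EFinM lee_fin.
  rewrite le_eqVlt; apply/orP; left; apply/eqP; field.
  by rewrite !gt_eqF.
move=> hX; have -> : X = ((X `^ r^-1) `^ r)%E by rewrite -poweRrM mulVf // poweRe1.
apply: (@le_trans _ _ ((del * (side Q ^+ n) `^ r^-1)%:E `^ r)%E).
  apply: gt0_ler_poweR => //; first exact: le_trans r_ge1.
    by rewrite in_itv /= leey poweR_ge0.
  by rewrite in_itv /= leey lee_fin mulr_ge0 ?powR_ge0 // ltW.
rewrite poweR_EFin lee_fin powRM ?powR_ge0 ?(ltW del0) // -powRrM mulVf // powRr1 ?(ltW V0) //.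
by rewrite ler_pM2r //; apply: ge1r_powR => //; rewrite del0.
Qed.

Lemma exists_good Q (A : set Rn) (v : R) : v < side Q ^+ n ->
  (mu_ext mu A <= v%:E)%E -> exists2 z, cube_set Q z & ~ A z.
Proof.
move=> vQ hA; apply: contrapT => no.
have [B [mB AB Bw]] := measurable_hull (midf_lt vQ).1 hA.
have : (mu (cube_set Q) <= mu B)%E.
  apply: le_measure; rewrite ?inE //; first exact: measurable_cube.
  move=> z Qz; apply: AB; apply: contrapT => nA; apply: no; by exists z.
rewrite mu_cube => /le_trans/(_ Bw); rewrite lee_fin leNgt.
by have -> := (midf_lt vQ).2.
Qed.

(** For cubes of comparable size no exceptional set remains: [lam] makes both bad sets, estimated on
    the scale of [alpha P], at most an eighth of [Q], so that each leaves points of [Q] to start the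
    oscillation argument from. *)
Lemma annulus_bound rho : 0 < rho -> exists2 C, 0 <= C &
  forall f Q P E t, inLp s setT f -> cube_set Q `<=` cube_set P ->
    side (adil P) ^+ n <= rho * side Q ^+ n ->
    measurable E -> E `<=` dilate alpha P `\` dilate alpha Q ->
    0 < t -> small t f (adil P) ->
    {ae mu, forall x, cube_set Q x -> (U (cutoff f E) x <= (C * t)%:E)%E}.
Proof.
move=> rho0; pose lam := (8 * (rho + 1))^-1.
have lam0 : 0 < lam by rewrite invr_gt0; lra.
have lam1 : lam < 1 by rewrite invf_lt1; lra.
have lamrho : lam * rho <= 8^-1.
  by rewrite /lam invfM -mulrA ger_pMr ?invr_gt0 // mulrC ler_pdivrMr; lra.
have lam01 : 0 < lam < 1 by rewrite lam0.
have lam01' : 0 < lam <= 1 by rewrite lam0 ltW.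
have [B1 B10 hB1] := weak_W lam01.
have [B2 B20 hB2] := weak_sharp lam01'.
exists (B1 + B2); first by rewrite addr_ge0 // ltW.
move=> f Q P E t fs QP hrho mE EPQ t0 fP; case: (fs) => mf _.
have V0 : 0 < side Q ^+ n by rewrite exprn_gt0 // side_gt0.
have EP : E `<=` cube_set (adil P) by rewrite dilE => x /EPQ[].
have lamV : lam * side (adil P) ^+ n <= 8^-1 * side Q ^+ n.
  apply: (@le_trans _ _ (lam * (rho * side Q ^+ n))); first by rewrite ler_pM2l.
  by rewrite mulrA ler_pM2r.
have h1 := hB1 f E (adil P) t mf mE EP t0 fP.
have h2 := hB2 f E (adil P) t fs mE EP t0 fP.
have v4 : 8^-1 * side Q ^+ n < 4^-1 * side Q ^+ n by rewrite ltr_pM2r //; lra.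
have v1 : 4^-1 * side Q ^+ n < side Q ^+ n by rewrite gtr_pMl //; lra.
have [B [mB hB muB]] : exists B, [/\ measurable B,
   cube_set (adil P) `&` [set x | ((B1 * t)%:E < U (cutoff f E) x)%E] `<=` B
   & (mu B <= (4^-1 * side Q ^+ n)%:E)%E].
  by apply: measurable_hull v4 _; apply: le_trans h1 _; rewrite lee_fin.
have [z Qz hz] : exists2 z, cube_set Q z &
   ~ ((B2 * t)%:E < `|sharp_maximal U alpha (cutoff f E) z|)%E.
  apply: (@exists_good Q _ _ (lt_trans v4 v1)); apply: le_trans h2 _.
  by rewrite lee_fin.
have fE : cutoff (cutoff f E) (~` dilate alpha Q) = cutoff f E.
  by rewrite cutoff_cutoff setIidl // => x /EPQ[].
(* Cutting [cutoff f E] off [alpha Q] does not change it, so its sharp maximal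
   function controls the oscillation of [U (cutoff f E)] itself on [Q]. *)
have := @sharp_oscillation _ _ U alpha U_ge0 (cutoff f E) Q z (B2 * t) (B1 * t) B Qz.
rewrite fE -mulrDl; apply => //.
- by rewrite leNgt; apply/negP.
- by rewrite mu_cube; apply: le_lt_trans muB _; rewrite lte_fin.
- apply: aeW => x Qx nB; rewrite leNgt; apply/negP => h; apply: nB; apply: hB.
  by split => //; rewrite dilE; apply: sub_dilate => //; exact: QP.
Qed.

(** The null set depends on the two functions, so every later use concerns cutoffs fixed before the
    point. *)
Lemma U_split f E1 E2 E : inLp 1 setT (cutoff f E1) -> inLp 1 setT (cutoff f E2) ->
  E = E1 `|` E2 -> E1 `&` E2 = set0 ->
  {ae mu, forall x, (U (cutoff f E) x <= U (cutoff f E1) x + U (cutoff f E2) x)%E}.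
Proof.
move=> h1 h2 -> E12; have -> : cutoff f (E1 `|` E2) = (fun y => cutoff f E1 y + cutoff f E2 y).
  apply/funext => y; rewrite !cutoffE in_setU.
  have : ~~ ((y \in E1) && (y \in E2)) by rewrite -in_setI E12 in_set0.
  by case: (y \in E1); case: (y \in E2) => // _; rewrite ?addr0 ?add0r.
have := subU.1 _ _ h1 h2; apply: filterS => x.
by rewrite !gee0_abs.
Qed.

Lemma U_diff f E1 E2 : inLp 1 setT (cutoff f E1) -> inLp 1 setT (cutoff f E2) ->
  E2 `<=` E1 ->
  {ae mu, forall x, (U (cutoff f (E1 `\` E2)) x <= U (cutoff f E1) x + U (cutoff f E2) x)%E}.
Proof.
move=> h1 h2 E21; pose g y := -1 * cutoff f E2 y.
have gE : inLp 1 setT g.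
  case: h2 => -[m1 m2] hi; split.
    split; [rewrite (_ : (fun x => _) = \- (fun x => complex.Re (cutoff f E2 x)))
           |rewrite (_ : (fun x => _) = \- (fun x => complex.Im (cutoff f E2 x)))].
    - exact: measurableT_comp.
    - by apply/funext => y; rewrite /g /= mulN1r; case: (cutoff f E2 y).
    - exact: measurableT_comp.
    - by apply/funext => y; rewrite /g /= mulN1r; case: (cutoff f E2 y).
  apply: le_lt_trans hi; rewrite le_eqVlt; apply/orP; left; apply/eqP.
  apply: eq_integral => y _; congr (_ `^ _)%:E.
  by rewrite /g mulN1r normc_opp.
have -> : cutoff f (E1 `\` E2) = (fun y => cutoff f E1 y + g y).
  apply/funext => y; rewrite /g !cutoffE mulN1r in_setD.
  have [y2|y2] := boolP (y \in E2) => /=.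
    by rewrite andbF (_ : y \in E1) ?subrr //; move: y2; rewrite !inE => /E21.
  by rewrite andbT oppr0 addr0.
have := subU.1 _ _ h1 gE; apply: filterS2 (subU.2 (-1) _ h2) => x.
rewrite !gee0_abs // => ->; rewrite (_ : ComplexField.Normc.normc _ = 1) ?mul1e //.
by rewrite normc_opp ComplexField.Normc.normc1.
Qed.

Lemma inLp1_cutoff (f : Rn -> R[i]) (E : set Rn) Q : inLp s setT f -> measurable E ->
  E `<=` cube_set Q ->
  inLp 1 setT (cutoff f E).
Proof. by move=> fs mE EQ; exact: (inLp_cutoff (lexx 1) s_ge1 mE EQ fs). Qed.

(** [EP] covers the places where [U] of the cutoff to [alpha P] (within [alpha P]) or its sharp
    maximal function is large; it depends on [P] only. Where [U] of the cutoff to [alpha Q] is large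
    depends on [Q], but is a small part of it by W_q and the bound on the mean over [alpha Q]. Off
    both, sub-linearity bounds the difference, and the oscillation extends this to almost all of
    [Q]. *)
Lemma local_bound th C0 : 0 < th -> 1 <= C0 -> exists2 C, 0 <= C &
  forall f P t, inLp s setT f -> 0 < t -> small t f (adil P) ->
  exists EP, [/\ measurable EP, (mu EP <= (th * side P ^+ n)%:E)%E &
    forall Q, cube_set Q `<=` cube_set P ->
      (mu (cube_set Q `&` EP) <= (2^-1 * side Q ^+ n)%:E)%E ->
      small (C0 * t) f (adil Q) ->
    {ae mu, forall x, cube_set Q x ->
      (U (cutoff f (dilate alpha P `\` dilate alpha Q)) x <= (C * t)%:E)%E}].
Proof.
move=> th0 C01; pose an := alpha ^+ n.
have an0 : 0 < an by rewrite exprn_gt0.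
(* [an] is the ratio of the volumes of [alpha P] and [P]; the choice makes [lam * an] at most both
   [1/8] and [th / 8]. *)
pose lam := (8 * an * (1 + th^-1))^-1.
have th'0 : 0 < th^-1 by rewrite invr_gt0.
have an1 : 1 <= an by rewrite exprn_ege1.
have m0 : 0 < 8 * an * (1 + th^-1) by rewrite !mulr_gt0 //; lra.
have lam0 : 0 < lam by rewrite invr_gt0.
have hlam : lam * an = (8 * (1 + th^-1))^-1.
  by rewrite /lam; field; rewrite !gt_eqF //; nra.
have lam8 : lam * an <= 8^-1.
  by rewrite hlam lef_pV2 ?posrE //; nra.
have lamth : lam * an <= 8^-1 * th.
  rewrite hlam -[X in _ <= X]invrK lef_pV2 ?posrE ?invr_gt0 ?mulr_gt0 ?invr_gt0 //; last by lra.
  by rewrite invfM invrK; lra.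
have lam1 : lam < 1.
  by apply: (@le_lt_trans _ _ (lam * an)); [rewrite ler_peMr // ltW|lra].
have lam01 : 0 < lam < 1 by rewrite lam0.
have lam01' : 0 < lam <= 1 by rewrite lam0 ltW.
have [B1 B10 hB1] := weak_W lam01.
have [B2 B20 hB2] := weak_sharp lam01'.
exists (B1 + B1 * C0 + B2); first by rewrite !addr_ge0 ?mulr_ge0 //; lra.
move=> f P t fs t0 fP; case: (fs) => mf _.
have mP : measurable (dilate alpha P) by exact: measurable_dilate.
have VP : 0 < side P ^+ n by rewrite exprn_gt0 // side_gt0.
have sdil (Q : cube R n) : side (adil Q) ^+ n = an * side Q ^+ n by rewrite /= exprMn.
have h1 := hB1 f (dilate alpha P) (adil P) t mf mP.
have h2 := hB2 f (dilate alpha P) (adil P) t fs mP.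
rewrite sdil !dilE (mulrA lam) in h1 h2.
have {}h1 := h1 (@subset_refl _ _) t0 fP.
have {}h2 := h2 (@subset_refl _ _) t0 fP.
have v4 : lam * an * side P ^+ n < 4^-1 * th * side P ^+ n by rewrite ltr_pM2r //; lra.
have [A1 [mA1 hA1 muA1]] := measurable_hull v4 h1.
have [A2 [mA2 hA2 muA2]] := measurable_hull v4 h2.
exists (A1 `|` A2); split; first exact: measurableU.
  apply: le_trans (measureU2 _ mA1 mA2) _; apply: le_trans (leeD muA1 muA2) _.
  by rewrite -EFinD lee_fin -mulrDl ler_pM2r //; lra.
move=> Q QP hQ fQ.
have VQ : 0 < side Q ^+ n by rewrite exprn_gt0 // side_gt0.
have mQ : measurable (dilate alpha Q) by exact: measurable_dilate.
have t0' : 0 < C0 * t by rewrite mulr_gt0 //; lra.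
have h3 := hB1 f (dilate alpha Q) (adil Q) (C0 * t) mf mQ.
rewrite sdil !dilE (mulrA lam) in h3.
have {}h3 := h3 (@subset_refl _ _) t0' fQ.
have w4 : lam * an * side Q ^+ n < 4^-1 * side Q ^+ n by rewrite ltr_pM2r //; lra.
have [A3 [mA3 hA3 muA3]] := measurable_hull w4 h3.
have [z Qz nz] : exists2 z, cube_set Q z & ~ (cube_set Q `&` (A1 `|` A2)) z.
  apply: (@exists_good Q _ (2^-1 * side Q ^+ n)); first by rewrite gtr_pMl //; lra.
  rewrite measurable_mu_extE //; apply: measurableI; [exact: measurable_cube|exact: measurableU].
have nz2 : ~ A2 z by move=> h; apply: nz; split => //; right.
(* The discarded set has measure at most [1/2 + 1/4] of that of [Q], so it does not fill [Q]. *)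
have := @sharp_oscillation _ _ U alpha U_ge0 (cutoff f (dilate alpha P)) Q z (B2 * t)
  ((B1 + B1 * C0) * t) ((cube_set Q `&` (A1 `|` A2)) `|` A3) Qz.
have -> : cutoff (cutoff f (dilate alpha P)) (~` dilate alpha Q) =
   cutoff f (dilate alpha P `\` dilate alpha Q) by rewrite cutoff_cutoff.
rewrite -[(B1 + B1 * C0) * t + _]mulrDl; apply => //.
- by rewrite leNgt; apply/negP => h; apply: nz2; exact: hA2.
- apply: measurableU => //; apply: measurableI; [exact: measurable_cube|exact: measurableU].
- apply: le_lt_trans (measureU2 _ _ _) _ => //.
    by apply: measurableI; [exact: measurable_cube|exact: measurableU].
  apply: le_lt_trans (leeD hQ muA3) _; rewrite mu_cube -EFinD lte_fin -mulrDl gtr_pMl //; lra.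
have sQP := dilateS alpha_ge1 QP.
have i1 : inLp 1 setT (cutoff f (dilate alpha P)).
  by apply: (@inLp1_cutoff f _ (adil P)) => //; rewrite dilE.
have i2 : inLp 1 setT (cutoff f (dilate alpha Q)).
  by apply: (@inLp1_cutoff f _ (adil Q)) => //; rewrite dilE.
apply: filterS (U_diff i1 i2 sQP) => x hx Qx nB.
apply: le_trans hx _; rewrite mulrDl EFinD; apply: leeD.
  rewrite leNgt; apply/negP => h; apply: nB; left; split => //; left; apply: hA1.
  by split => //; apply: sQP; exact: sub_dilate.
rewrite -mulrA leNgt; apply/negP => h; apply: nB; right; apply: hA3.
by split => //; exact: sub_dilate.
Qed.

End local_estimates.

Section am.
Variables (R : realType) (n : nat) (s : R).
Local Notation Rn := 'rV[R]_n.
Local Notation mu := (lebesgue_rV R n).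
Local Notation normc := ComplexField.Normc.normc.
Hypothesis s_ge1 : 1 <= s.
Let s_gt0 : 0 < s. Proof. exact: lt_le_trans s_ge1. Qed.
Implicit Types (f : Rn -> R[i]) (Q : cube R n).

Definition am f Q : R := (fine (pint s (cube_set Q) f) / side Q ^+ n) `^ s^-1.

Lemma am_ge0 f Q : 0 <= am f Q. Proof. exact: powR_ge0. Qed.

Lemma pint_fin f E : inLp s setT f -> measurable E -> pint s E f \is a fin_num.
Proof.
move=> [mf fs] mE; rewrite ge0_fin_numE ?pint_ge0 //.
by apply: le_lt_trans fs; apply: pintS.
Qed.

Lemma pint_measure f : inLp s setT f ->
  exists nu : {measure set Rn -> \bar R}, forall E, nu E = pint s E f.
Proof.
move=> [mf _]; have mp := measurable_pow s measurableT mf.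
have p0 x : (0 <= (normc (f x) `^ s)%:E)%E by rewrite lee_fin powR_ge0.
by have [nu h] := density_measure mu mp p0; exists nu.
Qed.

Lemma avg_am f Q : inLp s setT f -> avg s Q f = (am f Q)%:E.
Proof.
move=> fs; rewrite avgE -[pint s _ f]fineK; last exact: pint_fin (measurable_cube Q).
by rewrite -EFinM poweR_EFin mulrC.
Qed.

Lemma ratio_ge0 f Q : 0 <= fine (pint s (cube_set Q) f) / side Q ^+ n.
Proof. by rewrite divr_ge0 ?fine_ge0 ?pint_ge0 // exprn_ge0 // ltW // side_gt0. Qed.

Lemma am_small f Q t : inLp s setT f -> am f Q <= t -> small s t f Q.
Proof.
move=> fs h; rewrite /small -[leLHS]fineK; last exact: pint_fin (measurable_cube Q).
rewrite lee_fin -ler_pdivrMr ?exprn_gt0 ?side_gt0 //.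
have -> : fine (pint s (cube_set Q) f) / side Q ^+ n = am f Q `^ s.
  have s0 : s != 0 by exact: lt0r_neq0.
  by rewrite /am -powRrM mulVf // powRr1 // ratio_ge0.
apply: ge0_ler_powR (h); rewrite ?nnegrE ?am_ge0 // ?(ltW s_gt0) //.
by apply: le_trans (h); exact: am_ge0.
Qed.

Lemma le_am f P Q c : inLp s setT f -> cube_set Q `<=` cube_set P ->
  1 <= c -> side P ^+ n <= c * side Q ^+ n -> am f Q <= c * am f P.
Proof.
move=> fs QP c1 hc; have [mf _] := fs.
have mQ := measurable_cube Q; have mP := measurable_cube P.
have VQ : 0 < side Q ^+ n by rewrite exprn_gt0 // side_gt0.
have VP : 0 < side P ^+ n by rewrite exprn_gt0 // side_gt0.
have c0 : 0 <= c by lra.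
have s0 : 0 <= s^-1 by rewrite invr_ge0 ltW.
apply: (@le_trans _ _ ((c * (fine (pint s (cube_set P) f) / side P ^+ n)) `^ s^-1)).
  apply: ge0_ler_powR => //; rewrite ?nnegrE.
    exact: ratio_ge0.
    by apply: mulr_ge0 => //; exact: ratio_ge0.
  have h : fine (pint s (cube_set Q) f) <= fine (pint s (cube_set P) f).
    apply: fine_le; [exact: pint_fin|exact: pint_fin|apply: pintS => //].
    exact: cmeasurableS mf.
  have f0 : 0 <= fine (pint s (cube_set P) f) by rewrite fine_ge0 // pint_ge0.
  rewrite ler_pdivrMr // (le_trans h) // mulrA mulrAC ler_pdivlMr //.
  by rewrite -mulrA mulrCA ler_wpM2l.
rewrite powRM ?ratio_ge0 // ler_wpM2r ?powR_ge0 //.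
by apply: ler1_powR => //; rewrite invf_le1.
Qed.

End am.

Lemma ae_le_limit d (X : measurableType d) (R : realType) (m : {measure set X -> \bar R})
    (u : X -> \bar R) (A : set X) (C a : R) : 0 <= C ->
  (forall t, a < t -> {ae m, forall x, A x -> (u x <= (C * t)%:E)%E}) ->
  {ae m, forall x, A x -> (u x <= (C * a)%:E)%E}.
Proof.
move=> C0 h; have : {ae m, forall x, forall k : nat, A x -> (u x <= (C * (a + k.+1%:R^-1))%:E)%E}.
  by apply/ae_foralln => k; apply: h; rewrite ltrDl invr_gt0.
apply: filterS => x hx Ax; apply/lee_addgt0Pr => e e0.
have [k hk] : exists k : nat, C * k.+1%:R^-1 <= e.
  have := archi_boundP (divr_ge0 C0 (ltW e0)); set k := Num.bound _.
  rewrite ltr_pdivrMr // => hk; exists k.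
  rewrite ler_pdivrMr // mulrC (le_trans (ltW hk)) // ler_wpM2r ?(ltW e0) // ler_nat //.
apply: le_trans (hx k Ax) _; rewrite -EFinD lee_fin mulrDr lerD2l //.
Qed.

Section local_am.
Variables (R : realType) (n : nat).
Local Notation Rn := 'rV[R]_n.
Local Notation mu := (lebesgue_rV R n).
Variables (U : (Rn -> R[i]) -> Rn -> \bar R) (alpha q r s : R).
Hypotheses (U_ge0 : forall f x, (0 <= U f x)%E) (subU : sublinear U).
Hypotheses (q_ge1 : 1 <= q) (r_ge1 : 1 <= r) (qs : q <= s) (rs : r <= s).
Hypotheses (WU : W_property q U) (sharpU : weak_type r (sharp_maximal U alpha)).
Variables (alpha0 : 0 < alpha) (alpha_ge1 : 1 <= alpha).
Local Notation adil := (dil alpha0).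
Let s_ge1 : 1 <= s. Proof. exact: le_trans qs. Qed.

Lemma am0_gt0 (f : Rn -> R[i]) Q t : am s f Q < t -> 0 < t.
Proof. by apply: le_lt_trans; exact: am_ge0. Qed.

Lemma annulus_am rho : 0 < rho -> exists2 C, 0 <= C &
  forall f Q P E, inLp s setT f -> cube_set Q `<=` cube_set P ->
    side (adil P) ^+ n <= rho * side Q ^+ n ->
    measurable E -> E `<=` dilate alpha P `\` dilate alpha Q ->
    {ae mu, forall x, cube_set Q x -> (U (cutoff f E) x <= (C * am s f (adil P))%:E)%E}.
Proof.
move=> rho0; have [C C0 hC] := annulus_bound U_ge0 q_ge1 r_ge1 qs rs WU sharpU alpha_ge1 rho0.
exists C => // f Q P E fs QP hrho mE EPQ; apply: ae_le_limit => // t ht.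
apply: (hC f Q P E t) => //; first exact: am0_gt0 ht.
rewrite /small; have := @am_small _ _ s s_ge1 f (adil P) t fs (ltW ht).
by rewrite /small !dilE.
Qed.

(** The exceptional set of [local_bound] depends on [t], which rules out a limit in [t]. When the
    mean over [alpha P] is zero, [annulus_am] takes over with an empty exceptional set: its constant
    depends on the ratio of the cubes, but is multiplied by zero. *)
Lemma local_am th C0 : 0 < th -> 1 <= C0 -> exists2 C, 0 <= C &
  forall f P, inLp s setT f ->
  exists EP, [/\ measurable EP, (mu EP <= (th * side P ^+ n)%:E)%E &
    forall Q, cube_set Q `<=` cube_set P ->
      (mu (cube_set Q `&` EP) <= (2^-1 * side Q ^+ n)%:E)%E ->
      am s f (adil Q) <= C0 * am s f (adil P) ->
    {ae mu, forall x, cube_set Q x ->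
      (U (cutoff f (dilate alpha P `\` dilate alpha Q)) x <= (C * am s f (adil P))%:E)%E}].
Proof.
move=> th0 C01.
have [C C'0 hC] := local_bound U_ge0 subU q_ge1 r_ge1 qs rs WU sharpU alpha_ge1 th0 C01.
exists C => // f P fs; have [a0|a0] := eqVneq (am s f (adil P)) 0.
  exists set0; split => //.
    by rewrite measure0 lee_fin mulr_ge0 ?exprn_ge0 // ltW // side_gt0.
  move=> Q QP _ _; have VQ : 0 < side Q ^+ n by rewrite exprn_gt0 // side_gt0.
  have VP : 0 < side (adil P) ^+ n by rewrite exprn_gt0 // side_gt0.
  have [C1 _ h1] := annulus_am (divr_gt0 VP VQ).
  rewrite a0 mulr0 -(mulr0 C1) -a0; apply: h1 => //.
    by rewrite divfK // gt_eqF.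
  by apply: measurableD; exact: measurable_dilate.
have t0 : 0 < am s f (adil P) by rewrite lt_neqAle eq_sym a0 am_ge0.
have fP := @am_small _ _ s s_ge1 f (adil P) _ fs (lexx _).
have [EP [h1 h2 h3]] := hC f P (am s f (adil P)) fs t0 fP.
exists EP; split => // Q QP hQ hC0; apply: h3 => //.
exact: am_small.
Qed.

Variables (I : finType) (D : I -> set (cube R n)) (i0 : I).
Hypotheses (gridD : forall j, dyadic_grid (D j)) (coverD : covering_grids D).

(** The covering cube has at most [c] times the volume of [alpha Q], hence side at most [2 ^ L]
    times that of [Q], where [n > 0] lets volumes control sides. Replacing it by the larger cell
    exactly [L] levels above [Q] gives one [L] for all cells. *)
Lemma cover_level : (0 < n)%N -> exists L : nat, forall k x, exists j,
  dilate alpha (cell (D i0) k x) `<=` cube_set (cell (D j) (k + L%:Z) (corner (cell (D i0) k x))).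
Proof.
move=> n0; have [c hc] := coverD.
have [L hL] : exists L : nat, Num.max c 1 * alpha ^+ n <= (2 ^+ L) ^+ n.
  have ca0 : 0 <= Num.max c 1 * alpha ^+ n.
    by rewrite mulr_ge0 ?exprn_ge0 ?(ltW alpha0) // le_max ler01 orbT.
  have := archi_boundP ca0; set L := Num.bound _ => hL; exists L; apply: le_trans (ltW hL) _.
  apply: (@le_trans _ _ (2 ^+ L)); first by rewrite -natrX ler_nat ltnW // ltn_expl.
  rewrite -[leLHS]expr1; apply: ler_weXn2l => //; apply: exprn_ege1; lra.
exists L => k x; set Q := cell (D i0) k x.
have [j [Q' [DQ' sub hQ']]] := hc (adil Q); exists j; rewrite dilE in sub.
have cQ : cube_set Q' (corner Q) by apply/sub/sub_dilate => //; exact: corner_in.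
have [/(_ _ DQ')[l sl] _ _] := gridD j.
have Q'E := cell_unique (gridD j) DQ' sl cQ.
apply: (subset_trans sub); rewrite {1}Q'E; apply: cell_mono => //.
have := hQ'; rewrite !mu_cube sl -EFinM lee_fin /= side_cell // => h.
have {}h : (2 ^ l) ^+ n <= (2 ^ (k + L%:Z)) ^+ n :> R.
  apply: le_trans h _; rewrite exprMn expfzDr ?pnatr_eq0 // exprMn [leRHS]mulrC mulrA.
  rewrite ler_wpM2r ?exprn_ge0 // ?exprz_ge0 //; apply: le_trans hL.
  by rewrite ler_wpM2r ?exprn_ge0 ?(ltW alpha0) // le_max lexx.
rewrite leNgt; apply/negP => lt; move: h; rewrite leNgt.
by rewrite ltrXn2r ?nnegrE ?exprz_ge0 // -lt0n n0.
Qed.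

End local_am.

(** * The stopping-time decomposition *)

Lemma ae_countable d (X : measurableType d) (R : realType) (m : {measure set X -> \bar R})
    (I : Type) (S : set I) (P : I -> X -> Prop) : countable S ->
  (forall i, S i -> {ae m, forall x, P i x}) ->
  {ae m, forall x, forall i, S i -> P i x}.
Proof.
move=> /countable_injP[f finj] h.
have : {ae m, forall x, forall k : nat, forall i, S i -> f i = k -> P i x}.
  apply/ae_foralln => k; have [[i [Si ik]]|no] := pselect (exists i, S i /\ f i = k).
    apply: filterS (h _ Si) => x Px j Sj jk.
    by have -> : j = i by apply: finj; rewrite ?inE // jk ik.
  by apply: aeW => x j Sj jk; exfalso; apply: no; exists j.
by apply: filterS => x hx i Si; exact: (hx (f i) i).
Qed.

Lemma level_shift (k l L : int) : l <= k -> k + L - `|k - l|%N%:Z = l + L.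
Proof. by move=> lk; rewrite gez0_abs ?subr_ge0 //; ring. Qed.

Section decomposition.
Variables (R : realType) (n : nat) (n_gt0 : (0 < n)%N).
Local Notation Rn := 'rV[R]_n.
Local Notation mu := (lebesgue_rV R n).
Variables (U : (Rn -> R[i]) -> Rn -> \bar R) (alpha q r s : R).
Hypotheses (U_ge0 : forall f x, (0 <= U f x)%E) (subU : sublinear U).
Hypotheses (q_ge1 : 1 <= q) (r_ge1 : 1 <= r) (qs : q <= s) (rs : r <= s).
Hypotheses (WU : W_property q U) (sharpU : weak_type r (sharp_maximal U alpha)).
Variables (alpha0 : 0 < alpha) (alpha_ge1 : 1 <= alpha).
Local Notation adil := (dil alpha0).
Let s_ge1 : 1 <= s. Proof. exact: le_trans qs. Qed.

Variables (N : nat) (D : 'I_N.+1 -> set (cube R n)).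
Hypothesis gridD : forall j, dyadic_grid (D j).
Local Notation D0 := (D ord0).
Variable L : nat.
Hypothesis coverL : forall k x, exists j,
  dilate alpha (cell D0 k x) `<=` cube_set (cell (D j) (k + L%:Z) (corner (cell D0 k x))).

(** [alpha Q] is not a cell, but lies in a cell [L] levels above [Q] in one of the grids. If its
    mean is large, then so is, on all of [Q], the dyadic maximal function of that grid for [|f| ^ s]
    restricted to [alpha P]. [B] unites the weak type sets of all the grids. *)
Lemma large_dilated f P A : inLp s setT f -> D0 P -> 0 < A ->
  exists B, [/\ measurable B,
    (mu B <= (N.+1%:R * (alpha ^+ n / A) * side P ^+ n)%:E)%E &
    forall Q z, D0 Q -> cube_set Q `<=` cube_set P -> cube_set Q z -> ~ B z ->
      fine (pint s (cube_set (adil Q)) f) <=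
      A * 2 ^+ (L * n) * (fine (pint s (cube_set (adil P)) f) / side (adil P) ^+ n) * side Q ^+ n].
Proof.
move=> fs DP A0; case: (fs) => mf _.
have mdil (Q : cube R n) : measurable (cube_set (adil Q)) by exact: measurable_cube.
set m := fine (pint s (cube_set (adil P)) f) / side (adil P) ^+ n.
have m_ge0 : 0 <= m by exact: ratio_ge0.
have VP : 0 < side P ^+ n by rewrite exprn_gt0 // side_gt0.
have VaP : 0 < side (adil P) ^+ n by rewrite exprn_gt0 // side_gt0.
have sub Q : cube_set Q `<=` cube_set P -> cube_set (adil Q) `<=` cube_set (adil P).
  by move=> QP; rewrite !dilE; exact: dilateS.
have pfin Q : pint s (cube_set (adil Q)) f \is a fin_num by exact: pint_fin fs (mdil Q).
have pP Q : cube_set Q `<=` cube_set P ->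
    fine (pint s (cube_set (adil Q)) f) <= fine (pint s (cube_set (adil P)) f).
  move=> QP; apply: fine_le => //; apply: pintS => //; first exact: sub.
  exact: cmeasurableS mf.
have [m0|m0] := eqVneq m 0.
  exists set0; split => //.
    by rewrite measure0 lee_fin !mulr_ge0 // ?invr_ge0 ?exprn_ge0 // ltW // ?side_gt0.
  move=> Q z _ QP _ _; rewrite m0 mulr0 mul0r; apply: le_trans (pP _ QP) _.
  by rewrite -(divfK (lt0r_neq0 VaP) (fine _)) -/m m0 mul0r.
have {}m0 : 0 < m by rewrite lt_neqAle eq_sym m0.
have [nu nuE] := pint_measure fs.
have [/(_ _ DP)[k sk] _ _] := gridD ord0.
have Am0 : 0 <= A * m by rewrite mulr_ge0 // ltW.
pose m1 : {measure set Rn -> \bar R} := mscale (NngNum Am0) mu.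
pose m2 : {measure set Rn -> \bar R} := mrestr nu (mdil P).
pose M (j : 'I_N.+1) := [set x | exists d : nat,
  (m1 (cube_set (cell (D j) (k + L%:Z - d%:Z) x)) <=
   m2 (cube_set (cell (D j) (k + L%:Z - d%:Z) x)))%E].
have mM j : measurable (M j) /\ (m1 (M j) <= m2 (M j))%E.
  exact: (dyadic_maximal (gridD j) m1 m2 (k + L%:Z)).
have muM j : (mu (M j) <= (alpha ^+ n / A * side P ^+ n)%:E)%E.
  have [mMj hM] := mM j.
  have : ((A * m)%:E * mu (M j) <= (m * side (adil P) ^+ n)%:E)%E.
    apply: (le_trans hM); rewrite divfK ?gt_eqF // fineK // -nuE.
    have mI : measurable (M j `&` cube_set (adil P)) by exact: measurableI.
    by apply: le_measure; rewrite ?inE // => x [].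
  rewrite -lee_pdivlMl; last exact: mulr_gt0 A0 m0.
  move=> /le_trans; apply; rewrite -EFinM lee_fin.
  rewrite le_eqVlt; apply/orP; left; apply/eqP; rewrite /= exprMn.
  by rewrite invfM -[LHS]mulrA mulKf ?lt0r_neq0 // mulrA [A^-1 * _]mulrC.
pose B := \big[setU/set0]_(i < N.+1) M (inord i).
have mB : measurable B by apply: bigsetU_measurable => i _; case: (mM (inord i)).
exists B; split => //.
  apply: (@le_trans _ _ (\sum_(i < N.+1) mu (M (inord i)))%E).
    have := @content_subadditive _ _ _ mu B (fun i => M (inord i)) N.+1.
    apply => // i _; by case: (mM (inord i)).
  apply: (@le_trans _ _ (\sum_(i < N.+1) (alpha ^+ n / A * side P ^+ n)%:E)%E).
    by apply: lee_sum => i _.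
  by rewrite sumEFin sumr_const card_ord lee_fin -[leLHS]mulr_natl !mulrA.
move=> Q z DQ QP Qz nB.
have [/(_ _ DQ)[l sl] _ _] := gridD ord0.
have lk : l <= k.
  have [] := sub_cube (Ordinal n_gt0) QP; rewrite sl sk => h1 h2.
  have : 2 ^ l <= 2 ^ k :> R by lra.
  by rewrite ler_eXz2l // ltr1n.
have QE := cell_unique (gridD ord0) DQ sl (corner_in Q).
have [j] := coverL l (corner Q); rewrite -QE => cov.
have Qc : cube_set (adil Q) `<=` cube_set (cell (D j) (l + L%:Z) z).
  rewrite dilE (cell_eq (gridD j) (x := corner Q)) //.
  by apply: cov; exact: sub_dilate.
have : ~ M j z.
  move=> Mz; apply: nB; rewrite /B -(bigcup_mkord N.+1 (fun i => M (inord i))).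
  exists j; first exact: ltn_ord.
  by rewrite /= inord_val.
move=> nM; have {nM} : (m2 (cube_set (cell (D j) (l + L%:Z) z)) <
                     m1 (cube_set (cell (D j) (l + L%:Z) z)))%E.
  (* [k - l] is the depth below [k + L] of the cell of level [l + L]. *)
  rewrite ltNge; apply/negP => h; apply: nM; exists `|k - l|%N.
  by rewrite level_shift.
rewrite /m1 /m2 /= /mscale /mrestr /= mu_cube side_cell // => h.
have : (pint s (cube_set (adil Q)) f <= (A * m * (2 ^ (l + L%:Z)) ^+ n)%:E)%E.
  apply: le_trans (ltW h); rewrite -nuE; apply: le_measure; rewrite ?inE //.
    by apply: measurableI => //; exact: measurable_cube.
  by move=> x Qx; split; [exact: Qc|exact: sub Qx].
rewrite -[leLHS]fineK // lee_fin => /le_trans; apply.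
rewrite le_eqVlt; apply/orP; left; apply/eqP.
rewrite expfzDr ?pnatr_eq0 // exprMn -exprnP -exprM sl; ring.
Qed.

(** Half of the allowance [th] goes to the set of [local_am], the other half to that of
    [large_dilated], which fixes [A]. The exceptional set covers at most half of [Q], so some point
    of [Q] is off it, and one such point already bounds the mean over [alpha Q] as [local_am]
    requires. *)
Lemma local_decomposition th : 0 < th -> exists2 C, 1 <= C &
  forall f, inLp s setT f -> exists E : cube R n -> set Rn,
  [/\ forall P, measurable (E P),
    forall P, D0 P -> (mu (E P) <= (th * side P ^+ n)%:E)%E &
    forall P Q, D0 P -> D0 Q -> cube_set Q `<=` cube_set P ->
      (mu (cube_set Q `&` E P) <= (2^-1 * side Q ^+ n)%:E)%E ->
      am s f (adil Q) <= C * am s f (adil P) /\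
      {ae mu, forall x, cube_set Q x ->
        (U (cutoff f (dilate alpha P `\` dilate alpha Q)) x <= (C * am s f (adil P))%:E)%E}].
Proof.
move=> th0; pose th2 := th / 2; have th20 : 0 < th2 by rewrite divr_gt0.
pose A := N.+1%:R * alpha ^+ n / th2.
have A0 : 0 < A by rewrite !mulr_gt0 ?invr_gt0 ?exprn_gt0 // ltr0Sn.
pose C0 := Num.max 1 (A * 2 ^+ (L * n)).
have C01 : 1 <= C0 by rewrite le_max lexx.
have [C C_ge0 hC] := local_am U_ge0 subU q_ge1 r_ge1 qs rs WU sharpU alpha0 alpha_ge1 th20 C01.
exists (Num.max C C0); first by rewrite le_max C01 orbT.
move=> f fs.
have H P : exists E, measurable E /\ (D0 P -> (mu E <= (th * side P ^+ n)%:E)%E /\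
    forall Q, D0 Q -> cube_set Q `<=` cube_set P ->
      (mu (cube_set Q `&` E) <= (2^-1 * side Q ^+ n)%:E)%E ->
      am s f (adil Q) <= C0 * am s f (adil P) /\
      {ae mu, forall x, cube_set Q x ->
        (U (cutoff f (dilate alpha P `\` dilate alpha Q)) x <= (C * am s f (adil P))%:E)%E}).
  have [DP|nDP] := pselect (D0 P); last by exists set0; split.
  have [E1 [mE1 E1le hE1]] := hC f P fs.
  have [E2 [mE2 E2le hE2]] := large_dilated fs DP A0.
  exists (E1 `|` E2); split; first exact: measurableU.
  have VP : 0 < side P ^+ n by rewrite exprn_gt0 // side_gt0.
  move=> _; split.
    apply: le_trans (measureU2 _ mE1 mE2) _; apply: le_trans (leeD E1le E2le) _.
    rewrite -EFinD lee_fin -mulrDl ler_pM2r //.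
    suff -> : N.+1%:R * (alpha ^+ n / A) = th2 by rewrite /th2; lra.
    rewrite /A; field; rewrite !gt_eqF // ?exprn_gt0 // ?ltr0Sn //.
  move=> Q DQ QP hQ.
  have VQ : 0 < side Q ^+ n by rewrite exprn_gt0 // side_gt0.
  have h1 : (mu (cube_set Q `&` E1) <= (2^-1 * side Q ^+ n)%:E)%E.
    apply: le_trans hQ; apply: le_measure; rewrite ?inE.
    - by apply: measurableI => //; exact: measurable_cube.
    - by apply: measurableI; [exact: measurable_cube|exact: measurableU].
    - by move=> x [? ?]; split => //; left.
  have [z Qz nz] : exists2 z, cube_set Q z & ~ (cube_set Q `&` (E1 `|` E2)) z.
    apply: (@exists_good _ _ Q _ (2^-1 * side Q ^+ n)); first by rewrite gtr_pMl //; lra.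
    by rewrite measurable_mu_extE //; apply: measurableI; [exact: measurable_cube|exact: measurableU].
  have amQ : am s f (adil Q) <= C0 * am s f (adil P).
    have := hE2 Q z DQ QP Qz (fun h => nz (conj Qz (or_intror h))).
    set mP := _ / side (adil P) ^+ n => h.
    have h2 : fine (pint s (cube_set (adil Q)) f) / side (adil Q) ^+ n <= C0 * mP.
      rewrite ler_pdivrMr ?exprn_gt0 ?side_gt0 //; apply: le_trans h _.
      have mP0 : 0 <= mP by exact: ratio_ge0.
      apply: (@le_trans _ _ (C0 * mP * side Q ^+ n)).
        by rewrite (ler_wpM2r (ltW VQ)) // ler_wpM2r // le_max lexx orbT.
      have C0mP : 0 <= C0 * mP by rewrite mulr_ge0 // (le_trans ler01).
      by rewrite ler_wpM2l //= exprMn ler_peMl ?(ltW VQ) // exprn_ege1.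
    have s0 : 0 <= s^-1 by rewrite invr_ge0 (le_trans ler01).
    apply: (@le_trans _ _ ((C0 * mP) `^ s^-1)).
      apply: ge0_ler_powR h2; rewrite ?nnegrE ?ratio_ge0 //.
      by rewrite mulr_ge0 ?ratio_ge0 // (le_trans ler01).
    rewrite powRM ?ratio_ge0 //; last exact: le_trans C01.
    rewrite ler_wpM2r ?powR_ge0 //; apply: ler1_powR => //.
    by rewrite invf_le1 // (lt_le_trans ltr01).
  by split => //; exact: hE1.
have [E hE] := choice H; exists E; split.
- by move=> P; case: (hE P).
- by move=> P DP; case: (hE P) => _ /(_ DP)[].
move=> P Q DP DQ QP hQ; have [_ /(_ DP)[_ /(_ Q DQ QP hQ)[h1 h2]]] := hE P; split.
  by apply: le_trans h1 _; rewrite ler_wpM2r ?am_ge0 // le_max lexx orbT.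
apply: filterS h2 => x h Qx; apply: le_trans (h Qx) _; rewrite lee_fin.
by rewrite ler_wpM2r ?am_ge0 // le_max lexx.
Qed.

End decomposition.

(** * Stopping cells chosen by the density of exceptional sets *)

Section density_stopping.
Variables (R : realType) (n : nat).
Local Notation Rn := 'rV[R]_n.
Local Notation mu := (lebesgue_rV R n).
Variables (D : set (cube R n)) (E : cube R n -> set Rn).
Hypothesis gridD : dyadic_grid D.
Variable K : int.
Local Notation c d x := (cell D (K - d%:Z) x).
(** Halving the side divides the volume by [2 ^ n], so a density of at most [2 ^ -(n+1)] becomes at
    most 1/2 in a child, which is what [local_decomposition] tolerates. *)
Definition dens_threshold : R := (2 ^+ n.+1)^-1.
Local Notation th := dens_threshold.
Hypotheses (mE : forall P, measurable (E P))
  (Ele : forall P, D P -> (mu (E P) <= (th / 2 * side P ^+ n)%:E)%E).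

Definition dens_bad x i d : bool :=
  ((th * side (c d x) ^+ n)%:E < mu (cube_set (c d x) `&` E (c i x)))%E.

Lemma dens_bad_cell x y i d : (i < d)%N -> cube_set (c d x) y -> dens_bad y i d = dens_bad x i d.
Proof.
move=> id_ xy; rewrite /dens_bad.
by rewrite (cell_up gridD (ltnW id_) xy) (cell_up gridD (leqnn d) xy).
Qed.

Lemma th_gt0 : 0 < th. Proof. by rewrite invr_gt0 exprn_gt0. Qed.
Lemma th_le : th <= 2^-1.
Proof. by rewrite lef_pV2 ?posrE ?exprn_gt0 // exprS ler_peMr // exprn_ege1 // ler1n. Qed.

Lemma sub_cell x i j : (i <= j)%N -> cube_set (c j x) `<=` cube_set (c i x).
Proof. by move=> ij; apply: cell_mono => //; exact/pow2_le/subz_level. Qed.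

(* A stopping cube still has density at most 1/2, because its parent was not selected. *)
Lemma dens_good x i j : (i <= j)%N -> i = j \/ ~~ dens_bad x i j ->
  (mu (cube_set (c j x) `&` E (c i x)) <= (2^-1 * side (c j x) ^+ n)%:E)%E /\
  (mu (cube_set (c j.+1 x) `&` E (c i x)) <= (2^-1 * side (c j.+1 x) ^+ n)%:E)%E.
Proof.
move=> ij h.
have V d : 0 < side (c d x) ^+ n by rewrite exprn_gt0 // side_gt0.
have mI d : measurable (cube_set (c d x) `&` E (c i x)).
  by apply: measurableI => //; exact: measurable_cube.
have {h}hj : (mu (cube_set (c j x) `&` E (c i x)) <= (th * side (c j x) ^+ n)%:E)%E.
  case: h => [<-|]; last by rewrite -leNgt.
  apply: (@le_trans _ _ (mu (E (c i x)))).
    by apply: le_measure; rewrite ?inE // => y [].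
  apply: le_trans (Ele (cell_in gridD _ _)) _; rewrite lee_fin ler_wpM2r ?(ltW (V _)) //.
  by have := th_gt0; lra.
split; first by apply: le_trans hj _; rewrite lee_fin ler_wpM2r ?(ltW (V _)) ?th_le.
apply: (@le_trans _ _ (mu (cube_set (c j x) `&` E (c i x)))).
  by apply: le_measure; rewrite ?inE //; apply: setSI; exact: sub_cell.
apply: le_trans hj _; rewrite lee_fin !side_cell // /dens_threshold.
have -> : K - j%:Z = K - j.+1%:Z + 1 by rewrite -(addn1 j) PoszD; ring.
rewrite expfzDr ?pnatr_eq0 // exprMn exprS -exprnP expr1 invfM -!mulrA.
by rewrite ler_pM2l ?invr_gt0 // mulrC mulfK // gt_eqF // exprn_gt0.
Qed.

(** The maximal function of the indicator of [E P] exceeds [th] on a set of measure at most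
    [mu (E P) / th]. This is at most half of [P], which is why [Ele] asks for [th / 2]. *)
Lemma dens_core x d : stop (dens_bad x) d ->
  ((2^-1)%:E * mu (cube_set (c d x)) <= mu (stop_core K dens_bad (c d x)))%E.
Proof.
move=> sx; set P := c d x.
pose m1 : {measure set Rn -> \bar R} := mscale (NngNum (ltW th_gt0)) mu.
pose m2 : {measure set Rn -> \bar R} := mrestr mu (mE P).
have [] := dyadic_maximal gridD m1 m2 K; set M := [set _ | _] => mM hM.
apply: (stop_core_half gridD dens_bad_cell sx (B := M)) => //.
  move=> y xy [e de be]; exists e; rewrite /m1 /m2 /= /mscale /mrestr /= mu_cube.
  by rewrite -EFinM ltW // /P -(cell_up gridD (leqnn d) xy).
have : (th%:E * mu M <= (th / 2 * side P ^+ n)%:E)%E.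
  apply: (le_trans hM); apply: le_trans (Ele (cell_in gridD _ _)).
  have mI : measurable (M `&` E P) by exact: measurableI.
  by apply: le_measure; rewrite ?inE // => y [].
rewrite -lee_pdivlMl ?th_gt0 // => /le_trans; apply.
by rewrite mu_cube -!EFinM lee_fin -[th / 2 * _]mulrA mulKf // gt_eqF ?th_gt0.
Qed.

End density_stopping.

Section chain.
Variables (R : realType) (n : nat).
Local Notation Rn := 'rV[R]_n.
Local Notation mu := (lebesgue_rV R n).
Variables (U : (Rn -> R[i]) -> Rn -> \bar R) (alpha s : R).
Hypotheses (U_ge0 : forall f x, (0 <= U f x)%E) (subU : sublinear U).
Variables (alpha0 : 0 < alpha) (alpha_ge1 : 1 <= alpha) (s_ge1 : 1 <= s).
Local Notation adil := (dil alpha0).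
Variables (D : set (cube R n)) (E : cube R n -> set Rn).
Hypothesis gridD : dyadic_grid D.
Hypotheses (mE : forall P, measurable (E P))
  (Ele : forall P, D P -> (mu (E P) <= (dens_threshold R n / 2 * side P ^+ n)%:E)%E).
Variables (f : Rn -> R[i]) (fs : inLp s setT f) (C : R) (C_ge1 : 1 <= C).
Hypothesis good : forall P Q, D P -> D Q -> cube_set Q `<=` cube_set P ->
  (mu (cube_set Q `&` E P) <= (2^-1 * side Q ^+ n)%:E)%E ->
  am s f (adil Q) <= C * am s f (adil P) /\
  {ae mu, forall x, cube_set Q x ->
    (U (cutoff f (dilate alpha P `\` dilate alpha Q)) x <= (C * am s f (adil P))%:E)%E}.

Lemma U_cutoff0 : {ae mu, forall x, U (cutoff f set0) x = 0%E}.
Proof.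
have h : inLp 1 setT (cutoff f (cube_set (Cube (0 : Rn) ltr01))).
  exact: (inLp_cutoff (lexx 1) s_ge1 (measurable_cube _) (@subset_refl _ _) fs).
apply: filterS (subU.2 0 _ h) => x.
rewrite ComplexField.Normc.normc0 mul0e.
have -> : (fun y => 0 * cutoff f (cube_set (Cube 0 ltr01)) y) = cutoff f set0.
  by apply/funext => y; rewrite mul0r cutoffE in_set0.
by rewrite gee0_abs.
Qed.

(** The local inequalities are collected for all pairs and triples of cells of the countable grid
    before a point is fixed, which leaves the starting level and the depth free. The mean at depth
    [d] is compared with that of the last stopping cell of depth at most [d]. *)
Lemma ae_chain : {ae mu, forall x, forall (K : int) (d : nat),
  let S := \sum_(0 <= j < d.+1 | stop (dens_bad D E K x) j) am s f (adil (cell D (K - j%:Z) x)) in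
  (U (cutoff f (dilate alpha (cell D (K - 0%:Z) x) `\` dilate alpha (cell D (K - d%:Z) x))) x
     <= (C * S)%:E)%E /\
  am s f (adil (cell D (K - d%:Z) x)) <= C * S}.
Proof.
have cD := countable_grid gridD.
have h1 : {ae mu, forall x P, D P -> forall Q, D Q ->
    (cube_set Q `<=` cube_set P -> (mu (cube_set Q `&` E P) <= (2^-1 * side Q ^+ n)%:E)%E ->
     cube_set Q x ->
     (U (cutoff f (dilate alpha P `\` dilate alpha Q)) x <= (C * am s f (adil P))%:E)%E)}.
  apply: ae_countable => // P DP; apply: ae_countable => // Q DQ.
  have [[QP hQ]|no] := pselect (cube_set Q `<=` cube_set P /\
      (mu (cube_set Q `&` E P) <= (2^-1 * side Q ^+ n)%:E)%E).
    have [_] := good DP DQ QP hQ; apply: filterS => x h _ _; exact: h.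
  by apply: aeW => x QP hQ; exfalso; apply: no.
have h2 : {ae mu, forall x P, D P -> forall P1, D P1 -> forall Q, D Q ->
    (cube_set P1 `<=` cube_set P -> cube_set Q `<=` cube_set P1 ->
     (U (cutoff f (dilate alpha P `\` dilate alpha Q)) x <=
      U (cutoff f (dilate alpha P `\` dilate alpha P1)) x +
      U (cutoff f (dilate alpha P1 `\` dilate alpha Q)) x)%E)}.
  apply: ae_countable => // P DP; apply: ae_countable => // P1 DP1.
  apply: ae_countable => // Q DQ.
  have [[QP hQ]|no] := pselect (cube_set P1 `<=` cube_set P /\ cube_set Q `<=` cube_set P1).
    have s1 := dilateS alpha_ge1 QP; have s2 := dilateS alpha_ge1 hQ.
    have mdil X : measurable (dilate alpha (X : cube R n)) by exact: measurable_dilate.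
    have i1 : inLp 1 setT (cutoff f (dilate alpha P `\` dilate alpha P1)).
      apply: (@inLp_cutoff _ _ 1 s _ (adil P) f (lexx 1) s_ge1 _ _ fs); first exact: measurableD.
      by rewrite dilE => y [].
    have i2 : inLp 1 setT (cutoff f (dilate alpha P1 `\` dilate alpha Q)).
      apply: (@inLp_cutoff _ _ 1 s _ (adil P1) f (lexx 1) s_ge1 _ _ fs); first exact: measurableD.
      by rewrite dilE => y [].
    have e1 : dilate alpha P `\` dilate alpha Q =
        (dilate alpha P `\` dilate alpha P1) `|` (dilate alpha P1 `\` dilate alpha Q).
      apply/seteqP; split => y; last by move=> [[h h']|[h h']]; split => //; [move=> /s2|exact: s1].
      move=> [yP yQ]; have [y1|y1] := pselect (dilate alpha P1 y); first by right.
      by left.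
    have e2 : (dilate alpha P `\` dilate alpha P1) `&` (dilate alpha P1 `\` dilate alpha Q) = set0.
      by apply/seteqP; split => // y [[_ h] [h' _]]; exact: h.
    by apply: filterS (U_split U_ge0 subU i1 i2 e1 e2) => x h _ _.
  by apply: aeW => x QP hQ; exfalso; apply: no.
move: U_cutoff0 h1 h2; apply: filterS3 => x x0 h1 h2 K d S.
pose cc j := cell D (K - j%:Z) x.
have Dc j : D (cc j) by exact: cell_in.
have sc i j : (i <= j)%N -> cube_set (cc j) `<=` cube_set (cc i) by exact: sub_cell.
have mc j : cube_set (cc j) x by exact: mem_cell.
pose bad := dens_bad D E K x.
pose a j := am s f (adil (cc j)).
have C0 : 0 <= C by exact: le_trans C_ge1.
split.
  have := @stop_chain R bad a _ C
    (fun i j => U (cutoff f (dilate alpha (cc i) `\` dilate alpha (cc j))) x) d C0.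
  apply.
  - by move=> i; exact: am_ge0.
  - by rewrite setDv x0.
  - move=> i j ij; apply: h2 => //; exact: sc.
  - move=> i j ij gij; have [g1 g2] := dens_good gridD mE Ele ij gij.
    by split; apply: h1 => //; apply: sc => //; exact: leqW.
have a_ge0 j : 0 <= a j by exact: am_ge0.
have ij := last_stop_le bad d.
have [g1 _] := dens_good gridD mE Ele ij (last_stop_bad bad d).
have [h _] := good (Dc _) (Dc _) (sc _ _ ij) g1.
apply: le_trans h _; rewrite ler_wpM2l //.
by apply: (stop_le_stopsum a_ge0); rewrite ltnS.
Qed.

End chain.

(** * Truncated operators as limits of sharp cutoffs *)

Lemma cvg_Rintegral_exhaustion d (X : measurableType d) (R : realType)
    (m : {measure set X -> \bar R}) (O : set X) (H : nat -> set X) (h : X -> R) :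
  measurable O -> (forall i, measurable (H i)) -> (forall i, H i `<=` O) ->
  (forall x, O x -> \forall i \near \oo, H i x) ->
  m.-integrable O (EFin \o h) ->
  \int[m]_(x in H i) h x @[i --> \oo] --> \int[m]_(x in O) h x.
Proof.
move=> mO mH HO ex ih; pose f_ i x := (h x * \1_(H i) x)%:E.
have mh : measurable_fun O h by apply/measurable_EFinP; exact: measurable_int ih.
have mf_ i : measurable_fun O (f_ i).
  apply/measurable_EFinP; apply: measurable_funM => //; exact: measurable_indic.
have ig : m.-integrable O (fun x => `|(h x)%:E|)%E by exact: integrable_abse.
have f_cvg : {ae m, forall x, O x -> f_ ^~ x @ \oo --> (EFin \o h) x}.
  apply: aeW => x Ox; apply: cvg_near_cst; near=> i; rewrite /f_ indicE mem_set ?mulr1 //.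
  by near: i; exact: ex.
have f_le : {ae m, forall x i, O x -> (`|f_ i x| <= `|(h x)%:E|)%E}.
  apply: aeW => x i Ox; rewrite /f_ lee_fin normrM ler_piMr // indicE.
  by case: (_ \in _); rewrite ?normr1 ?normr0.
have [_ _ cv] := dominated_convergence mO mf_ (measurable_int _ ih) f_cvg ig f_le.
have e i : (\int[m]_(x in O) f_ i x = \int[m]_(x in H i) (h x)%:E)%E.
  rewrite -[in RHS](setIidr (HO i)) integral_mkcondr; apply: eq_integral => x _.
  by rewrite patchE /f_ indicE; case: ifP; rewrite ?mulr1 ?mulr0.
have fin : (\int[m]_(x in O) (h x)%:E)%E \is a fin_num by exact: integrable_fin_num.
rewrite (_ : (fun i => \int[m]_(x in H i) h x) = fine \o (fun i => \int[m]_(x in O) f_ i x)%E).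
  by apply: fine_cvg; rewrite fineK //; exact: cv.
by apply/funext => i /=; rewrite /Rintegral e.
Unshelve. all: by end_near. Qed.

Section truncation.
Variables (R : realType) (n : nat).
Local Notation Rn := 'rV[R]_n.
Local Notation mu := (lebesgue_rV R n).
Local Notation normc := ComplexField.Normc.normc.
Implicit Types (g F : Rn -> R[i]) (O H : set Rn).

Lemma cmeasurableM O g F : cmeasurable O g -> cmeasurable O F ->
  cmeasurable O (fun y => g y * F y).
Proof.
move=> [g1 g2] [F1 F2]; split.
- rewrite (_ : (fun x => _) = (fun x => complex.Re (g x) * complex.Re (F x) -
      complex.Im (g x) * complex.Im (F x))).
    by apply: measurable_funB; apply: measurable_funM.
  by apply/funext => x; case: (g x) (F x) => [? ?] [? ?].
- rewrite (_ : (fun x => _) = (fun x => complex.Re (g x) * complex.Im (F x) +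
      complex.Im (g x) * complex.Re (F x))).
    by apply: measurable_funD; apply: measurable_funM.
  by apply/funext => x; case: (g x) (F x) => [? ?] [? ?].
Qed.

Lemma inLp1_integrable O F : measurable O -> inLp 1 O F ->
  mu.-integrable O (EFin \o (fun x => complex.Re (F x))) /\
  mu.-integrable O (EFin \o (fun x => complex.Im (F x))).
Proof.
move=> mO [mF iF]; have [m1 m2] := mF.
have mN := measurable_normc mO mF.
have iN : mu.-integrable O (EFin \o (fun x => normc (F x))).
  apply/integrableP; split; first exact/measurable_EFinP.
  apply: le_lt_trans iF; rewrite le_eqVlt; apply/orP; left; apply/eqP.
  apply: eq_integral => x _ /=.
  by rewrite powRr1 ?normc_ge0 // ger0_norm // normc_ge0.
have b (z : R[i]) : `|complex.Re z| <= normc z /\ `|complex.Im z| <= normc z.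
  case: z => u v /=; split; rewrite -sqrtr_sqr ler_wsqrtr //.
    by rewrite lerDl sqr_ge0.
  by rewrite lerDr sqr_ge0.
split.
- apply: (le_integrable mO _ _ iN) => [|x _]; first exact/measurable_EFinP.
  by rewrite /= lee_fin (ger0_norm (normc_ge0 _)); case: (b (F x)).
- apply: (le_integrable mO _ _ iN) => [|x _]; first exact/measurable_EFinP.
  by rewrite /= lee_fin (ger0_norm (normc_ge0 _)); case: (b (F x)).
Qed.

Lemma normc_limit (a b : nat -> R) (x y Y : R) : 0 <= Y ->
  a @ \oo --> x -> b @ \oo --> y ->
  (forall i, normc (Complex (a i) (b i)) <= Y) -> normc (Complex x y) <= Y.
Proof.
move=> Y0 ax by_ h; rewrite /normc /=.
have hi i : a i ^+ 2 + b i ^+ 2 <= Y ^+ 2.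
  have := h i; rewrite /normc /= => hh.
  have s0 : 0 <= a i ^+ 2 + b i ^+ 2 by rewrite addr_ge0 // sqr_ge0.
  by rewrite -(sqr_sqrtr s0) lerXn2r // nnegrE sqrtr_ge0.
rewrite -(ger0_norm Y0) -sqrtr_sqr ler_wsqrtr //.
have cv : (a i ^+ 2 + b i ^+ 2) @[i --> \oo] --> x ^+ 2 + y ^+ 2.
  by apply: cvgD; rewrite expr2; under eq_fun do rewrite expr2; exact: cvgM.
by apply: (cvgr_to_le cv); exact: nearW.
Qed.

Lemma enorm_le (z : Rn) M : 0 <= M -> supb M z -> enorm z <= n%:R * M.
Proof.
move=> M0 zM; rewrite -(ger0_norm (mulr_ge0 (ler0n _ n) M0)) -sqrtr_sqr ler_wsqrtr //.
apply: (@le_trans _ _ (\sum_(i < n) M ^+ 2)).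
  apply: ler_sum => i _; rewrite -(ger0_norm M0) -normrX ger0_norm ?sqr_ge0 //.
  by rewrite -[leLHS]ger0_norm ?sqr_ge0 // normrX lerXn2r // nnegrE.
rewrite sumr_const card_ord -[leLHS]mulr_natl exprMn ler_wpM2r ?sqr_ge0 // -natrX ler_nat.
by case: (n) => // k; rewrite -mulnn leq_pmulr.
Qed.

Lemma le_enorm (z : Rn) i : `|z ord0 i| <= enorm z.
Proof.
rewrite -sqrtr_sqr ler_wsqrtr // (bigD1 i) //= lerDl sumr_ge0 // => j _.
exact: sqr_ge0.
Qed.

Definition outside (x : Rn) (e : R) : set Rn := [set y | e < enorm (x - y)].

Lemma measurable_outside x e : measurable (outside x e).
Proof.
have me : measurable_fun setT (fun y : Rn => enorm (x - y) : measurableTypeR R).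
  rewrite (_ : (fun y => _) = (@powR R ^~ 2^-1) \o
      (fun y => \sum_(i <- index_enum 'I_n) (x ord0 i - coor i y) ^+ 2)).
    apply: (measurableT_comp (measurable_powR _)); apply: measurable_sum => i.
    by apply: measurable_funX; apply: measurable_funB => //; exact: measurable_coor.
  apply/funext => y /=; rewrite powR12_sqrt; last by apply: sumr_ge0 => i _; exact: sqr_ge0.
  by congr Num.sqrt; apply: eq_bigr => i _; rewrite !mxE.
rewrite (_ : outside x e = setT `&` (fun y : Rn => enorm (x - y)) @^-1` `]e, +oo[%classic).
  exact: me.
by rewrite setTI; apply/seteqP; split => y; rewrite /outside /= in_itv /= andbT.
Qed.

Lemma fsupp_outside g x e H : 0 < e -> H `<=` outside x e -> ~ fsupp (cutoff g H) x.
Proof.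
(* Balls of ['rV[R]_n] are sup-norm balls and [enorm] is at most [n] times the sup norm; [n + 1]
   also keeps the denominator positive. *)
move=> e0 Hx; pose M := e / n.+1%:R.
have M0 : 0 < M by rewrite divr_gt0.
move=> /(_ (ball x M) (nbhsx_ballx x _ M0))[y [/= gy xy]].
have : H y by apply: contrapT => ny; move/eqP: gy; apply; rewrite cutoffE memNset.
move=> /Hx; rewrite /outside /=; apply/negP; rewrite -leNgt.
have xyM : supb M (x - y).
  case: xy => _ xy i; have := xy ord0 i; rewrite /ball /= /ball_ /= !mxE; exact: ltW.
apply: le_trans (enorm_le (ltW M0) xyM) _.
by rewrite /M mulrA ler_pdivrMr // mulrC ler_pM2l // ler_nat.
Qed.

(** Since [x] is off the support of each [cutoff g (H i)], the kernel representation holds at this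
    very point, and dominated convergence leads to the truncation. When the truncated integral does
    not converge absolutely, its value is 0 by convention. *)
Lemma truncated_le (T : (Rn -> R[i]) -> Rn -> R[i]) K rho g (x : Rn) (e : R)
    (H : nat -> set Rn) (Y : R) : singular_integral T K rho ->
  inLp 1 setT g -> 0 < e -> 0 <= Y ->
  (forall i, measurable (H i)) -> (forall i, H i `<=` outside x e) ->
  (forall y, outside x e y -> \forall i \near \oo, H i y) ->
  (forall i, normc (T (cutoff g (H i)) x) <= Y) ->
  normc (truncated K e g x) <= Y.
Proof.
move=> TK g1 e0 Y0 mH HO ex hY; rewrite /truncated /cintegral.
case: asboolP => [iF|_]; last by rewrite ComplexField.Normc.normc0.
set F := fun y => K x y * g y in iF *.
have mO : measurable (outside x e) by exact: measurable_outside.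
have [i1 i2] := inLp1_integrable mO iF.
apply: (normc_limit Y0 (cvg_Rintegral_exhaustion mO mH HO ex i1)
  (cvg_Rintegral_exhaustion mO mH HO ex i2)) => i.
have mF : cmeasurable setT F by apply: cmeasurableM; [exact: (si_kernel_measurable TK)|exact: g1.1].
have one0 : 1 != 0 :> R by rewrite oner_neq0.
have FE : (fun y => K x y * cutoff g (H i) y) = cutoff F (H i).
  by apply/funext => y; rewrite !cutoffE; case: ifP; rewrite ?mulr0.
have c1 : inLp 1 setT (cutoff g (H i)).
  split; first exact: cmeasurable_cutoff (g1.1).
  suff : (pint 1 setT (cutoff g (H i)) < +oo)%E by [].
  rewrite (pint_cutoff _ one0 (mH i)) // setTI.
  by apply: le_lt_trans g1.2; apply: (pintS 1 (mH i) measurableT _ g1.1).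
have F1 : inLp 1 setT (cutoff F (H i)).
  split; first exact: cmeasurable_cutoff.
  suff : (pint 1 setT (cutoff F (H i)) < +oo)%E by [].
  rewrite (pint_cutoff _ one0 (mH i)) // setTI.
  apply: le_lt_trans iF.2; apply: (pintS 1 (mH i) mO (HO i)).
  exact: cmeasurableS mF.
have := hY i.
rewrite (si_kernel TK c1 (fsupp_outside e0 (HO i) (g := g))); last by rewrite FE.
rewrite FE /cintegral asboolT //.
suff [-> ->] : \int[mu]_y complex.Re (cutoff F (H i) y) = \int[mu]_(y in H i) complex.Re (F y) /\
   \int[mu]_y complex.Im (cutoff F (H i) y) = \int[mu]_(y in H i) complex.Im (F y) by [].
by split; rewrite [RHS]Rintegral_mkcond; apply: eq_Rintegral => y _;
  rewrite patchE cutoffE; case: ifP.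
Qed.

End truncation.

Section star.
Variables (R : realType) (n : nat).
Local Notation Rn := 'rV[R]_n.
Local Notation mu := (lebesgue_rV R n).
Local Notation normc := ComplexField.Normc.normc.
Variables (A : Type) (phi : A -> Rn -> R).
Hypothesis mphi : forall th, measurable_fun setT (phi th : _ -> measurableTypeR R).

Lemma normc_modulation th f x : normc (modulation phi th f x) = normc (f x).
Proof.
rewrite /modulation ComplexField.Normc.normcM /= cos2Dsin2 sqrtr1 mul1r //.
Qed.

Lemma modulation_cutoff th f H : cutoff (modulation phi th f) H = modulation phi th (cutoff f H).
Proof. by apply/funext => y; rewrite /modulation /cutoff mulrA. Qed.

Lemma inLp_modulation p th f : inLp p setT f -> inLp p setT (modulation phi th f).
Proof.
move=> [mf fp]; split.
  apply: cmeasurableM mf; split => /=.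
    apply: (measurableT_comp (continuous_measurable_fun (@continuous_cos R))).
    by apply: measurable_funM; [exact: measurable_cst|exact: mphi].
  apply: (measurableT_comp (continuous_measurable_fun (@continuous_sin R))).
  by apply: measurable_funM; [exact: measurable_cst|exact: mphi].
apply: le_lt_trans fp; rewrite le_eqVlt; apply/orP; left; apply/eqP.
by apply: eq_integral => x _; rewrite normc_modulation.
Qed.

(** Modulation commutes with cutoffs, and [H] depends on [e] but not on the modulation, so a bound
    for the modulated operator on these cutoffs treats all modulations at once. *)
Lemma max_modulated_star_le (T : (Rn -> R[i]) -> Rn -> R[i]) K rho f (x : Rn)
    (Y : R) : singular_integral T K rho -> inhabited A ->
  inLp 1 setT f -> 0 <= Y ->
  (forall e, 0 < e -> exists H : nat -> set Rn,
    [/\ forall i, measurable (H i), forall i, H i `<=` outside x e,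
      forall y, outside x e y -> \forall i \near \oo, H i y &
      forall i, (max_modulated phi T (cutoff f (H i)) x <= Y%:E)%E]) ->
  (`|max_modulated_star phi K f x| <= Y%:E)%E.
Proof.
move=> TK [a0] f1 Y0 h; rewrite gee0_abs.
  apply: ge_ereal_sup => _ [e /= e0 <-]; apply: ge_ereal_sup => _ [th _ <-].
  have [H [mH HO ex hY]] := h e e0; rewrite lee_fin.
  apply: (truncated_le TK (inLp_modulation th f1) e0 Y0 mH HO ex) => i.
  rewrite -lee_fin modulation_cutoff; apply: le_trans (hY i).
  by apply: ereal_sup_ubound; exists th.
apply: (@le_trans _ _ (normc (truncated K 1 (modulation phi a0 f) x))%:E).
  by rewrite lee_fin normc_ge0.
apply: (@le_trans _ _
  (ereal_sup [set (normc (truncated K 1 (modulation phi th f) x))%:E | th in [set: A]])).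
  by apply: ereal_sup_ubound; exists a0.
by apply: ereal_sup_ubound; exists 1 => //=.
Qed.

End star.

Section exhaustion.
Variables (R : realType) (n : nat).
Local Notation Rn := 'rV[R]_n.
Local Notation mu := (lebesgue_rV R n).

Lemma exists_pow2 (e : R) : 0 < e -> exists k : int, e <= 2 ^ k /\ 2 ^ k < 2 * e.
Proof.
move=> e0; have [m hm] : exists m : nat, e <= 2 ^+ m.
  have := archi_boundP (ltW e0); set m := Num.bound _ => h; exists m.
  by apply: le_trans (ltW h) _; rewrite -natrX ler_nat ltnW // ltn_expl.
have ex : exists d : nat, 2 ^ (m%:Z - d%:Z) < 2 * e.
  have e1 : 0 <= 2 ^+ m / e by rewrite divr_ge0 ?exprn_ge0 // ltW.
  have := archi_boundP e1; set d := Num.bound _ => h; exists d.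
  rewrite expfzDr ?pnatr_eq0 // -exprnN -exprnP ltr_pdivrMr ?exprn_gt0 //.
  move: h; rewrite ltr_pdivrMr // => h; apply: lt_trans h _.
  rewrite -mulrA [e * _]mulrC mulrA ltr_pM2r //.
  apply: (@lt_trans _ _ (2 ^+ d)); first by rewrite -natrX ltr_nat ltn_expl.
  by rewrite ltr_pMl ?exprn_gt0 // ltr1n.
case: (ex_minnP ex) => d hd mind; exists (m%:Z - d%:Z); split => //.
case: d hd mind => [|d] hd mind; first by rewrite subr0.
have : ~~ (2 ^ (m%:Z - d%:Z) < 2 * e) by apply/negP => /mind; rewrite ltnn.
rewrite -leNgt; have -> : m%:Z - d%:Z = (m%:Z - d.+1%:Z) + 1.
  by rewrite -(addn1 d) PoszD; ring.
by rewrite expfzDr ?pnatr_eq0 // expr1z [2 * e]mulrC ler_pM2r.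
Qed.

Lemma outside_open (x y : Rn) (e : R) : 0 < e -> outside x e y ->
  exists2 del, 0 < del & forall z, supb del (z - y) -> outside x e z.
Proof.
move=> e0; rewrite /outside /=; set w := enorm (x - y) => ew.
have w0 : 0 < w by exact: lt_trans ew.
have gap : 0 < w ^+ 2 - e ^+ 2 by rewrite subr_gt0 ltrXn2r // ?nnegrE ltW.
have n0 : 0 < n.+1%:R :> R by rewrite ltr0Sn.
(* Replacing [y] by [z] lowers each squared coordinate of [x - y] by at most [2 * w * del], and [n]
   such losses stay below [w ^+ 2 - e ^+ 2]. *)
exists ((w ^+ 2 - e ^+ 2) / (2 * n.+1%:R * w)); first by rewrite divr_gt0 // !mulr_gt0.
set del := _ / _ => z zy.
have del0 : 0 <= del by rewrite divr_ge0 ?(ltW gap) // !mulr_ge0 // ltW.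
have sq i : (x ord0 i - y ord0 i) ^+ 2 - 2 * w * del <= (x ord0 i - z ord0 i) ^+ 2.
  have := le_enorm (x - y) i; have := zy i; rewrite -/w !mxE.
  set a := x ord0 i - y ord0 i; set t := z ord0 i - y ord0 i => ht ha.
  have -> : x ord0 i - z ord0 i = a - t by rewrite /a /t; ring.
  have : a * t <= w * del.
    by apply: le_trans (ler_norm _) _; rewrite normrM ler_pM.
  by have := sqr_ge0 t; rewrite !expr2; lra.
have ws : w ^+ 2 = \sum_i (x ord0 i - y ord0 i) ^+ 2.
  rewrite /w /enorm sqr_sqrtr; last by apply: sumr_ge0 => i _; exact: sqr_ge0.
  by apply: eq_bigr => i _; rewrite !mxE.
have : e ^+ 2 < enorm (x - z) ^+ 2.
  rewrite /enorm sqr_sqrtr; last by apply: sumr_ge0 => i _; exact: sqr_ge0.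
  apply: (@lt_le_trans _ _ (\sum_i ((x ord0 i - y ord0 i) ^+ 2 - 2 * w * del))).
    rewrite big_split /= -ws sumr_const card_ord.
    rewrite -[X in _ + X]mulr_natl mulrN ltrBrDr -ltrBrDl.
    have -> : n%:R * (2 * w * del) = (w ^+ 2 - e ^+ 2) * (n%:R / n.+1%:R).
      by rewrite /del; field; rewrite !gt_eqF.
    by rewrite gtr_pMr // ltr_pdivrMr // mul1r ltr_nat.
  by apply: ler_sum => i _; rewrite !mxE; exact: sq.
by rewrite ltr_pXn2r // nnegrE ?(ltW e0) // sqrtr_ge0.
Qed.

Definition union_cubes (C : set (cube R n)) : set Rn := \bigcup_(Q in C) cube_set Q.

Lemma measurable_union_cubes C : finite_set C -> measurable (union_cubes C).
Proof.
by move=> fC; apply: fin_bigcup_measurable => // Q _; exact: measurable_cube.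
Qed.

(** [C i] keeps those cells inside the region whose code is below [i]; the region is open, so each
    of its points has a small cell that fits. Finiteness matters because a countable grid has only
    countably many finite subfamilies. *)
Lemma exhaustion (D : set (cube R n)) (x : Rn) (e : R) : dyadic_grid D -> 0 < e ->
  exists C : nat -> set (cube R n),
    [/\ forall i, C i `<=` D /\ finite_set (C i),
      forall i, union_cubes (C i) `<=` outside x e &
      forall y, outside x e y -> \forall i \near \oo, union_cubes (C i) y].
Proof.
move=> gridD e0; have /countable_injP[code inj] := countable_grid gridD.
exists (fun i => [set Q | [/\ D Q, (code Q < i)%N & cube_set Q `<=` outside x e]]).
split => [i|i|y yO].
- split => [Q []//|]; set C := mkset _.
  have injC : {in C &, injective code}.
    by move=> P Q; rewrite !inE => -[DP _ _] [DQ _ _]; apply: inj; exact/mem_set.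
  rewrite -(eq_finite_set (inj_card_eq injC)).
  by apply: (@sub_finite_set _ _ `I_i) => // _ [Q [_ Qi _] <-].
- by move=> y [Q [_ _ QO] Qy]; exact: QO.
- have [del del0 hd] := outside_open e0 yO.
  have [k [_ kd]] := exists_pow2 (divr_gt0 del0 (ltr0n R 2)).
  have {}kd : 2 ^ k <= del by move: kd; rewrite mulrCA mulfV ?mulr1 // => /ltW.
  pose Q := cell D k y.
  have QO : cube_set Q `<=` outside x e.
    move=> z zQ; apply: hd => i; have := zQ i; have := mem_cell gridD k y i.
    rewrite /Q side_cell // !mxE => /andP[h1 h2] /andP[h3 h4].
    by rewrite ler_norml; apply/andP; split; lra.
  exists (code Q).+1 => // i hi; exists Q; last exact: mem_cell.
  by split => //; exact: cell_in.
Qed.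

End exhaustion.

(** * Transfer to the covering grids *)

Section transfer.
Variables (R : realType) (n : nat) (n_gt0 : (0 < n)%N).
Local Notation Rn := 'rV[R]_n.
Local Notation mu := (lebesgue_rV R n).
Variables (alpha s : R) (alpha0 : 0 < alpha) (alpha_ge1 : 1 <= alpha) (s_ge1 : 1 <= s).
Local Notation adil := (dil alpha0).
Variables (N : nat) (D : 'I_N.+1 -> set (cube R n)).
Hypothesis gridD : forall j, dyadic_grid (D j).
Local Notation D0 := (D ord0).
Variable L : nat.
Hypothesis coverL : forall k x, exists j,
  dilate alpha (cell D0 k x) `<=` cube_set (cell (D j) (k + L%:Z) (corner (cell D0 k x))).

Lemma cover_cube : exists J : cube R n -> 'I_N.+1 * cube R n, forall P, D0 P ->
  [/\ D (J P).1 (J P).2, side (J P).2 = 2 ^+ L * side P &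
    dilate alpha P `<=` cube_set (J P).2].
Proof.
suff /choice[J hJ] : forall P, exists i : 'I_N.+1 * cube R n, D0 P ->
  [/\ D i.1 i.2, side i.2 = 2 ^+ L * side P & dilate alpha P `<=` cube_set i.2] by exists J.
move=> P.
have [DP|nD] := pselect (D0 P); last by exists (ord0, P).
have [/(_ _ DP)[l sl] _ _] := gridD ord0.
have PE := cell_unique (gridD ord0) DP sl (corner_in P).
have [j] := coverL l (corner P); rewrite -PE => cov.
exists (j, cell (D j) (l + L%:Z) (corner P)) => _; split => //=; first exact: cell_in.
by rewrite side_cell // expfzDr ?pnatr_eq0 // -exprnP sl mulrC.
Qed.

(** The first factor compares the mean over [alpha P] with that over a covering cell of side
    [2 ^+ L * side P]; the second is the loss [4 * (m + 1)] of [near_stops_dominate] for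
    [m = 2 ^ (L * n + 3)]. *)
Definition transfer_const : R := 2 ^+ (L * n) * (4 * (2 ^ (L * n + 3)).+1%:R).

(** Covering cells inherit the cores of the stopping cells they come from, but these fill only a
    proportion [eta] of them; selecting by [sparse_bad] restores sparsity. At a point the towers run
    in parallel: the covering cell at depth [j] below [K] is the cell at depth [j] below [K + L] in
    its grid. *)
Lemma sparse_transfer (E : cube R n -> set Rn) (f : Rn -> R[i]) (K : int) :
  (forall P, measurable (E P)) ->
  (forall P, D0 P -> (mu (E P) <= (dens_threshold R n / 2 * side P ^+ n)%:E)%E) ->
  inLp s setT f ->
  exists S : 'I_N.+1 -> set (cube R n),
  [/\ forall i, S i `<=` D i /\ sparse 4^-1 (S i),
    forall x d, supb (2 ^ (K + L%:Z)) x ->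
      ((\sum_(0 <= j < d.+1 | stop (dens_bad D0 E K x) j)
          am s f (adil (cell D0 (K - j%:Z) x)))%:E <=
       transfer_const%:E * \sum_(i < N.+1) sparse_operator s (S i) f x)%E &
    forall (k : int) i, K + L%:Z + 4 <= k -> S i (cell (D i) k 0)].
Proof.
move=> mE Ele fs; have [J hJ] := cover_cube.
have [nu nuE] := pint_measure fs.
have nu_fin : (nu setT < +oo)%E by rewrite nuE; case: fs.
pose bad := dens_bad D0 E K; pose K1 := K + L%:Z.
have bad_cell : forall x y i d, (i < d)%N -> cube_set (cell D0 (K - d%:Z) x) y ->
  bad y i d = bad x i d by exact: dens_bad_cell.
pose stopped P := exists x d, stop (bad x) d /\ P = cell D0 (K - d%:Z) x.
have stoppedD P : stopped P -> D0 P by move=> [x [d [_ ->]]]; exact: cell_in.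
pose F i : set (cube R n) := [set Q | exists P, stopped P /\ J P = (i, Q)].
(* Several stopping cells may share a covering cell; one of them is chosen to lend its core. *)
have [p hp] : exists p : 'I_N.+1 -> cube R n -> cube R n,
    forall i Q, F i Q -> stopped (p i Q) /\ J (p i Q) = (i, Q).
  have /choice[p hp] : forall iQ : 'I_N.+1 * cube R n, exists P, F iQ.1 iQ.2 ->
      stopped P /\ J P = iQ.
    move=> [i Q]; have [[P hP]|nF] := pselect (F i Q); last by exists Q.
    by exists P.
  by exists (fun i Q => p (i, Q)) => i Q; exact: (hp (i, Q)).
pose G i Q : set Rn := stop_core K bad (p i Q).
(* The core is at least half of the stopping cell, whose volume is [2 ^ -(L n)] times that of the
   covering cell; [m] then satisfies [eta * m = 4], as [large_count] demands. *)
pose eta : R := (2 * 2 ^+ (L * n))^-1; pose m := (2 ^ (L * n + 3))%N.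
have eta0 : 0 < eta by rewrite invr_gt0 mulr_gt0 ?exprn_gt0.
have etam : 4 <= eta * m%:R.
  have pL0 : (2 : R) ^+ (L * n) != 0 by rewrite expf_neq0.
  rewrite /eta /m natrX exprD invfM; set u := _ ^+ (L * n) in pL0 *.
  by have -> : 2^-1 * u^-1 * (u * 2 ^+ 3) = 4 by field.
have mG i Q : measurable (G i Q) by exact: (measurable_stop_core (gridD ord0) bad_cell).
have subG i Q : F i Q -> G i Q `<=` cube_set Q.
  move=> /hp[/stoppedD/hJ[_ _ sub] JP] y [yP _].
  by move: sub; rewrite JP /=; apply; exact: sub_dilate.
have trivG i : trivIset (F i) (G i).
  apply/trivIsetP => Q Q' FQ FQ' QQ'; apply/seteqP; split => // y [].
  rewrite /G; have [[x [d [sx e]]] JQ] := hp _ _ FQ; have [[x' [d' [sx' e']]] JQ'] := hp _ _ FQ'.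
  rewrite e e' => yQ yQ'; have := stop_core_disj (gridD ord0) bad_cell sx sx' yQ yQ'.
  rewrite -e -e' => ee; have := JQ; rewrite ee JQ' => -[QE].
  by move: QQ'; rewrite QE eqxx.
have bigG i Q : F i Q -> (eta%:E * mu (cube_set Q) <= mu (G i Q))%E.
  move=> /hp[sP JP]; have [_ sQ _] := hJ _ (stoppedD _ sP); rewrite JP /= in sQ.
  rewrite /G; have [x [d [sx e]]] := sP; rewrite e in sQ *.
  apply: le_trans (dens_core (gridD ord0) mE Ele sx); rewrite !mu_cube -!EFinM lee_fin sQ.
  rewrite exprMn -exprM mulrA /eta invfM mulfVK // expf_neq0.
pose sbad i := sparse_bad (D i) nu K1 (F i) m.
exists (fun i => near_stops (D i) K1 (sbad i) `|` far_chain (D i) (K1 + 4)); split.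
- move=> i; split.
    by move=> Q [[x [d [_ _ ->]]]|[k _ ->]]; exact: cell_in.
  apply: (family_sparse n_gt0 (gridD i) (lexx _)).
    exact: sparse_bad_cell (gridD i) nu K1 (F i) m.
  move=> x d; exact: (sparsify_core (gridD i) nu_fin eta0 (mG i) (subG i) (trivG i) (bigG i) etam).
- move=> x d xK.
  have dom i : ((\sum_(0 <= j < d.+1 | fam (D i) K1 (F i) x j)
        am s f (cell (D i) (K1 - j%:Z) x))%:E <=
      (4 * m.+1%:R)%:E * sparse_operator s
        (near_stops (D i) K1 (sbad i) `|` far_chain (D i) (K1 + 4)) f x)%E.
    have amE Q : mean nu Q `^ s^-1 = am s f Q by rewrite /mean /am nuE.
    under eq_bigr do rewrite -amE.
    apply: (near_stops_dominate (gridD i)) => //.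
    by move=> Q; rewrite amE avg_am.
  apply: (@le_trans _ _ ((2 ^+ (L * n))%:E * \sum_(i < N.+1)
      (\sum_(0 <= j < d.+1 | fam (D i) K1 (F i) x j)
        am s f (cell (D i) (K1 - j%:Z) x))%:E)%E); last first.
    rewrite /transfer_const -/m [(2 ^+ (L * n) * _)%:E]EFinM -muleA.
    apply: lee_wpmul2l; first by rewrite lee_fin exprn_ge0.
    rewrite ge0_sume_distrr; last first.
      by move=> i _; apply: esum_ge0 => Q _; rewrite mule_ge0 ?lee_fin // avg_am // lee_fin am_ge0.
    by apply: lee_sum => i _; exact: dom.
  rewrite sumEFin -EFinM lee_fin.
  under [X in _ <= _ * X]eq_bigr do rewrite big_mkcond.
  rewrite exchange_big /= big_distrr /= [leLHS]big_mkcond /=.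
  apply: ler_sum => j _; case: ifP => [sj|_]; last first.
    by rewrite mulr_ge0 ?exprn_ge0 // sumr_ge0 // => i _; case: ifP => // _; exact: am_ge0.
  set P := cell D0 (K - j%:Z) x; have sP : stopped P by exists x, j.
  have [DJ sJ subJ] := hJ _ (stoppedD _ sP).
  set i := (J P).1 in DJ; set Q := (J P).2 in DJ sJ subJ.
  have QE : Q = cell (D i) (K1 - j%:Z) x.
    apply: cell_unique => //; last by apply/subJ/sub_dilate => //; exact: mem_cell.
    rewrite sJ side_cell // [K1 - _](_ : _ = L%:Z + (K - j%:Z)); last by rewrite /K1; ring.
    by rewrite (expfzDr L%:Z) ?pnatr_eq0.
  apply: (@le_trans _ _ (2 ^+ (L * n) * am s f Q)).
    apply: le_am => //; first by rewrite dilE.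
      by rewrite exprn_ege1 // ler1n.
    rewrite sJ /= !exprMn -exprM ler_pM2l ?exprn_gt0 // ler_peMl ?exprn_ge0 ?exprn_ege1 //.
    by rewrite ltW // side_gt0.
  rewrite ler_pM2l ?exprn_gt0 // (bigD1 i) //= -QE.
  have -> : fam (D i) K1 (F i) x j.
    by apply/asboolP; rewrite -QE; exists P; split => //; rewrite /i /Q; case: (J P).
  rewrite lerDl sumr_ge0 // => i' _; case: ifP => // _; exact: am_ge0.
- by move=> k i hk; right; exists k.
Qed.

End transfer.

(** * Pointwise bounds near the support and far from it *)

Section pointwise.
Variables (R : realType) (n : nat).
Local Notation Rn := 'rV[R]_n.
Local Notation mu := (lebesgue_rV R n).
(* [U] and [V] stand for the modulated operator and its maximal truncation. *)
Variables (U V : (Rn -> R[i]) -> Rn -> \bar R) (alpha s : R).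
Hypotheses (U_ge0 : forall f x, (0 <= U f x)%E) (subU : sublinear U).
Hypothesis starU : forall f x Y, inLp 1 setT f -> 0 <= Y ->
  (forall e, 0 < e -> exists H : nat -> set Rn,
    [/\ forall i, measurable (H i), forall i, H i `<=` outside x e,
      forall y, outside x e y -> \forall i \near \oo, H i y &
      forall i, (U (cutoff f (H i)) x <= Y%:E)%E]) ->
  (`|V f x| <= Y%:E)%E.
Variables (alpha0 : 0 < alpha) (alpha_ge3 : 3 <= alpha) (s_ge1 : 1 <= s).
Local Notation adil := (dil alpha0).
Variables (D : set (cube R n)) (E : cube R n -> set Rn).
Hypothesis gridD : dyadic_grid D.
Variables (f : Rn -> R[i]) (fs : inLp s setT f).
Variables (C1 C2 : R) (C1_ge1 : 1 <= C1) (C2_ge0 : 0 <= C2).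
Variable b : nat.
Hypothesis b_large : 8 * alpha * n.+1%:R <= 2 ^+ b.
Hypothesis annulus : forall P Q E, cube_set Q `<=` cube_set P ->
  side (adil P) ^+ n <= (alpha * 2 ^+ b) ^+ n * side Q ^+ n ->
  measurable E -> E `<=` dilate alpha P `\` dilate alpha Q ->
  {ae mu, forall x, cube_set Q x -> (U (cutoff f E) x <= (C2 * am s f (adil P))%:E)%E}.
Variable K : int.
Hypothesis supp_f : forall y, f y != 0 -> supb (2 ^ (K - 3)) y.
Let alpha_ge1 : 1 <= alpha. Proof. by apply: le_trans alpha_ge3; rewrite ler1n. Qed.

Definition stop_sum x d : R := \sum_(0 <= j < d.+1 | stop (dens_bad D E K x) j)
  am s f (adil (cell D (K - j%:Z) x)).

Lemma stop_sum_ge0 x d : 0 <= stop_sum x d.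
Proof. by apply: sumr_ge0 => j _; exact: am_ge0. Qed.

Lemma eq_cutoff A B : (forall y, f y != 0 -> A y <-> B y) -> cutoff f A = cutoff f B.
Proof.
move=> AB; apply/funext => y; rewrite !cutoffE.
have [->|/AB h] := eqVneq (f y) 0; first by rewrite !if_same.
have [Ay|Ay] := pselect (A y); first by rewrite !mem_set // -h.
by rewrite !memNset // -h.
Qed.

Lemma pow2D (k : int) (j : nat) : 2 ^ (k + j%:Z) = 2 ^ k * 2 ^+ j :> R.
Proof. by rewrite expfzDr ?pnatr_eq0. Qed.

(** [A] may be unbounded, such as the complement of a dilate; integrability comes from the bounded
    support of [f]. *)
Lemma inLp1_support A : measurable A -> inLp 1 setT (cutoff f A).
Proof.
move=> mA; pose B : cube R n :=
  Cube (\row_(i < n) - (2 ^ (K - 3))) (mulr_gt0 (ltr0Sn R 2) (exprz_gt0 (K - 3) (ltr0Sn R 1))).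
have mB : measurable (cube_set B) by exact: measurable_cube.
rewrite (@eq_cutoff _ (A `&` cube_set B)).
  have sAB : A `&` cube_set B `<=` cube_set B by move=> y [].
  exact: (inLp_cutoff (lexx 1) s_ge1 (measurableI _ _ mA mB) sAB fs).
move=> y /supp_f yK; split => [Ay|[]//]; split => // i.
have := yK i; rewrite ler_norml mxE => /andP[h1 h2].
have h0 : 0 < 2 ^ (K - 3) :> R by exact: exprz_gt0.
by apply/andP; split => /=; lra.
Qed.

Lemma am_support P Q : cube_set Q `<=` cube_set P -> (forall y, f y != 0 -> cube_set Q y) ->
  am s f P <= am s f Q.
Proof.
move=> QP hQ; have mQ := measurable_cube Q; have mP := measurable_cube P.
have s0 : 0 < s by exact: lt_le_trans s_ge1.
have fE : f = cutoff f (cube_set Q).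
  apply/funext => y; rewrite cutoffE; case: ifPn => // /negP yQ.
  by apply/eqP; apply: contrapT => /negP /hQ h; apply: yQ; exact/mem_set.
have pE : pint s (cube_set P) f = pint s (cube_set Q) f.
  by rewrite {1}fE pint_cutoff ?gt_eqF // setIC setIidl.
rewrite /am pE; apply: ge0_ler_powR; rewrite ?nnegrE ?invr_ge0 ?(ltW s0) //.
- by rewrite -pE; exact: ratio_ge0.
- exact: ratio_ge0.
rewrite ler_wpM2l ?fine_ge0 ?pint_ge0 //.
rewrite lef_pV2 ?posrE ?exprn_gt0 ?side_gt0 //.
have : (mu (cube_set Q) <= mu (cube_set P))%E by apply: le_measure; rewrite ?inE.
by rewrite !mu_cube lee_fin.
Qed.

(** The properties of [x] that may fail on a null set. They range over cells, finite families of
    cells and depths only, so that the radius of truncation can be chosen after [x]. *)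
Definition good_point x := [/\ U (cutoff f set0) x = 0%E,
  forall P C, D P -> C `<=` D /\ finite_set C ->
    (U (cutoff f (~` dilate alpha P `|` union_cubes C `&` dilate alpha P)) x <=
     U (cutoff f (~` dilate alpha P)) x + U (cutoff f (union_cubes C `&` dilate alpha P)) x)%E,
  forall P Q C, D P -> D Q -> C `<=` D /\ finite_set C -> cube_set Q `<=` cube_set P ->
    side (adil P) ^+ n <= (alpha * 2 ^+ b) ^+ n * side Q ^+ n -> cube_set Q x ->
    (U (cutoff f ((union_cubes C `&` dilate alpha P) `\` dilate alpha Q)) x <=
     (C2 * am s f (adil P))%:E)%E &
  forall d, (U (cutoff f (dilate alpha (cell D (K - 0%:Z) x) `\`
       dilate alpha (cell D (K - d%:Z) x))) x <= (C1 * stop_sum x d)%:E)%E /\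
    am s f (adil (cell D (K - d%:Z) x)) <= C1 * stop_sum x d].

Hypothesis chain : {ae mu, forall x, forall (K : int) (d : nat),
  let S := \sum_(0 <= j < d.+1 | stop (dens_bad D E K x) j) am s f (adil (cell D (K - j%:Z) x)) in
  (U (cutoff f (dilate alpha (cell D (K - 0%:Z) x) `\` dilate alpha (cell D (K - d%:Z) x))) x
     <= (C1 * S)%:E)%E /\
  am s f (adil (cell D (K - d%:Z) x)) <= C1 * S}.

Lemma ae_good : {ae mu, forall x, good_point x}.
Proof.
pose fin := [set C : set (cube R n) | C `<=` D /\ finite_set C].
have cD := countable_grid gridD.
have cfin : countable fin by exact: countable_finite_subset.
have h2 : {ae mu, forall x, forall i : cube R n * set (cube R n), (D `*` fin) i ->
    (U (cutoff f (~` dilate alpha i.1 `|` union_cubes i.2 `&` dilate alpha i.1)) x <=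
     U (cutoff f (~` dilate alpha i.1)) x +
     U (cutoff f (union_cubes i.2 `&` dilate alpha i.1)) x)%E}.
  apply: ae_countable; first exact: countableX.
  move=> [P C] [_ [_ /measurable_union_cubes mC]].
  have mP := measurable_dilate P alpha0.
  have dis : ~` dilate alpha P `&` (union_cubes C `&` dilate alpha P) = set0.
    by apply/seteqP; split => // y [nP [_]].
  exact: (U_split U_ge0 subU (inLp1_support (measurableC mP))
    (inLp1_support (measurableI _ _ mC mP)) erefl dis).
have h3 : {ae mu, forall x, forall i : cube R n * cube R n * set (cube R n),
    (D `*` D `*` fin) i -> cube_set i.1.2 `<=` cube_set i.1.1 ->
    side (adil i.1.1) ^+ n <= (alpha * 2 ^+ b) ^+ n * side i.1.2 ^+ n -> cube_set i.1.2 x ->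
    (U (cutoff f ((union_cubes i.2 `&` dilate alpha i.1.1) `\` dilate alpha i.1.2)) x <=
     (C2 * am s f (adil i.1.1))%:E)%E}.
  apply: ae_countable; first by apply: countableX => //; exact: countableX.
  move=> [[P Q] C] [_ [_ /measurable_union_cubes mC]] /=.
  have [QP|nQP] := pselect (cube_set Q `<=` cube_set P); last by apply: aeW.
  have [hr|nr] := pselect (side (adil P) ^+ n <= (alpha * 2 ^+ b) ^+ n * side Q ^+ n); last first.
    by apply: aeW => x _ /nr.
  have mB : measurable ((union_cubes C `&` dilate alpha P) `\` dilate alpha Q).
    by apply: measurableD; [apply: measurableI => //|]; exact: measurable_dilate.
  have sB : (union_cubes C `&` dilate alpha P) `\` dilate alpha Q `<=`
      dilate alpha P `\` dilate alpha Q by move=> y [[]].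
  by apply: filterS (annulus QP hr mB sB) => x h _ _.
have h4 := U_cutoff0 U_ge0 subU s_ge1 fs.
apply: filterS2 (filterI h2 h3) (filterI h4 chain) => x [g2 g3] [g0 g4]; split => //.
- by move=> P C DP hC; exact: (g2 (P, C)).
- by move=> P Q C DP DQ hC; exact: (g3 (P, Q, C)).
Qed.

Lemma dilate_cell_near k x y : supb (2 ^ k) (y - x) -> dilate alpha (cell D k x) y.
Proof. by move=> yx; apply: (in_dilate alpha_ge3 (mem_cell gridD k x) yx); rewrite side_cell. Qed.

(** In the choice of [b], the factor [n + 1] absorbs the passage from the sup norm to [enorm], and
    the 8 leaves the room that [near_bound] and [far_bound] use. *)
Lemma dilate_cell_small k x y : dilate alpha (cell D (k - b%:Z) x) y ->
  supb (2 ^ k / (8 * n.+1%:R)) (y - x).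
Proof.
move=> yQ i; have := dilate_supb alpha_ge1 (mem_cell gridD _ _) yQ i.
move=> /le_trans; apply; rewrite side_cell // expfzDr ?pnatr_eq0 // -exprnN.
rewrite mulrCA ler_pM2l ?exprz_gt0 // ler_pdivrMr ?exprn_gt0 // ler_pdivlMl ?mulr_gt0 //.
by rewrite mulrAC.
Qed.

Lemma cell_ratio k x : side (adil (cell D k x)) ^+ n <=
  (alpha * 2 ^+ b) ^+ n * side (cell D (k - b%:Z) x) ^+ n.
Proof.
rewrite /= !side_cell // -exprMn -mulrA -[2 ^+ b * _]mulrC -pow2D.
by rewrite (_ : k - b%:Z + b%:Z = k) //; ring.
Qed.

Lemma supp_dilate x : supb (2 ^ (K - 1)) x -> forall y, f y != 0 ->
  dilate alpha (cell D (K - 0%:Z) x) y.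
Proof.
move=> xK y /supp_f yK; apply: dilate_cell_near => i.
have := xK i; have := yK i; rewrite subr0 !mxE => h1 h2.
have e1 : 2 ^ K = 2 ^ (K - 3) * 8 :> R.
  by rewrite (_ : 8 = 2 ^+ 3); [rewrite -pow2D (_ : K - 3 + 3%:Z = K) //|]; ring.
have e2 : 2 ^ K = 2 ^ (K - 1) * 2 :> R.
  by rewrite -[2 in RHS]expr1 -pow2D (_ : K - 1 + 1%:Z = K) //; ring.
have h0 : 0 < 2 ^ (K - 3) :> R by exact: exprz_gt0.
apply: le_trans (ler_normB _ _) _; lra.
Qed.

(** With [e <= 2 ^ k < 2 * e], the region beyond radius [e] contains the complement of [alpha P] for
    the cell [P] of level [k], and misses [alpha Q] for the cell [Q] lying [b] levels below. Each
    cutoff thus splits into the complement of [alpha P], estimated along the tower, and a subset of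
    [alpha P \ alpha Q], to which [annulus] applies. *)
Lemma near_bound x W : good_point x -> supb (2 ^ (K - 1)) x ->
  (forall d, ((stop_sum x d)%:E <= W)%E) ->
  (`|V f x| <= (C1 + C2 * C1)%:E * W)%E.
Proof.
move=> [g1 g2 g3 g4] xK hW; have C10 : 0 < C1 by exact: lt_le_trans C1_ge1.
have C0 : 0 < C1 + C2 * C1 by rewrite ltr_pwDl // mulr_ge0 // ltW.
have f1 : inLp 1 setT f.
  have -> : f = cutoff f setT by apply/funext => y; rewrite cutoffE in_setT.
  exact: inLp1_support.
have : (0 <= W)%E by apply: le_trans (hW 0%N); rewrite lee_fin stop_sum_ge0.
case: W hW => [w hW|_ _|//]; last by rewrite gt0_muley ?lte_fin // leey.
rewrite lee_fin -EFinM => w0; apply: starU => //; first by rewrite mulr_ge0 // ltW.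
move=> e e0; have [k [ek ke]] := exists_pow2 e0; have [C [CD Cout Cex]] := exhaustion x gridD e0.
set P := cell D k x; set Q := cell D (k - b%:Z) x.
have k0 : 0 < 2 ^ k :> R by exact: exprz_gt0.
have DP : D P by exact: cell_in.
have DQ : D Q by exact: cell_in.
have QP : cube_set Q `<=` cube_set P by apply/cell_mono/pow2_le => //; rewrite gerBl.
have mP := measurable_dilate P alpha0.
have outP y : ~ dilate alpha P y -> outside x e y.
  apply: contra_notP => /negP; rewrite /outside /= -leNgt => xy.
  apply: dilate_cell_near => i; have := le_enorm (x - y) i.
  rewrite !mxE distrC => /le_trans; apply; exact: le_trans xy ek.
have inQ y : dilate alpha Q y -> ~ outside x e y.
  move=> /dilate_cell_small yx; apply/negP; rewrite -leNgt.
  have {}yx : supb (2 ^ k / (8 * n.+1%:R)) (x - y).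
    by move=> i; have := yx i; rewrite !mxE distrC.
  apply: le_trans (enorm_le _ yx) _; first by rewrite divr_ge0 ?mulr_ge0 // ltW.
  apply: (@le_trans _ _ (2 ^ k / 8)); last by lra.
  have -> : n%:R * (2 ^ k / (8 * n.+1%:R)) = 2 ^ k / 8 * (n%:R / n.+1%:R) :> R.
    by rewrite invfM; ring.
  by rewrite ler_piMr ?divr_ge0 ?(ltW k0) // ler_pdivrMr // mul1r ler_nat.
(* For [k > K] the dilate of [P] contains the support: the outer part vanishes, and the mean over
   [alpha P] is at most that over the dilated top cell. *)
have [bA amP] : (U (cutoff f (~` dilate alpha P)) x <= (C1 * w)%:E)%E /\
    am s f (adil P) <= C1 * w.
  have Sw d : C1 * stop_sum x d <= C1 * w by rewrite ler_pM2l // -lee_fin.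
  have [kK|Kk] := leP k K.
    have [h1 h2] := g4 `|K - k|%N.
    have dk : K - `|K - k|%N%:Z = k by rewrite gez0_abs ?subr_ge0 //; ring.
    move: h1 h2; rewrite dk => h1 h2; split; last exact: le_trans h2 (Sw _).
    rewrite (@eq_cutoff _ (dilate alpha (cell D (K - 0%:Z) x) `\` dilate alpha P)).
      by apply: le_trans h1 _; rewrite lee_fin.
    by move=> y fy; split => [h|[]//]; split => //; exact: supp_dilate.
  have sub : dilate alpha (cell D (K - 0%:Z) x) `<=` dilate alpha P.
    apply: dilateS => //; apply/cell_mono/pow2_le => //.
    by rewrite subr0 ltW.
  split.
    rewrite (@eq_cutoff _ set0) ?g1 ?lee_fin ?mulr_ge0 ?(ltW C10) // => y fy; split => // h.
    by apply: h; apply: sub; exact: supp_dilate.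
  have [_ h] := g4 0%N; apply: le_trans (Sw 0%N); apply: le_trans h.
  by apply: am_support; rewrite ?dilE //; exact: supp_dilate.
exists (fun i => ~` dilate alpha P `|` union_cubes (C i) `&` dilate alpha P); split.
- move=> i; have [_ /measurable_union_cubes mC] := CD i.
  by apply: measurableU; [exact: measurableC|exact: measurableI].
- by move=> i y [/outP//|[/Cout]].
- move=> y /Cex; apply: filterS => i Cy.
  by have [yP|yP] := pselect (dilate alpha P y); [right|left].
move=> i; apply: le_trans (g2 P (C i) DP (CD i)) _; rewrite mulrDl EFinD; apply: leeD => //.
have -> : union_cubes (C i) `&` dilate alpha P =
    (union_cubes (C i) `&` dilate alpha P) `\` dilate alpha Q.
  by apply/seteqP; split => [y [yC yP]|y []//]; split => // /inQ; apply; exact: (Cout i).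
apply: le_trans (g3 P Q (C i) DP DQ (CD i) QP (cell_ratio _ _) (mem_cell gridD _ _)) _.
by rewrite lee_fin -mulrA ler_wpM2l.
Qed.

(** Let [k] be the least level with [x] in the sup-norm ball of radius [2 ^ k]. Some coordinate of
    [x] exceeds [2 ^ (k - 1)] in absolute value, while the support stays within [2 ^ (k - 3)]. So
    the support lies in [alpha P] and off [alpha Q] for the cells of levels [k + 1] and [k + 1 - b],
    and one annulus bound suffices. *)
Lemma far_bound x : good_point x -> ~ supb (2 ^ (K - 1)) x ->
  exists k : int, [/\ K <= k, supb (2 ^ k) x &
    (`|V f x| <= (C2 * am s f (adil (cell D (k + 1) x)))%:E)%E].
Proof.
move=> [_ _ g3 _] nxK.
have exm : exists m : nat, `[< supb (2 ^ (K + m%:Z)) x >].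
  have h0 : 0 <= (\sum_i `|x ord0 i|) / 2 ^ K.
    by rewrite divr_ge0 ?sumr_ge0 // ltW // exprz_gt0.
  have := archi_boundP h0; set m := Num.bound _; rewrite ltr_pdivrMr ?exprz_gt0 // => hm.
  exists m; apply/asboolP => i; rewrite pow2D mulrC.
  apply: (@le_trans _ _ (\sum_i `|x ord0 i|)); first by rewrite (bigD1 i) //= lerDl sumr_ge0.
  apply: le_trans (ltW hm) _; rewrite ler_wpM2r //; first by rewrite ltW // exprz_gt0.
  by rewrite -natrX ler_nat ltnW // ltn_expl.
case: (ex_minnP exm) => m /asboolP xm minm; set k := K + m%:Z in xm.
have Kk : K <= k by rewrite lerDl.
have nxk : ~ supb (2 ^ (k - 1)) x.
  rewrite /k; case: (m) minm => [|j] minm; first by rewrite addr0.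
  rewrite (_ : K + j.+1%:Z - 1 = K + j%:Z); last by rewrite -(addn1 j) PoszD; ring.
  by move=> /asboolP/minm; rewrite ltnn.
have [i xi] : exists i, 2 ^ (k - 1) < `|x ord0 i|.
  apply: contrapT => no; apply: nxk => i; rewrite leNgt; apply/negP => h; apply: no; by exists i.
exists k; split => //.
set P := cell D (k + 1) x; set Q := cell D (k + 1 - b%:Z) x.
have k0 : 0 < 2 ^ k :> R by exact: exprz_gt0.
have e1 : 2 ^ (k + 1) = 2 ^ k * 2 :> R by rewrite -[k + 1]/(k + 1%:Z) pow2D expr1.
have e2 : 2 ^ k = 2 ^ (k - 1) * 2 :> R.
  by rewrite -[2 in RHS]expr1 -pow2D (_ : k - 1 + 1%:Z = k) //; ring.
have e3 : 2 ^ k = 2 ^ (k - 3) * 8 :> R.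
  by rewrite (_ : 8 = 2 ^+ 3); [rewrite -pow2D (_ : k - 3 + 3%:Z = k) //|]; ring.
have supp y : f y != 0 -> supb (2 ^ (k - 3)) y.
  move=> /supp_f yK j; apply: le_trans (yK j) _.
  by apply: pow2_le; rewrite lerD2r.
have suppP y : f y != 0 -> dilate alpha P y.
  move=> /supp yk; apply: dilate_cell_near => j; rewrite !mxE.
  have := yk j; have := xm j; move: (ler_normB (y ord0 j) (x ord0 j)) => h0 h1 h2.
  apply: le_trans h0 _; lra.
have suppQ y : f y != 0 -> ~ dilate alpha Q y.
  move=> /supp yk /dilate_cell_small/(_ i); rewrite !mxE distrC.
  have := yk i; have := lerB_dist (x ord0 i) (y ord0 i) => h1 h2.
  have : 2 ^ (k + 1) / (8 * n.+1%:R) <= 2 ^ (k + 1) / 8 :> R.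
    rewrite ler_pM2l ?exprz_gt0 // lef_pV2 ?posrE ?mulr_gt0 // ler_peMr // ler1n //.
  move=> h3 h4; have := le_trans h4 h3; move: h1 h2 xi e1 e2 e3 k0.
  move: (2 ^ (k + 1)) (2 ^ (k - 1)) (2 ^ (k - 3)) (2 ^ k) => a1 a2 a3 a4; lra.
have f1 : inLp 1 setT f.
  have -> : f = cutoff f setT by apply/funext => y; rewrite cutoffE in_setT.
  exact: inLp1_support.
apply: starU => //; first by rewrite mulr_ge0 // am_ge0.
move=> e e0; have [C [CD Cout Cex]] := exhaustion x gridD e0.
exists (fun i => union_cubes (C i)); split => // j.
  by have [_ /measurable_union_cubes] := CD j.
rewrite (@eq_cutoff _ ((union_cubes (C j) `&` dilate alpha P) `\` dilate alpha Q)).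
  apply: g3 => //; [exact: cell_in|exact: cell_in| |exact: cell_ratio|exact: mem_cell].
  by apply/cell_mono/pow2_le => //; rewrite gerBl.
by move=> y fy; split => [h|[[]]//]; split; [split => //; exact: suppP|exact: suppQ].
Qed.

End pointwise.

(** * Far cells, constants and the final estimate *)

Section assembly.
Variables (R : realType) (n : nat).
Local Notation Rn := 'rV[R]_n.
Local Notation mu := (lebesgue_rV R n).

Lemma sparse_operator_ge0 s S f (x : Rn) : inLp s setT f -> (0 <= sparse_operator s S f x)%E.
Proof.
move=> fs; apply: esum_ge0 => Q _.
by rewrite mule_ge0 ?lee_fin // avg_am // lee_fin am_ge0.
Qed.

Lemma sparse_le eta eta' (S : set (cube R n)) : eta' <= eta -> sparse eta S -> sparse eta' S.
Proof.
move=> ee [E [tE hE]]; exists E; split => // Q /hE[mE EQ le]; split => //.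
by apply: le_trans le; apply: lee_wpmul2r; rewrite ?lee_fin.
Qed.

Lemma compact_support_bound (f : Rn -> R[i]) : compact (fsupp f) ->
  exists K : int, forall y, f y != 0 -> supb (2 ^ (K - 3)) y.
Proof.
move=> /compact_bounded[M [_ hM]].
have M0 : 0 < `|M| + 1 by rewrite ltr_wpDl.
have [k [hk _]] := exists_pow2 M0.
exists (k + 3) => y fy; rewrite addrK => i; apply: le_trans hk.
have : `|y| <= `|M| + 1.
  apply: hM; last exact: subset_closure.
  by rewrite (le_lt_trans (ler_norm M)) // ltrDl.
apply: le_trans; rewrite [leRHS]mx_normrE.
by rewrite (le_trans _ (le_bigmax _ _ (ord0, i))).
Qed.

Section modulated.
Variables (A : Type) (phi : A -> Rn -> R) (T : (Rn -> R[i]) -> Rn -> R[i]).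

Lemma max_modulated_ge0 f x : inhabited A -> (0 <= max_modulated phi T f x)%E.
Proof.
move=> [a]; apply: ereal_sup_ge; exists (ComplexField.Normc.normc (T (modulation phi a f) x))%:E.
  by exists a.
by rewrite lee_fin normc_ge0.
Qed.

(** Otherwise the exceptional set of the zero function on the unit cube would be the entire cube,
    against W_q at [1/2]. *)
Lemma W_property_inhabited q : 1 <= q -> W_property q (max_modulated phi T) -> inhabited A.
Proof.
move=> q1 [psi [_ hW]]; apply: contrapT => nA.
have q0 : q != 0 by rewrite gt_eqF // (lt_le_trans ltr01).
pose Q : cube R n := Cube 0 ltr01; have mQ : measurable (cube_set Q) by exact: measurable_cube.
have z0 (B : set Rn) : inLp q B (fun=> 0).
  split; first by split; exact: measurable_cst.
  rewrite ComplexField.Normc.normc0 powR0 // integral0 ltry //.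
have h2 : 0 < (2^-1 : R) < 1 by rewrite invr_gt0 ltr0Sn invf_lt1 // ltr1n.
have := hW Q (fun=> 0) 2^-1 (z0 _) h2; rewrite avg_am //.
rewrite (_ : _ `&` _ = cube_set Q); last first.
  apply/seteqP; split => [y []//|y Qy]; split => //=.
  rewrite /max_modulated (_ : [set _ | _ in _] = set0) ?ereal_sup0 ?ltry //.
  by rewrite -subset0 => z [a]; case: nA; exists.
have -> : mu_ext mu (cube_set Q) = (side Q ^+ n)%:E.
  by rewrite measurable_mu_extE //; exact: mu_cube.
rewrite mu_cube -EFinM lee_fin expr1n mulr1.
by case/andP: h2 => _; rewrite ltNge => /negP.
Qed.

End modulated.

Section far.
Variables (alpha s : R) (alpha0 : 0 < alpha) (alpha_ge3 : 3 <= alpha) (s_ge1 : 1 <= s).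
Variables (N : nat) (D : 'I_N.+1 -> set (cube R n)).
Hypothesis gridD : forall j, dyadic_grid (D j).
Variable L : nat.
Hypothesis coverL : forall k x, exists j,
  dilate alpha (cell (D ord0) k x) `<=`
    cube_set (cell (D j) (k + L%:Z) (corner (cell (D ord0) k x))).
Variables (S : 'I_N.+1 -> set (cube R n)) (f : Rn -> R[i]) (fs : inLp s setT f).

(** The dilated cell at [x] contains the origin, as its side exceeds [2 ^ k]. Its covering cell is
    therefore one around the origin and lies in the far cell of level [k + L + 4], whose side is
    [2 ^ (3 + L)] times that of [P]; this gives the constant. *)
Lemma far_transfer (k : int) x : supb (2 ^ k) x ->
  (forall i, S i (cell (D i) (k + L%:Z + 4) 0)) ->
  ((am s f (dil alpha0 (cell (D ord0) (k + 1) x)))%:E <=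
   (2 ^+ ((3 + L) * n))%:E * \sum_(i < N.+1) sparse_operator s (S i) f x)%E.
Proof.
move=> xk hS; set P := cell (D ord0) (k + 1) x; have [j cov] := coverL (k + 1) x.
set R1 := cell (D j) _ _ in cov; set Q := cell (D j) (k + L%:Z + 4) 0.
have alpha1 : 1 <= alpha by apply: le_trans alpha_ge3; rewrite ler1n.
have P0 : dilate alpha P 0.
  apply: (in_dilate alpha_ge3 (mem_cell (gridD ord0) _ _) (M := 2 ^ k)).
    by move=> i; rewrite !mxE sub0r normrN.
  by rewrite side_cell //; apply: pow2_le; rewrite lerDl.
have R1E : R1 = cell (D j) (k + 1 + L%:Z) 0.
  exact: esym (cell_eq (gridD j) (cov _ P0)).
have PQ : dilate alpha P `<=` cube_set Q.
  apply: (subset_trans cov); rewrite R1E; apply/cell_mono/pow2_le => //.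
  by rewrite addrAC lerD2l.
have Qx : cube_set Q x by apply/PQ/sub_dilate => //; exact: mem_cell.
have h : am s f (dil alpha0 P) <= 2 ^+ ((3 + L) * n) * am s f Q.
  apply: le_am => //; first by rewrite dilE.
    by rewrite exprn_ege1 // ler1n.
  rewrite exprM -exprMn; apply: lerXn2r.
  - by rewrite nnegrE ltW // side_gt0.
  - by rewrite nnegrE mulr_ge0 ?(ltW (side_gt0 _)) // exprn_ge0.
  rewrite [side (dil _ _)]/= !side_cell //.
  have -> : k + L%:Z + 4 = k + 1 + (3 + L)%N%:Z by rewrite PoszD; ring.
  rewrite (expfzDr (k + 1)) ?pnatr_eq0 // -exprnP mulrC ler_pM2l ?exprn_gt0 //.
  by rewrite ler_peMl // exprz_ge0.
have op : ((am s f Q)%:E <= \sum_(i < N.+1) sparse_operator s (S i) f x)%E.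
  have opj : ((am s f Q)%:E <= sparse_operator s (S j) f x)%E.
    have := @le_sum_esum R _ (S j) (fun Q => avg s Q f * (\1_(cube_set Q) x)%:E)%E [:: Q] isT.
    rewrite big_seq1 avg_am // indicE mem_set // mule1; apply=> t.
    by rewrite inE => /eqP ->; exact: hS.
  apply: (le_trans opj); rewrite (bigD1 j) //= leeDl // sume_ge0 // => i _.
  exact: sparse_operator_ge0.
apply: (@le_trans _ _ (2 ^+ ((3 + L) * n) * am s f Q)%:E); first by rewrite lee_fin.
by rewrite EFinM; apply: lee_wpmul2l => //; rewrite lee_fin exprn_ge0.
Qed.

End far.
End assembly.

Theorem proposition2p4 (R : realType) (n : nat) (n_gt0 : (0 < n)%N)
    (D : 'I_n.+1 -> set (cube R n))
    (dyadicD : forall j, dyadic_grid (D j)) (coverD : covering_grids D)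
    (T : ('rV[R]_n -> R[i]) -> 'rV[R]_n -> R[i])
    (K : 'rV[R]_n -> 'rV[R]_n -> R[i])
    (rho : \bar R) (rho_ge1 : (1 <= rho)%E)
    (TK : singular_integral T K rho)
    (A : Type) (phi : A -> 'rV[R]_n -> R)
    (mphi : forall th, measurable_fun setT (phi th : _ -> measurableTypeR R))
    (sublinearTF : sublinear (max_modulated phi T))
    (q r : R) (q_ge1 : 1 <= q) (r_ge1 : 1 <= r)
    (WTF : W_property q (max_modulated phi T))
    (alpha : R) (alpha_ge3 : 3 <= alpha)
    (sharpTF : weak_type r (sharp_maximal (max_modulated phi T) alpha)) :
  let s := Num.max q r in
  exists C : R, forall f : 'rV[R]_n -> R[i],
    inLp s setT f -> compact (fsupp f) ->
    exists S : 'I_n.+1 -> set (cube R n),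
      (forall j, S j `<=` D j /\ sparse (2 * alpha ^+ n)^-1 (S j)) /\
      {ae lebesgue_rV R n, forall x,
        (`|max_modulated_star phi K f x|
         <= C%:E * \sum_(j < n.+1) sparse_operator s (S j) f x)%E}.
Proof.
move=> s; have qs : q <= s by rewrite le_max lexx.
have rs : r <= s by rewrite le_max lexx orbT.
have s_ge1 : 1 <= s by exact: le_trans qs.
have alpha_ge1 : 1 <= alpha by apply: le_trans alpha_ge3; rewrite ler1n.
have alpha0 : 0 < alpha by exact: lt_le_trans alpha_ge1.
(* On an empty index set the supremum is -oo, of absolute value +oo. *)
have A0 := W_property_inhabited q_ge1 WTF.
set U := max_modulated phi T in sublinearTF WTF sharpTF.
have U_ge0 f x : (0 <= U f x)%E by exact: max_modulated_ge0.
have [L coverL] := cover_level alpha0 alpha_ge1 ord0 dyadicD coverD n_gt0.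
have th0 : 0 < dens_threshold R n / 2 by rewrite divr_gt0 // th_gt0.
have [C1 C1_ge1 local] := local_decomposition n_gt0 U_ge0 sublinearTF q_ge1 r_ge1 qs rs
  WTF sharpTF alpha0 alpha_ge1 dyadicD coverL th0.
have [b b_large] : exists b : nat, 8 * alpha * n.+1%:R <= 2 ^+ b.
  have h0 : 0 <= 8 * alpha * n.+1%:R by rewrite !mulr_ge0 // ltW.
  have := archi_boundP h0; set b := Num.bound _ => h; exists b.
  by apply: le_trans (ltW h) _; rewrite -natrX ler_nat ltnW // ltn_expl.
have rho0 : 0 < (alpha * 2 ^+ b) ^+ n by rewrite exprn_gt0 // mulr_gt0 // exprn_gt0.
have [C2 C2_ge0 annulus] := annulus_am U_ge0 q_ge1 r_ge1 qs rs WTF sharpTF alpha0 alpha_ge1 rho0.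
have C1_ge0 : 0 <= C1 by exact: le_trans C1_ge1.
pose Cn := (C1 + C2 * C1) * transfer_const R n L; pose Cf := C2 * 2 ^+ ((3 + L) * n).
have Cn0 : 0 <= Cn by rewrite !mulr_ge0 ?addr_ge0 ?mulr_ge0 // exprn_ge0.
have Cf0 : 0 <= Cf by rewrite mulr_ge0 // exprn_ge0.
exists (Cn + Cf) => f fs /compact_support_bound[K0 supp_f].
have [E [mE Ele good]] := local f fs.
have [S [SD near far]] := sparse_transfer n_gt0 alpha0 alpha_ge1 s_ge1 dyadicD coverL K0 mE Ele fs.
have chain := ae_chain U_ge0 sublinearTF alpha_ge1 s_ge1 (dyadicD ord0) mE Ele fs C1_ge1 good.
have star := fun f x Y => @max_modulated_star_le R n A phi mphi T K rho f x Y TK A0.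
exists S; split.
  move=> j; have [SjD Sj] := SD j; split => //; apply: sparse_le Sj.
  (* The families are 1/4-sparse, and [4 <= 2 * alpha ^+ n] because [alpha >= 3] and [n > 0]. *)
  have a3 : alpha <= alpha ^+ n by rewrite -[leLHS]expr1; apply: ler_weXn2l.
  rewrite lef_pV2 ?posrE ?mulr_gt0 ?exprn_gt0 //; lra.
have gd := ae_good (alpha0 := alpha0) U_ge0 sublinearTF s_ge1 (dyadicD ord0) fs
  (fun P Q => annulus f Q P ^~ fs) supp_f chain.
apply: filterS gd => x gx.
have op0 : (0 <= \sum_(j < n.+1) sparse_operator s (S j) f x)%E.
  by apply: sume_ge0 => j _; exact: sparse_operator_ge0.
have [xK|xK] := pselect (supb (2 ^ (K0 - 1)) x).
  have xL : supb (2 ^ (K0 + L%:Z)) x.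
    by move=> i; apply: le_trans (xK i) _; apply: pow2_le; rewrite lerD2l (@le_trans _ _ 0).
  apply: le_trans (near_bound star alpha_ge3 s_ge1 (dyadicD ord0) fs C1_ge1 C2_ge0 b_large supp_f
    gx xK (fun d => near x d xL)) _.
  rewrite muleA -EFinM; apply: lee_wpmul2r => //; rewrite lee_fin lerDl //.
have [k [Kk xk bk]] := far_bound star alpha_ge3 s_ge1 (dyadicD ord0) fs C2_ge0 b_large supp_f gx xK.
apply: (le_trans bk); rewrite EFinM.
have Sk i : S i (cell (D i) (k + L%:Z + 4) 0) by apply: far; rewrite !lerD2r.
apply: le_trans (lee_wpmul2l _ (far_transfer alpha0 alpha_ge3 s_ge1 dyadicD coverL fs xk Sk)) _.
  by rewrite lee_fin.
by rewrite muleA -EFinM; apply: lee_wpmul2r => //; rewrite lee_fin lerDr.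
Qed.
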